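(* Let $n\ge 1$, let $\lambda_j,\sigma_j,\tau_j\in\mathbb C$ for $j=1,\dots,n$, and put $\lambda_{n+1}=\sigma_{n+1}=\tau_{n+1}=0$. Assume that $\operatorname{Re}(\lambda_k-n-k+1)>0$ and $\operatorname{Re}(\sigma_k+\tau_k-\lambda_k-n+k)>0$ for $k=1,\dots,n$. Then $$\int_{T+S\in W_n(\mathbb C)}\prod_{j=1}^n\frac{\det[T]_j^{\lambda_j-\lambda_{j+1}}}{\det[1+T+S]_j^{\{\sigma_j-\sigma_{j+1}\|\tau_j-\tau_{j+1}\}}}\,\det T^{-2n}\,dT\,dS=\prod_{k=1}^n 2^{2(n-k+1)-\sigma_k-\tau_k}\,\pi^{2k-1}\,\frac{\Gamma(\lambda_k-n-k+1)\,\Gamma(\sigma_k+\tau_k-\lambda_k-n+k)}{\Gamma(\sigma_k-n+k)\,\Gamma(\tau_k-n+k)} .$$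
   Context: $W_n(\mathbb C)$ is the set of complex $n\times n$ matrices $R$ that are dissipative, i.e. $R+R^*$ is positive definite. Each $R$ is written $R=T+S$ with $T=T^*$ positive definite and $S=-S^*$; the integral is over all such pairs $(T,S)$. $[A]_j$ denotes the left upper $j\times j$ block of $A$; $\det[A]_j^{a}$ means the power $a$ of $\det[A]_j$. For a complex dissipative matrix $R$ with eigenvalues $\mu_1,\dots,\mu_m$ (which have positive real parts), $\det R^{\{\sigma\|\tau\}}:=\det R^{\sigma}\,\overline{\det R}^{\,\tau}=\exp\{\sigma\sum_j\ln\mu_j+\tau\sum_j\overline{\ln\mu_j}\}$ with the principal logarithm. Lebesgue measures: $dT=\prod_k dt_{kk}\prod_{k<m}d\operatorname{Re}t_{km}\,d\operatorname{Im}t_{km}$; $dS=\prod_k dc_k\prod_{k<m}d\operatorname{Re}s_{km}\,d\operatorname{Im}s_{km}$, where $s_{kk}=ic_k$, $c_k\in\mathbb R$. *)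

(* Defs.v *)
From HB Require Import structures.
From mathcomp Require Import all_boot all_order all_algebra.
From mathcomp Require Import all_classical all_reals all_analysis.
From mathcomp Require Import complex.
Set Implicit Arguments.
Unset Strict Implicit.
Unset Printing Implicit Defensive.
Import Order.TTheory GRing.Theory Num.Theory.
Import numFieldNormedType.Exports.

Local Open Scope classical_set_scope.
Local Open Scope ring_scope.
Local Open Scope complex_scope.
Local Open Scope sesquilinear_scope.

Section cons_measure.
Context (R : realType) (d : nat).
Variable m : {sigma_finite_measure set (d.-tuple R) -> \bar R}.

Definition tcons (xt : R * d.-tuple R) : d.+1.-tuple R :=
  [tuple of xt.1 :: xt.2].

Lemma measurable_tcons : measurable_fun [set: R * d.-tuple R] tcons.
Proof. exact: measurable_cons. Qed.

Definition cons_measure : set (d.+1.-tuple R) -> \bar R :=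
  pushforward (@lebesgue_measure R \x m)%E tcons.

Let cons_measure0 : cons_measure set0 = 0%E.
Proof. by rewrite /cons_measure /pushforward preimage_set0 measure0. Qed.

Let cons_measure_ge0 A : (0 <= cons_measure A)%E.
Proof. by apply: integral_ge0 => x _; exact: measure_ge0. Qed.

Let cons_measure_sigma_additive : semi_sigma_additive cons_measure.
Proof.
move=> F mF tF mUF; rewrite /cons_measure /pushforward preimage_bigcup.
apply: measure_semi_sigma_additive.
- by move=> n; rewrite -[X in measurable X]setTI; exact: measurable_tcons.
- apply/trivIsetP => /= i j _ _ ij; rewrite -preimage_setI.
  by move/trivIsetP : tF => /(_ _ _ _ _ ij) ->//; rewrite preimage_set0.
- by rewrite -preimage_bigcup -[X in measurable X]setTI; exact: measurable_tcons.
Qed.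

HB.instance Definition _ := isMeasure.Build _ _ _ cons_measure
  cons_measure0 cons_measure_ge0 cons_measure_sigma_additive.

Lemma preimage_tcons_box (A : set R) (B : set (d.-tuple R)) :
  tcons @^-1` [set t | A (thead t) /\ B [tuple of behead t]] = A `*` B.
Proof.
apply/seteqP; split=> -[x t]; rewrite /tcons /= theadE;
  by rewrite (_ : [tuple of behead (x :: t)] = t)//; exact/val_inj.
Qed.

Lemma measurable_tuple_box (A : set (measurableTypeR R)) (B : set (d.-tuple R)) :
  measurable A -> measurable B ->
  measurable [set t : d.+1.-tuple R | A (thead t) /\ B [tuple of behead t]].
Proof.
move=> mA mB.
have mh := @measurable_tnth _ (measurableTypeR R) d.+1 ord0.
have mb := @measurable_behead _ (measurableTypeR R) d.
rewrite (_ : mkset _ = ((fun t : d.+1.-tuple R => thead t) @^-1` A) `&`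
   ((fun t : d.+1.-tuple R => [tuple of behead t]) @^-1` B))//.
apply: measurableI.
  by rewrite -[X in measurable X]setTI; exact: mh.
by rewrite -[X in measurable X]setTI; exact: mb.
Qed.

Lemma cons_measure_box (A : set (measurableTypeR R)) (B : set (d.-tuple R)) :
  measurable A -> measurable B ->
  cons_measure [set t | A (thead t) /\ B [tuple of behead t]] =
  (lebesgue_measure A * m B)%E.
Proof.
by move=> mA mB; rewrite /cons_measure /pushforward preimage_tcons_box
  product_measure1E.
Qed.

Let cons_measure_sigma_finite : sigma_finite setT cons_measure.
Proof.
have /sigma_finiteP[F [TF ndF Foo]] := sigma_finiteT (@lebesgue_measure R).
have /sigma_finiteP[G [TG ndG Goo]] := sigma_finiteT m.
exists (fun k => [set t : d.+1.-tuple R |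
                   F k (thead t) /\ G k [tuple of behead t]]).
  apply/seteqP; split => // t _.
  have [i _ Fi] : (\bigcup_k F k) (thead t) by rewrite -TF.
  have [j _ Gj] : (\bigcup_k G k) [tuple of behead t] by rewrite -TG.
  exists (maxn i j) => //; split.
    by move: Fi; exact/subsetPset/ndF/leq_maxl.
  by move: Gj; exact/subsetPset/ndG/leq_maxr.
move=> k; have [mF Foo'] := Foo k; have [mG Goo'] := Goo k.
split; first exact: measurable_tuple_box.
by rewrite cons_measure_box// lte_mul_pinfty// ge0_fin_numE.
Qed.

HB.instance Definition _ := Measure_isSigmaFinite.Build _ _ _ cons_measure
  cons_measure_sigma_finite.

End cons_measure.

(* Lebesgue measure on R^d, with R^d realized as d.-tuple R: the image of
   lebesgue_measure \x (Lebesgue measure on R^(d-1)) under (x, t) |-> x :: t. *)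
Fixpoint lebesgue_tuple (R : realType) (d : nat) :
    {sigma_finite_measure set (d.-tuple R) -> \bar R} :=
  match d with
  | 0 => \d_ [tuple]
  | d'.+1 => cons_measure (lebesgue_tuple R d')
  end.

Lemma lebesgue_tuple_box (R : realType) (d : nat)
    (A : 'I_d -> set (measurableTypeR R)) :
  (forall i, measurable (A i)) ->
  lebesgue_tuple R d [set t | forall i, A i (tnth t i)] =
  (\prod_(i < d) lebesgue_measure (A i))%E.
Proof.
elim: d A => [|d IH] A mA.
  by rewrite big_ord0 /= diracE mem_set// => -[].
rewrite big_ord_recl -(IH (fun i => A (lift ord0 i)))//=.
rewrite -cons_measure_box//; last first.
  rewrite (_ : mkset _ = \bigcap_(i in [set: 'I_d])
     ((fun t : d.-tuple R => tnth t i) @^-1` A (lift ord0 i))); last first.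
    by apply/seteqP; split=> t h i; [move=> _; exact: (h i)|exact: (h i I)].
  apply: fin_bigcap_measurable => // i _.
  rewrite -[X in measurable X]setTI.
  exact: (@measurable_tnth _ (measurableTypeR R) d i).
congr (cons_measure _ _); apply/seteqP; split=> t /=.
  move=> h; split; first exact: h.
  by move=> i; have := h (lift ord0 i); rewrite {1}(tuple_eta t) tnthS.
move=> [h0 h] i; case: (unliftP ord0 i) => [j ->|->]//.
by have := h j; rewrite [in X in _ -> X](tuple_eta t) tnthS.
Qed.

Section complex_functions.
Variable R : realType.
Implicit Types z a : R[i].

Definition cexp z : R[i] :=
  (expR (complex.Re z))%:C * (cos (complex.Im z) +i* sin (complex.Im z)).

(* Principal argument, in ]-pi, pi] for z != 0. *)
Definition carg z : R :=
  let phi := acos (complex.Re z / ComplexField.Normc.normc z) in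
  if 0 <= complex.Im z then phi else - phi.

(* Principal logarithm (only meaningful for z != 0). *)
Definition clog z : R[i] := ln (ComplexField.Normc.normc z) +i* carg z.

Definition cpow z a : R[i] := cexp (a * clog z).

Lemma clogK z : z != 0 -> cexp (clog z) = z.
Proof.
case: z => x y z0; rewrite /cexp /clog /=.
set r := Num.sqrt _.
have r0 : 0 < r.
  rewrite sqrtr_gt0; move: z0; rewrite eq_complex /= negb_and.
  by case/orP => h; [rewrite ltr_wpDr|rewrite ltr_wpDl];
    rewrite ?sqr_ge0// exprn_even_gt0.
have r2 : r ^+ 2 = x ^+ 2 + y ^+ 2 by rewrite sqr_sqrtr// addr_ge0 ?sqr_ge0.
have xr : -1 <= x / r <= 1.
  rewrite -ler_norml normrM normfV (gtr0_norm r0) ler_pdivrMr// mul1r.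
  by rewrite -(ler_pXn2r (n:=2))// ?nnegrE ?(ltW r0)// real_normK ?num_real// r2
    lerDl sqr_ge0.
have sE : sin (acos (x / r)) = `|y| / r.
  rewrite sin_acos//.
  rewrite (_ : 1 - _ = (`|y| / r) ^+ 2); first by rewrite sqrtr_sqr ger0_norm//
    divr_ge0// ltW.
  rewrite !expr_div_n real_normK ?num_real//.
  have -> : y ^+ 2 = r ^+ 2 - x ^+ 2 by rewrite r2 addrC addKr.
  by rewrite mulrBl divff// expf_neq0// gt_eqF.
rewrite lnK ?posrE//; apply/eqP; rewrite /carg /= -/r.
case: (leP 0 y) => y0; rewrite ?cosN ?sinN acosK ?in_itv//= sE.
- by rewrite ger0_norm// eq_complex /= !mul0r subr0 addr0 !(mulrC r)
    !divfK ?eqxx// gt_eqF.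
- by rewrite ltr0_norm// eq_complex /= !mul0r subr0 addr0 mulNr opprK !(mulrC r)
    !divfK ?eqxx// gt_eqF.
Qed.

(* The eigenvalues of A, repeated according to algebraic multiplicity. *)
Definition eigenvals n (A : 'M[R[i]]_n) : seq R[i] :=
  sval (closed_field_poly_normal (char_poly A)).

(* det A^{s||t} = exp (s * sum of ln mu + t * sum of conj (ln mu)) over the
   eigenvalues mu. *)
Definition detpow n (A : 'M[R[i]]_n) (s t : R[i]) : R[i] :=
  cexp (s * (\sum_(mu <- eigenvals A) clog mu) +
        t * (\sum_(mu <- eigenvals A) (clog mu)^*)).

End complex_functions.

Section complex_integral.
Context d (X : measurableType d) (R : realType).
Variable mu : {measure set X -> \bar R}.
Implicit Types (D : set X) (f : X -> R[i]).

Definition cintegrable D f : Prop :=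
  mu.-integrable D (fun x => (complex.Re (f x))%:E) /\
  mu.-integrable D (fun x => (complex.Im (f x))%:E).

Definition cintegral D f : R[i] :=
  (\int[mu]_(x in D) complex.Re (f x)) +i* (\int[mu]_(x in D) complex.Im (f x)).

End complex_integral.

(* Euler's integral, continued to all z by
     Gamma z = Gamma (z + m) / (z (z + 1) ... (z + m - 1)),
   where m is large enough for Re (z + m) > 0, and m = 0 if Re z > 0. At the
   poles the denominator vanishes and the value is 0, so (Gamma z)^-1 is the
   entire function 1 / Gamma everywhere. *)
Definition Gamma (R : realType) (z : R[i]) : R[i] :=
  let m := Num.truncn (1 - complex.Re z) in
  cintegral (@lebesgue_measure R) `]0, +oo[
    (fun t : R => cpow t%:C (z + m%:R - 1) * (expR (- t))%:C)
  / \prod_(k < m) (z + k%:R).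

Section matrices.
Variable R : realType.

Definition posdefmx n (A : 'M[R[i]]_n) : Prop :=
  A \is hermsymmx /\
  forall v : 'cV[R[i]]_n, v != 0 -> 0 < (v ^t* *m A *m v) 0 0.

(* W_n(C), the set of dissipative n x n matrices. *)
Definition dissipative n : set 'M[R[i]]_n := [set A | posdefmx (A + A ^t*)].

(* With 0-based j : 'I_n this is [A]_(j+1), the left upper block of size j + 1. *)
Definition ulblock n (j : 'I_n) (A : 'M[R[i]]_n) : 'M[R[i]]_j.+1 :=
  mxsub (widen_ord (ltn_ord j)) (widen_ord (ltn_ord j)) A.

(* The n * n real coordinates of a Hermitian matrix T or an anti-Hermitian
   matrix S are arranged in a square array: position (k, k) holds t_kk, resp.
   c_k = s_kk / i; for k < m, position (k, m) holds the real part and position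
   (m, k) the imaginary part of the (k, m) entry. Under these two
   parametrizations dT and dS are the Lebesgue measure on R^(n * n). *)
Definition coord n (x : (n * n).-tuple R) (k m : 'I_n) : R :=
  tnth x (mxvec_index k m).

Definition herm_of n (x : (n * n).-tuple R) : 'M[R[i]]_n :=
  \matrix_(k, m)
    if k == m then (coord x k k)%:C
    else if (k < m)%N then coord x k m +i* coord x m k
    else coord x m k -i* coord x k m.

Definition skewherm_of n (x : (n * n).-tuple R) : 'M[R[i]]_n :=
  \matrix_(k, m)
    if k == m then 0 +i* coord x k k
    else if (k < m)%N then coord x k m +i* coord x m k
    else - coord x m k +i* coord x k m.

Let conjE (z : R[i]) : Num.conj z = conjc z. Proof. by []. Qed.

Lemma herm_ofP n (T : 'M[R[i]]_n) :
  T ^t* = T <-> exists x, T = herm_of x.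
Proof.
split=> [hT|[x ->]]; last first.
  apply/matrixP => k m; rewrite !mxE !conjE /= eq_sym.
  case: eqVneq => [->|km]; first by rewrite conjc_real.
  by case: ltngtP => /= [_|_|/val_inj mk]; rewrite ?opprK// mk eqxx in km *.
exists [tuple (let km := enum_val (cast_ord (esym (mxvec_cast n n)) i) in
  if (km.1 <= km.2)%N then complex.Re (T km.1 km.2)
  else complex.Im (T km.2 km.1)) | i < n * n].
apply/matrixP => k m; rewrite !mxE /coord !tnth_mktuple.
rewrite /mxvec_index !cast_ordK !enum_rankK /= !leqnn.
have := congr1 (fun A => fun_of_matrix A m k) hT; rewrite !mxE !conjE /=.
case: eqVneq => [<-|km].
  by case: (T k k) => a b [] /eqP; rewrite -subr_eq0 -opprD oppr_eq0 -mulr2n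
    mulrn_eq0 /= => /eqP ->.
case: ltngtP => [_|_|/val_inj mk]; last by rewrite mk eqxx in km.
all: by case: (T k m) => a b; case: (T m k) => a' b' /= [? ?]; subst a' b'; rewrite ?opprK.
Qed.

Lemma skewherm_ofP n (S : 'M[R[i]]_n) :
  S ^t* = - S <-> exists y, S = skewherm_of y.
Proof.
split=> [hS|[x ->]]; last first.
  apply/matrixP => k m; rewrite !mxE !conjE /= eq_sym.
  case: eqVneq => [->|km]; first by simpc.
  by case: ltngtP => /= [_|_|/val_inj mk]; [simpc|simpc|];
    rewrite ?opprK// mk eqxx in km *.
exists [tuple (let km := enum_val (cast_ord (esym (mxvec_cast n n)) i) in
  if (km.1 < km.2)%N then complex.Re (S km.1 km.2)
  else complex.Im (S km.2 km.1)) | i < n * n].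
apply/matrixP => k m; rewrite !mxE /coord !tnth_mktuple.
rewrite /mxvec_index !cast_ordK !enum_rankK /= !ltnn.
have := congr1 (fun A => fun_of_matrix A m k) hS; rewrite !mxE !conjE /=.
case: eqVneq => [<-|km].
  by case: (S k k) => a b [] /eqP; rewrite -subr_eq0 opprK -mulr2n
    mulrn_eq0 /= => /eqP ->.
case: ltngtP => [_|_|/val_inj mk]; last by rewrite mk eqxx in km.
all: by case: (S k m) => a b; case: (S m k) => a' b' /= [? /oppr_inj ?]; subst a b.
Qed.

End matrices.

(* Main.v *)
Require Import Defs.
From HB Require Import structures.
From mathcomp Require Import all_boot all_order all_algebra.
From mathcomp Require Import all_classical all_reals all_analysis.
From mathcomp Require Import complex measurable_realfun.
From mathcomp Require Import ring lra.
Set Implicit Arguments.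
Unset Strict Implicit.
Unset Printing Implicit Defensive.
Import Order.TTheory GRing.Theory Num.Theory.
Import numFieldNormedType.Exports.
Local Open Scope classical_set_scope.
Local Open Scope ring_scope.
Local Open Scope complex_scope.

(** The integral is computed by peeling off the last row and column of [T] and
    [S], and induction on the size.

    Let [Q = 1 + T + S], let primes denote the left upper blocks of size one
    less, [t] and [v] the last columns of [T] and [S] above the corner, and
    [tn] and [i sn] the corners. The quotients [r = det T / det T'] and
    [q = det Q / det Q'] are the Schur complements of [T'] and [Q'], that is, the
    last pivots of Gaussian elimination. Summation by parts in the exponents
    turns the integrand into a product, over the successive pivots, of
    [r ^ a * q ^ (- {s || t})] ([weight], [weight_integrand]), so that only one
    factor depends on [t], [v], [tn], [sn] when [T'] and [S'] are fixed. Positive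
    definiteness of [T] means that all the [r] are positive ([posd_recr]).

    The integral of that factor rests on the identity [Re_bschur]: with
    [H = 1 + T'],
      [Re q = 1 + r + N [t] + A [v - w]]
    where [N = T'^-1 - H^-1] and [A], the Hermitian part of [Q'^-1], are positive
    definite forms and [w] depends on [t] only. Integrating over [sn] is a
    one-dimensional integral along a vertical line (Cauchy's beta integral,
    [has_int_line]); over [v], and later [t], a power of a quadratic form
    ([has_int_quadratic]); over [r], Euler's beta integral
    ([beta_integral_scale]). Since [det A = det H / |det Q'| ^ 2] and
    [1 / det N = det T' * det H], the result is a constant times
    [|det Q'| ^ 2 * det T'] ([has_int_border]), and multiplying by it shifts the
    exponents of the remaining pivots by [1] in [a] and by [-1] in [s] and [t]
    ([weight_shift]). This closes the induction ([has_int_integrand]). Fubini's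
    theorem applies at each stage because the integrand is bounded by a constant
    times the same integrand with real exponents and [s = t], whose iterated
    integrals are given by the same formulas ([weight_bound]).

    The powers of [det Q] in the statement are defined by the logarithms of the
    eigenvalues, while the product over the pivots uses the logarithms of the
    pivots. Their sums agree ([logdet_pivot]): along the path [Q + y ^ 2] they
    differ by multiples of [2 pi i], continuously in [y], and for large [y] the
    arguments of the eigenvalues are small while that of the pivot is below
    [pi / 2].

    Cauchy's integral is found without contour integration: its recursion in
    [s] and [t] ([cintSl], [cintSr]) is that of the quotient of Gamma functions,
    and Laplace's method together with Gauss's limit for Gamma determines the
    solution ([cint_laplace], [Gamma_gauss], [cint_pos]). *)

(** * Complex exponential, logarithm and powers *)

Section complex_elementary.
Variable R : realType.
Implicit Types z w a s t : R[i].
Local Notation Re := (@complex.Re R).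
Local Notation Im := (@complex.Im R).
Local Notation normc := (@ComplexField.Normc.normc R).

Lemma complex_ext z w : Re z = Re w -> Im z = Im w -> z = w.
Proof. by case: z => a b; case: w => c d /= -> ->. Qed.

Lemma ReM z w : Re (z * w) = Re z * Re w - Im z * Im w.
Proof. by case: z w => [a b] [c d]. Qed.

Lemma ImM z w : Im (z * w) = Re z * Im w + Im z * Re w.
Proof. by case: z w => [a b] [c d]. Qed.

Lemma ReD z w : Re (z + w) = Re z + Re w.
Proof. by case: z w => [a b] [c d]. Qed.

Lemma ImD z w : Im (z + w) = Im z + Im w.
Proof. by case: z w => [a b] [c d]. Qed.

Lemma ReN z : Re (- z) = - Re z.
Proof. by case: z. Qed.

Lemma ImN z : Im (- z) = - Im z.
Proof. by case: z. Qed.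

Lemma ReC z : Re z^* = Re z.
Proof. by case: z. Qed.

Lemma ImC z : Im z^* = - Im z.
Proof. by case: z. Qed.

Lemma Re_nat n : Re n%:R = n%:R.
Proof. by rewrite -(rmorph_nat (real_complex R)). Qed.

Lemma Im_nat n : Im n%:R = 0.
Proof. by rewrite -(rmorph_nat (real_complex R)). Qed.

Lemma Re1 : Re 1 = 1. Proof. by []. Qed.
Lemma Im1 : Im 1 = 0. Proof. by []. Qed.

Definition ReE := (ReD, ReN, ReM, ReC, Re_nat, Re1).
Definition ImE := (ImD, ImN, ImM, ImC, Im_nat, Im1).

Lemma Re_sum I (r : seq I) (P : pred I) (F : I -> R[i]) :
  Re (\sum_(i <- r | P i) F i) = \sum_(i <- r | P i) Re (F i).
Proof. by elim/big_rec2: _ => // i x y _ <-; rewrite ReD. Qed.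

Lemma Im_sum I (r : seq I) (P : pred I) (F : I -> R[i]) :
  Im (\sum_(i <- r | P i) F i) = \sum_(i <- r | P i) Im (F i).
Proof. by elim/big_rec2: _ => // i x y _ <-; rewrite ImD. Qed.

Lemma sqr_normc z : normc z ^+ 2 = Re z ^+ 2 + Im z ^+ 2.
Proof. by case: z => a b; rewrite /= sqr_sqrtr// addr_ge0// sqr_ge0. Qed.

Lemma normc_ge0 z : 0 <= normc z.
Proof. by case: z => a b; exact: sqrtr_ge0. Qed.

Lemma normc_gt0 z : (0 < normc z) = (z != 0).
Proof.
rewrite lt_def normc_ge0 andbT; apply/idP/idP; apply: contra_neq.
  by move=> ->; rewrite ComplexField.Normc.normc0.
exact: ComplexField.Normc.eq0_normc.
Qed.

Lemma normc_real (x : R) : normc x%:C = `|x|.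
Proof. by rewrite /= expr0n /= addr0 sqrtr_sqr. Qed.

Lemma Re_le_normc z : `|Re z| <= normc z.
Proof.
rewrite -(ler_pXn2r (n:=2))// ?nnegrE ?normc_ge0// sqr_normc real_normK ?num_real//.
by rewrite lerDl sqr_ge0.
Qed.

Lemma Im_le_normc z : `|Im z| <= normc z.
Proof.
rewrite -(ler_pXn2r (n:=2))// ?nnegrE ?normc_ge0// sqr_normc real_normK ?num_real//.
by rewrite lerDr sqr_ge0.
Qed.

Lemma Re_neq0 z : 0 < Re z -> z != 0.
Proof. by move=> z0; apply/eqP => zE; move: z0; rewrite zE ltxx. Qed.

Lemma mulcJ z : z * z^* = ((normc z) ^+ 2)%:C.
Proof.
by rewrite sqr_normc; case: z => a b; apply: complex_ext => /=; ring.
Qed.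

Lemma ReV z : Re z^-1 = Re z / normc z ^+ 2.
Proof. by rewrite sqr_normc; case: z. Qed.

Lemma ImV z : Im z^-1 = - Im z / normc z ^+ 2.
Proof. by rewrite sqr_normc mulNr; case: z. Qed.

Lemma Re_cexp z : Re (cexp z) = expR (Re z) * cos (Im z).
Proof. by rewrite /cexp ReM /= mul0r subr0. Qed.

Lemma Im_cexp z : Im (cexp z) = expR (Re z) * sin (Im z).
Proof. by rewrite /cexp ImM /= mul0r addr0. Qed.

Lemma cexpD z w : cexp (z + w) = cexp z * cexp w.
Proof.
apply: complex_ext; rewrite ?(ReM (cexp z)) ?(ImM (cexp z)) !(Re_cexp,Im_cexp).
  by rewrite ReD ImD cosD expRD; ring.
by rewrite ReD ImD sinD expRD; ring.
Qed.

Lemma cexp_real (x : R) : cexp x%:C = (expR x)%:C.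
Proof.
apply: complex_ext; rewrite ?Re_cexp ?Im_cexp /=; first by rewrite cos0 mulr1.
by rewrite sin0 mulr0.
Qed.

Lemma cexp0 : cexp (0 : R[i]) = 1.
Proof. by rewrite -[0]/(0%:C) cexp_real expR0. Qed.

Lemma normc_cexp z : normc (cexp z) = expR (Re z).
Proof.
apply/eqP; rewrite -(eqrXn2 (n:=2))// ?normc_ge0 ?expR_ge0//; apply/eqP.
rewrite sqr_normc Re_cexp Im_cexp !exprMn -mulrDr.
by rewrite cos2Dsin2 mulr1.
Qed.

Lemma cexp_neq0 z : cexp z != 0.
Proof. by rewrite -normc_gt0 normc_cexp expR_gt0. Qed.

Lemma cexpN z : cexp (- z) = (cexp z)^-1.
Proof.
by apply: (mulfI (cexp_neq0 z)); rewrite -cexpD subrr cexp0 divff// cexp_neq0.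
Qed.

Lemma cexpJ z : cexp z^* = (cexp z)^*.
Proof.
apply: complex_ext; rewrite ?ReC ?ImC !(Re_cexp, Im_cexp) ReC ImC.
  by rewrite cosN.
by rewrite sinN mulrN.
Qed.

Lemma cexp_sum I (r : seq I) (P : pred I) (F : I -> R[i]) :
  cexp (\sum_(i <- r | P i) F i) = \prod_(i <- r | P i) cexp (F i).
Proof. by elim/big_rec2: _ => [|i x y _ <-]; rewrite ?cexp0 ?cexpD. Qed.

Lemma cexpMn z n : cexp (n%:R * z) = cexp z ^+ n.
Proof.
by elim: n => [|n IH]; rewrite ?mul0r ?cexp0// mulrSr mulrDl mul1r cexpD IH exprSr.
Qed.

(** On the right half-plane the principal logarithm is this expression, which
    unlike [clog] is visibly measurable and continuous. *)
Definition rlog z : R[i] := ln (normc z) +i* atan (Im z / Re z).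

Lemma rlog_clog z : 0 < Re z -> clog z = rlog z.
Proof.
case: z => x y /= x0; rewrite /clog /rlog /carg /=; congr (_ +i* _).
set r := Num.sqrt _.
have r2 : r ^+ 2 = x ^+ 2 + y ^+ 2 by rewrite sqr_sqrtr// addr_ge0 ?sqr_ge0.
have r0 : 0 < r by rewrite sqrtr_gt0 ltr_wpDr ?sqr_ge0// exprn_gt0.
have c : cos (atan (y / x)) = x / r.
  rewrite cos_atan; apply: invr_inj; rewrite invrK invf_div.
  apply/eqP; rewrite -(eqrXn2 (n:=2))// ?sqrtr_ge0 ?divr_ge0 ?ltW//; apply/eqP.
  rewrite sqr_sqrtr ?addr_ge0 ?sqr_ge0// !expr_div_n r2.
  by rewrite mulrDl divff// expf_neq0// gt_eqF.
have pi0 : pi / 2 <= pi :> R by have := pi_ge0 R; lra.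
have := atan_gtNpi2 (y / x); have := atan_ltpi2 (y / x).
rewrite -c => a1 a2; case: leP => y0.
  have a0 : 0 <= atan (y / x).
    by rewrite -[0]atan0; apply: (ltW_homo (@lt_atan R)) => //; rewrite divr_ge0// ltW.
  by rewrite cosK// in_itv/= a0/=; lra.
have a0 : atan (y / x) <= 0.
  by rewrite -[0]atan0; apply: (ltW_homo (@lt_atan R)) => //; rewrite mulr_le0_ge0 ?invr_ge0 ?ltW.
by rewrite cosKN ?opprK// a0 andbT; lra.
Qed.

Lemma cexp_rlog z : 0 < Re z -> cexp (rlog z) = z.
Proof. by move=> z0; rewrite -rlog_clog// clogK// Re_neq0. Qed.

Lemma rlog_real (x : R) : 0 < x -> rlog x%:C = (ln x)%:C.
Proof. by move=> x0; rewrite /rlog /= expr0n addr0 sqrtr_sqr gtr0_norm// mul0r atan0. Qed.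

Lemma rlogZ (x : R) z : 0 < x -> z != 0 -> rlog (x%:C * z) = (ln x)%:C + rlog z.
Proof.
move=> x0; rewrite -normc_gt0 => z0; rewrite /rlog.
rewrite ComplexField.Normc.normcM normc_real gtr0_norm// lnM ?posrE//.
apply: complex_ext => //; rewrite ImD ReM ImM /= !mul0r addr0 subr0 add0r.
by rewrite -mulf_div divff ?gt_eqF// mul1r.
Qed.

Lemma normc_rlog_arg z : `|Im (rlog z)| < pi / 2.
Proof. by rewrite /rlog/= ltr_norml atan_gtNpi2 atan_ltpi2. Qed.

End complex_elementary.

(** The power [cpow x a] of a real base [x > 0]; locked because rewriting modulo
    associativity would otherwise see the product inside [cexp]. *)
HB.lock Definition rpow (R : realType) (x : R) (a : R[i]) : R[i] := cexp (a * (ln x)%:C).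

Section real_base_power.
Variable R : realType.
Implicit Types a b : R[i].
Local Notation Re := (@complex.Re R).
Local Notation normc := (@ComplexField.Normc.normc R).

Lemma rpowE x a : rpow x a = cexp (a * (ln x)%:C).
Proof. by rewrite rpow.unlock. Qed.

Implicit Types x y : R.

Lemma rpow_cpow x a : 0 < x -> cpow x%:C a = rpow x a.
Proof. by move=> x0; rewrite rpowE /cpow rlog_clog// rlog_real. Qed.

Lemma rpowD x a b : rpow x (a + b) = rpow x a * rpow x b.
Proof. by rewrite !rpowE mulrDl cexpD. Qed.

Lemma rpowN x a : rpow x (- a) = (rpow x a)^-1.
Proof. by rewrite !rpowE mulNr cexpN. Qed.

Lemma rpow0 x : rpow x 0 = 1.
Proof. by rewrite !rpowE mul0r cexp0. Qed.

Lemma rpow1 x : 0 < x -> rpow x 1 = x%:C.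
Proof. by move=> x0; rewrite !rpowE mul1r cexp_real lnK. Qed.

Lemma rpow_nat x n : 0 < x -> rpow x n%:R = (x ^+ n)%:C.
Proof. by move=> x0; rewrite !rpowE cexpMn cexp_real lnK// rmorphXn. Qed.

Lemma rpow1l a : rpow 1 a = 1.
Proof. by rewrite !rpowE ln1 mulr0 cexp0. Qed.

Lemma rpow_neq0 x a : rpow x a != 0.
Proof. by rewrite rpowE cexp_neq0. Qed.

Lemma rpowM x y a : 0 < x -> 0 < y -> rpow (x * y) a = rpow x a * rpow y a.
Proof. by move=> x0 y0; rewrite !rpowE lnM// raddfD mulrDr cexpD. Qed.

Lemma rpowV x a : 0 < x -> rpow x^-1 a = rpow x (- a).
Proof. by move=> x0; rewrite !rpowE lnV// raddfN mulrN mulNr. Qed.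

Lemma normc_rpowE x a : normc (rpow x a) = expR (Re a * ln x).
Proof. by rewrite !rpowE normc_cexp ReM /= mulr0 subr0. Qed.

Lemma rpow_realE x (b : R) : rpow x b%:C = (expR (b * ln x))%:C.
Proof. by rewrite !rpowE -rmorphM cexp_real. Qed.

End real_base_power.

(** * Measurability and integration of complex functions *)

Section complex_measurable.
Context d (X : measurableType d) (R : realType).
Implicit Types f g : X -> R[i].
Local Notation Re := (@complex.Re R).
Local Notation Im := (@complex.Im R).
Local Notation normc := (@ComplexField.Normc.normc R).

Definition cmeas f :=
  measurable_fun [set: X] (fun x => Re (f x)) /\
  measurable_fun [set: X] (fun x => Im (f x)).

Lemma cmeas_cst c : cmeas (fun=> c).
Proof. by split; exact: measurable_cst. Qed.

Lemma cmeas_real (h : X -> R) :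
  measurable_fun [set: X] h -> cmeas (fun x => (h x)%:C).
Proof. by move=> mh; split => //=; exact: measurable_cst. Qed.

Lemma cmeasN f : cmeas f -> cmeas (fun x => - f x).
Proof.
move=> [f1 f2]; split; [under eq_fun do rewrite ReN|under eq_fun do rewrite ImN];
  exact: measurableT_comp.
Qed.

Lemma cmeasJ f : cmeas f -> cmeas (fun x => (f x)^*).
Proof.
move=> [f1 f2]; split; [by under eq_fun do rewrite ReC|under eq_fun do rewrite ImC].
exact: measurableT_comp.
Qed.

Lemma cmeasD f g : cmeas f -> cmeas g -> cmeas (fun x => f x + g x).
Proof.
move=> [f1 f2] [g1 g2]; split;
  [under eq_fun do rewrite ReD|under eq_fun do rewrite ImD];
  exact: measurable_funD.
Qed.

Lemma cmeasB f g : cmeas f -> cmeas g -> cmeas (fun x => f x - g x).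
Proof. by move=> mf mg; apply: cmeasD => //; exact: cmeasN. Qed.

Lemma cmeasM f g : cmeas f -> cmeas g -> cmeas (fun x => f x * g x).
Proof.
move=> [f1 f2] [g1 g2]; split.
  under eq_fun do rewrite ReM.
  by apply: measurable_funB; exact: measurable_funM.
under eq_fun do rewrite ImM.
by apply: measurable_funD; exact: measurable_funM.
Qed.

Lemma measurable_continuous_comp (h : R -> R) (k : X -> R) : continuous h ->
  measurable_fun [set: X] k -> measurable_fun [set: X] (fun x => h (k x)).
Proof.
move=> ch mk; apply: (@measurableT_comp _ _ _ _ _ _ h _ k) => //.
exact: continuous_measurable_fun.
Qed.

Lemma measurable_invr : measurable_fun [set: R] (@GRing.inv R).
Proof.
rewrite (_ : GRing.inv = fun x : R => x * (x ^+ 2) `^ (-1)).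
  apply: measurable_funM; first exact: measurable_id.
  apply: (@measurableT_comp _ _ _ _ _ _ (fun y : R => y `^ (-1)) _ (fun x : R => x ^+ 2)).
    exact: measurable_powR.
  by apply: measurable_funX; exact: measurable_id.
apply/funext => x; have [->|x0] := eqVneq x 0; first by rewrite invr0 mul0r.
by rewrite powR_inv1 ?sqr_ge0// expr2 invfM mulrA divff// mul1r.
Qed.

Lemma measurable_normc f : cmeas f -> measurable_fun [set: X] (fun x => normc (f x)).
Proof.
move=> [f1 f2].
rewrite (_ : (fun x => _) = fun x => Num.sqrt (Re (f x) ^+ 2 + Im (f x) ^+ 2)).
  apply: measurable_continuous_comp; first exact: sqrt_continuous.
  by apply: measurable_funD; exact: measurable_funX.
by apply/funext => x; case: (f x).
Qed.

Lemma cmeasV f : cmeas f -> cmeas (fun x => (f x)^-1).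
Proof.
move=> mf; have mn := measurable_normc mf; case: mf => f1 f2; split.
  under eq_fun do rewrite ReV.
  apply: measurable_funM => //; apply: measurableT_comp; first exact: measurable_invr.
  exact: measurable_funX.
under eq_fun do rewrite ImV.
apply: measurable_funM; first exact: measurableT_comp.
by apply: measurableT_comp; [exact: measurable_invr|exact: measurable_funX].
Qed.

Lemma cmeas_sum I (r : seq I) (P : pred I) (F : I -> X -> R[i]) :
  (forall i, P i -> cmeas (F i)) -> cmeas (fun x => \sum_(i <- r | P i) F i x).
Proof.
move=> mF; elim: r => [|i r IH].
  by under eq_fun do rewrite big_nil; exact: cmeas_cst.
under eq_fun do rewrite big_cons.
by case Pi: (P i) => //; apply: cmeasD => //; exact: mF.
Qed.

Lemma cmeas_prod I (r : seq I) (P : pred I) (F : I -> X -> R[i]) :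
  (forall i, P i -> cmeas (F i)) -> cmeas (fun x => \prod_(i <- r | P i) F i x).
Proof.
move=> mF; elim: r => [|i r IH].
  by under eq_fun do rewrite big_nil; exact: cmeas_cst.
under eq_fun do rewrite big_cons.
by case Pi: (P i) => //; apply: cmeasM => //; exact: mF.
Qed.

Lemma cmeas_cexp f : cmeas f -> cmeas (fun x => cexp (f x)).
Proof.
move=> [f1 f2]; split.
  under eq_fun do rewrite Re_cexp.
  apply: measurable_funM; apply: measurable_continuous_comp => //.
    exact: continuous_expR.
  exact: continuous_cos.
under eq_fun do rewrite Im_cexp.
apply: measurable_funM; apply: measurable_continuous_comp => //.
  exact: continuous_expR.
exact: continuous_sin.
Qed.

Lemma cmeas_rlog f : cmeas f -> cmeas (fun x => rlog (f x)).
Proof.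
move=> mf; have mn := measurable_normc mf; case: mf => f1 f2; split => /=.
  by apply: measurableT_comp; [exact: measurable_ln|].
apply: measurable_continuous_comp; first exact: continuous_atan.
by apply: measurable_funM => //; apply: measurableT_comp => //; exact: measurable_invr.
Qed.

Lemma cmeas_if (b : X -> bool) f g : measurable_fun [set: X] b ->
  cmeas f -> cmeas g -> cmeas (fun x => if b x then f x else g x).
Proof.
move=> mb [f1 f2] [g1 g2]; split.
  rewrite (_ : (fun x => _) = fun x => if b x then Re (f x) else Re (g x)).
    exact: measurable_fun_ifT.
  by apply/funext => x; case: ifP.
rewrite (_ : (fun x => _) = fun x => if b x then Im (f x) else Im (g x)).
  exact: measurable_fun_ifT.
by apply/funext => x; case: ifP.
Qed.

Lemma cmeas_rpow (h : X -> R) a :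
  measurable_fun [set: X] h -> cmeas (fun x => rpow (h x) a).
Proof.
move=> mh; under eq_fun do rewrite rpowE; apply: cmeas_cexp; apply: cmeasM; first exact: cmeas_cst.
by apply: cmeas_real; apply: measurableT_comp; [exact: measurable_ln|].
Qed.

End complex_measurable.

Lemma cmeas_comp d d' (X : measurableType d) (Y : measurableType d') (R : realType)
    (phi : X -> Y) (f : Y -> R[i]) :
  measurable_fun [set: X] phi -> cmeas f -> cmeas (f \o phi).
Proof.
by move=> mphi [f1 f2]; split; [exact: (measurableT_comp f1)|exact: (measurableT_comp f2)].
Qed.

Section has_integral.
Context d (X : measurableType d) (R : realType) (mu : {measure set X -> \bar R}).
Implicit Types (f g : X -> R[i]) (v w c : R[i]).
Local Notation Re := (@complex.Re R).
Local Notation Im := (@complex.Im R).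
Local Notation normc := (@ComplexField.Normc.normc R).

Definition has_int f v := cintegrable mu setT f /\ cintegral mu setT f = v.

Lemma has_int_ext f g v : (forall x, f x = g x) -> has_int f v -> has_int g v.
Proof. by move=> /funext ->. Qed.

Lemma has_int_cmeas f v : has_int f v -> cmeas f.
Proof.
move=> [[/integrableP[f1 _] /integrableP[f2 _]] _].
by split; apply/measurable_EFinP.
Qed.

Lemma has_intZ c f v : has_int f v -> has_int (fun x => c * f x) (c * v).
Proof.
move=> [[f1 f2] <-].
have g1 (a : R) : mu.-integrable setT (EFin \o (fun x => a * Re (f x))).
  exact: (integrableZl measurableT a f1).
have g2 (a : R) : mu.-integrable setT (EFin \o (fun x => a * Im (f x))).
  exact: (integrableZl measurableT a f2).
split; first split.
- under eq_fun do rewrite ReM EFinB.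
  exact: (integrableB _ (g1 _) (g2 _)).
- under eq_fun do rewrite ImM EFinD.
  exact: (integrableD _ (g2 _) (g1 _)).
- rewrite /cintegral; apply: complex_ext; rewrite ?ReM ?ImM /=.
    under eq_Rintegral do rewrite ReM.
    by rewrite RintegralB// !RintegralZl.
  under eq_Rintegral do rewrite ImM.
  by rewrite RintegralD// !RintegralZl.
Qed.

Lemma has_intD f g v w : has_int f v -> has_int g w ->
  has_int (fun x => f x + g x) (v + w).
Proof.
move=> [[f1 f2] <-] [[g1 g2] <-]; split; first split.
- under eq_fun do rewrite ReD EFinD.
  exact: (integrableD _ f1 g1).
- under eq_fun do rewrite ImD EFinD.
  exact: (integrableD _ f2 g2).
- rewrite /cintegral; apply: complex_ext; rewrite ?ReD ?ImD /=.
    by under eq_Rintegral do rewrite ReD; rewrite RintegralD.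
  by under eq_Rintegral do rewrite ImD; rewrite RintegralD.
Qed.

Lemma has_int_unique f v w : has_int f v -> has_int f w -> v = w.
Proof. by move=> [_ <-] [_ <-]. Qed.

Lemma cintegrable_dom f (G : X -> R) : cmeas f ->
  mu.-integrable setT (EFin \o G) -> (forall x, normc (f x) <= G x) ->
  cintegrable mu setT f.
Proof.
move=> [f1 f2] iG fG; split; apply: (le_integrable _ _ _ iG) => //.
- exact/measurable_EFinP.
- move=> x _ /=; rewrite lee_fin (le_trans (Re_le_normc _))// (le_trans (fG x))//.
  exact: ler_norm.
- exact/measurable_EFinP.
- move=> x _ /=; rewrite lee_fin (le_trans (Im_le_normc _))// (le_trans (fG x))//.
  exact: ler_norm.
Qed.

Lemma has_int_Re_ge0 f v : (forall x, 0 <= Re (f x)) -> has_int f v ->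
  (\int[mu]_x (Re (f x))%:E = (Re v)%:E)%E.
Proof.
move=> f0 [[f1 f2] <-] /=; rewrite /Rintegral fineK//.
exact: integrable_fin_num.
Qed.

End has_integral.

(** A name for the product measure under which iterated products are again
    seen to be sigma-finite. *)
Section product_sigma_finite.
Context d1 d2 (X : measurableType d1) (Y : measurableType d2) (R : realType).
Variables (m1 : {sigma_finite_measure set X -> \bar R})
          (m2 : {sigma_finite_measure set Y -> \bar R}).

Definition prodm : set (X * Y)%type -> \bar R := (m1 \x m2)%E.

HB.instance Definition _ := Measure.on prodm.

Let prodm_sigma_finite : sigma_finite setT prodm.
Proof.
have /sigma_finiteP[F [TF ndF Foo]] := sigma_finiteT m1.
have /sigma_finiteP[G [TG ndG Goo]] := sigma_finiteT m2.
exists (fun n => F n `*` G n).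
  apply/seteqP; split=> [[x y] _|//].
  have [i _ Fi] : (\bigcup_k F k) x by rewrite -TF.
  have [j _ Gj] : (\bigcup_k G k) y by rewrite -TG.
  exists (maxn i j) => //; split.
    by move: Fi; exact/subsetPset/ndF/leq_maxl.
  by move: Gj; exact/subsetPset/ndG/leq_maxr.
move=> k; have [? ?] := Foo k; have [? ?] := Goo k.
split; first exact: measurableX.
by rewrite /prodm product_measure1E// lte_mul_pinfty// ge0_fin_numE.
Qed.

HB.instance Definition _ :=
  Measure_isSigmaFinite.Build _ _ _ prodm prodm_sigma_finite.

End product_sigma_finite.

Section complex_fubini.
Context d1 d2 (X : measurableType d1) (Y : measurableType d2) (R : realType).
Variables (m1 : {sigma_finite_measure set X -> \bar R})
          (m2 : {sigma_finite_measure set Y -> \bar R}).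
Local Notation Re := (@complex.Re R).
Local Notation Im := (@complex.Im R).
Local Notation normc := (@ComplexField.Normc.normc R).

(** Tonelli applied to the majorant [f0], whose iterated integral is known to
    be finite, justifies Fubini for [f]. *)
Lemma has_int_fubini (C : R) (f f0 : X * Y -> R[i]) (g g0 : X -> R[i]) v v0 :
  cmeas f -> cmeas f0 ->
  (forall z, 0 <= Re (f0 z)) -> (forall z, normc (f z) <= C * Re (f0 z)) ->
  (forall x, has_int m2 (fun y => f (x, y)) (g x)) ->
  (forall x, has_int m2 (fun y => f0 (x, y)) (g0 x)) ->
  has_int m1 g v -> has_int m1 g0 v0 ->
  has_int (prodm m1 m2) f v.
Proof.
move=> mf mf0 f00 ff0 fg fg0 gv gv0.
have if0 : (prodm m1 m2).-integrable setT (fun z => (Re (f0 z))%:E).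
  apply/integrable12ltyP; first by case: mf0 => ? _; exact/measurable_EFinP.
  have inner x : (\int[m2]_y `|(Re (f0 (x, y)))%:E| = (Re (g0 x))%:E)%E.
    rewrite -(has_int_Re_ge0 _ (fg0 x)) => [|y]; last exact: f00.
    by apply: eq_integral => y _; rewrite /= ger0_norm.
  under eq_integral do rewrite inner.
  have g00 x : 0 <= Re (g0 x).
    rewrite -lee_fin -(has_int_Re_ge0 _ (fg0 x))//.
    by apply: integral_ge0 => y _; rewrite lee_fin.
  by rewrite (has_int_Re_ge0 _ gv0)// ltry.
have [if1 if2] : cintegrable (prodm m1 m2) setT f.
  apply: (@cintegrable_dom _ _ _ _ _ (fun z => C * Re (f0 z))) => //.
  exact: (integrableZl measurableT C if0).
split=> //; case: gv => _ <-; rewrite /cintegral; congr (_ +i* _).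
- rewrite /Rintegral -(integral12_prod_meas1 if1); congr fine.
  apply: eq_integral => x _; rewrite /fubini_F.
  by case: (fg x) => [[? ?] <-]; rewrite /= /Rintegral fineK//; exact: integrable_fin_num.
- rewrite /Rintegral -(integral12_prod_meas1 if2); congr fine.
  apply: eq_integral => x _; rewrite /fubini_F.
  by case: (fg x) => [[? ?] <-]; rewrite /= /Rintegral fineK//; exact: integrable_fin_num.
Qed.

End complex_fubini.

(** * Transport of integrals and dominated convergence *)

Section transport.
Context d d' (X : measurableType d) (Y : measurableType d') (R : realType).
Variables (mu : {measure set X -> \bar R}) (nu : {measure set Y -> \bar R}).
Variables (phi : X -> Y) (a : R).
Hypotheses (mphi : measurable_fun [set: X] phi) (a0 : 0 < a).
Hypothesis nuE : forall A, measurable A -> nu A = (a%:E * mu (phi @^-1` A))%E.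

Lemma ge0_integral_transport (h : Y -> \bar R) :
  measurable_fun [set: Y] h -> (forall y, (0 <= h y)%E) ->
  (\int[nu]_y h y = a%:E * \int[mu]_x h (phi x))%E.
Proof.
move=> mh h0.
rewrite (@eq_measure_integral _ _ _ _ (mscale (NngNum (ltW a0)) (pushforward mu phi)))//.
  by rewrite ge0_integral_mscale// ge0_integral_pushforward// => y _; exact: h0.
by move=> A mA _; rewrite nuE.
Qed.

Lemma integrable_transport (h : Y -> R) : measurable_fun [set: Y] h ->
  nu.-integrable setT (EFin \o h) <-> mu.-integrable setT (EFin \o h \o phi).
Proof.
move=> mh.
have mhphi : measurable_fun setT (EFin \o h \o phi).
  by apply/measurable_EFinP; exact: measurableT_comp.
have E : (\int[nu]_y `|(EFin \o h) y| = a%:E * \int[mu]_x `|(EFin \o h \o phi) x|)%E.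
  rewrite (@ge0_integral_transport (abse \o EFin \o h))//.
    by apply: measurableT_comp => //; exact/measurable_EFinP.
  by move=> y; exact: abse_ge0.
split=> /integrableP[_ fin]; apply/integrableP; split => //.
- rewrite ltey; apply/eqP => Eoo; move: fin.
  by rewrite E Eoo gt0_muley ?lte_fin// ltxx.
- exact/measurable_EFinP.
- by rewrite E; apply: lte_mul_pinfty => //; rewrite lee_fin ltW.
Qed.

Lemma Rintegral_transport (h : Y -> R) : measurable_fun [set: Y] h ->
  mu.-integrable setT (EFin \o h \o phi) ->
  \int[nu]_y h y = a * \int[mu]_x h (phi x).
Proof.
move=> mh ih; have ih' := (integrable_transport mh).2 ih.
have mEh : measurable_fun setT (EFin \o h) by exact/measurable_EFinP.
have Ep : (\int[nu]_y (EFin \o h)^\+ y = a%:E * \int[mu]_x (EFin \o h \o phi)^\+ x)%E.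
  rewrite (funepos_comp (EFin \o h) phi) (@ge0_integral_transport ((EFin \o h)^\+)%E)//; exact: measurable_funepos.
have En : (\int[nu]_y (EFin \o h)^\- y = a%:E * \int[mu]_x (EFin \o h \o phi)^\- x)%E.
  rewrite (funeneg_comp (EFin \o h) phi) (@ge0_integral_transport ((EFin \o h)^\-)%E)//; exact: measurable_funeneg.
rewrite /Rintegral -[a]/(fine a%:E) -fineM//; last exact: integrable_fin_num.
congr fine; rewrite [LHS]integralE [in RHS]integralE Ep En.
rewrite -[fun x => (h (phi x))%:E]/(EFin \o h \o phi).
have := integrable_fin_num measurableT (integrable_funeneg measurableT ih).
set P := (\int[mu]_x (_^\+ x))%E; set N := (\int[mu]_x (_^\- x))%E => fN.
clearbody P N; rewrite muleBr//.
by apply: fin_num_adde_defl; rewrite fin_numN.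
Qed.

Lemma has_int_transport (f : Y -> R[i]) v : cmeas f ->
  has_int nu f (a%:C * v) <-> has_int mu (f \o phi) v.
Proof.
move=> [f1 f2].
have aC : a%:C != 0 by rewrite eq_complex /= eqxx andbT gt_eqF.
have key w : has_int mu (f \o phi) w -> has_int nu f (a%:C * w).
  move=> [[i1 i2] <-]; split.
    by split; apply/integrable_transport.
  rewrite /cintegral !Rintegral_transport//.
  by apply: complex_ext; rewrite ?ReM ?ImM /= ?mul0r ?subr0 ?addr0.
split=> [|/key//] H; have [[i1 i2] _] := H.
have H2 : has_int mu (f \o phi) (cintegral mu setT (f \o phi)).
  by split=> //; split; [exact: (integrable_transport f1).1|exact: (integrable_transport f2).1].
by have /(mulfI aC) -> := has_int_unique H (key _ H2).
Qed.

End transport.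

(** Measure-preserving maps transport integrals; this is how all changes of
    coordinates below are performed. *)
Lemma has_int_preserving d d' (X : measurableType d) (Y : measurableType d')
    (R : realType) (mu : {measure set X -> \bar R}) (nu : {measure set Y -> \bar R})
    (phi : X -> Y) (f : Y -> R[i]) v :
  measurable_fun [set: X] phi ->
  (forall A, measurable A -> nu A = mu (phi @^-1` A)) ->
  cmeas f -> has_int nu f v <-> has_int mu (f \o phi) v.
Proof.
move=> mphi nuE mf; rewrite -[v in X in X <-> _]mul1r.
apply: (@has_int_transport _ _ _ _ _ _ _ _ 1) => // A mA.
by rewrite mul1e nuE.
Qed.

Section affine.
Context (R : realType).
Local Notation leb := (@lebesgue_measure R).

Lemma has_int_affine (a b : R) (f : R -> R[i]) v : 0 < a ->
  has_int leb f (a%:C * v) <-> has_int leb (fun x => f (a * x + b)) v.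
Proof.
move=> a0; pose phi (x : measurableTypeR R) : measurableTypeR R := a * x + b.
have mphi : measurable_fun setT phi.
  by apply: measurable_funD; [exact: measurable_funM|exact: measurable_cst].
have mpsi : measurable_fun setT (fun x : measurableTypeR R => (x - b) / a : measurableTypeR R).
  by apply: measurable_funM => //; apply: measurable_funB.
have E A : measurable A -> leb A = (a%:E * leb (phi @^-1` A))%E.
  move=> mA.
  apply: (@lebesgue_measure_unique _ (mscale (NngNum (ltW a0)) (pushforward leb phi))) => //.
  move=> _ [[x y]] _ <-.
  transitivity (a%:E * leb (phi @^-1` `]x, y]%classic))%E; last by [].
  have -> : phi @^-1` `]x, y] = `](x - b) / a, (y - b) / a]%classic.
    apply/seteqP; split=> z; rewrite /phi /= !in_itv/= ltr_pdivrMr// ler_pdivlMr//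
      ltrBlDr lerBrDr (mulrC z)//.
  rewrite !lebesgue_measure_itv/= !lte_fin ltr_pM2r ?invr_gt0// ltrBlDr subrK.
  case: ifPn => xy; last by rewrite mule0.
  by rewrite -!EFinD -EFinM; congr (_%:E); field; rewrite gt_eqF.
split=> H.
  by apply: (has_int_transport mphi a0 E v (has_int_cmeas H)).1.
apply: (has_int_transport mphi a0 E v _).2 => //.
have := cmeas_comp mpsi (has_int_cmeas H).
rewrite (_ : _ \o _ = f)//; apply/funext => x /=.
by congr f; field; rewrite gt_eqF.
Qed.

Lemma has_int_shift (b : R) (f : R -> R[i]) v :
  has_int leb f v -> has_int leb (fun x => f (x + b)) v.
Proof.
rewrite -{1}[v]mul1r => /(has_int_affine b _ _ ltr01).1.
by apply: has_int_ext => x; rewrite mul1r.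
Qed.

Lemma has_int_scale (a : R) (f : R -> R[i]) v : 0 < a ->
  has_int leb f v -> has_int leb (fun x => f (a * x)) (a^-1%:C * v).
Proof.
move=> a0 H; have /(has_int_affine 0 _ _ a0).1 : has_int leb f (a%:C * (a^-1%:C * v)).
  by rewrite mulrA -rmorphM mulfV ?gt_eqF// mul1r.
by apply: has_int_ext => x; rewrite addr0.
Qed.

End affine.

Section complex_limits.
Context (R : realType).
Local Notation Re := (@complex.Re R).
Local Notation Im := (@complex.Im R).
Local Notation normc := (@ComplexField.Normc.normc R).
Implicit Types (u w : nat -> R[i]) (l m : R[i]).

(** Convergence of complex sequences, component by component. *)
Definition ccvg u l :=
  (Re (u n) @[n --> \oo] --> Re l) /\ (Im (u n) @[n --> \oo] --> Im l).

Lemma ccvg_cst l : ccvg (fun=> l) l.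
Proof. by split; exact: cvg_cst. Qed.

Lemma ccvgM u w l m : ccvg u l -> ccvg w m -> ccvg (fun n => u n * w n) (l * m).
Proof.
move=> [u1 u2] [w1 w2]; split.
  by under eq_fun do rewrite ReM; rewrite ReM; apply: cvgB; exact: cvgM.
by under eq_fun do rewrite ImM; rewrite ImM; apply: cvgD; exact: cvgM.
Qed.

Lemma ccvgD u w l m : ccvg u l -> ccvg w m -> ccvg (fun n => u n + w n) (l + m).
Proof.
move=> [u1 u2] [w1 w2]; split.
  by under eq_fun do rewrite ReD; rewrite ReD; exact: cvgD.
by under eq_fun do rewrite ImD; rewrite ImD; exact: cvgD.
Qed.

Lemma ccvg_unique u l m : ccvg u l -> ccvg u m -> l = m.
Proof.
move=> [u1 u2] [w1 w2]; apply: complex_ext.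
  exact: (cvg_unique _ u1 w1).
exact: (cvg_unique _ u2 w2).
Qed.

Lemma ccvg_ext u w l : (forall n, u n = w n) -> ccvg u l -> ccvg w l.
Proof. by move=> /funext ->. Qed.

Lemma ccvg_shift k u l : ccvg u l <-> ccvg (fun n => u (n + k)%N) l.
Proof.
by split=> -[h1 h2]; split;
  [rewrite (cvg_shiftn k (fun n => Re (u n)))|rewrite (cvg_shiftn k (fun n => Im (u n)))
  |rewrite -(cvg_shiftn k (fun n => Re (u n)))|rewrite -(cvg_shiftn k (fun n => Im (u n)))].
Qed.

Lemma ccvg_cexp u l : ccvg u l -> ccvg (fun n => cexp (u n)) (cexp l).
Proof.
move=> [u1 u2]; split.
  under eq_fun do rewrite Re_cexp; rewrite Re_cexp.
  by apply: cvgM; apply: continuous_cvg => //; [exact: continuous_expR|exact: continuous_cos].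
under eq_fun do rewrite Im_cexp; rewrite Im_cexp.
by apply: cvgM; apply: continuous_cvg => //; [exact: continuous_expR|exact: continuous_sin].
Qed.

Lemma ccvg_real (h : nat -> R) (x : R) : h n @[n --> \oo] --> x ->
  ccvg (fun n => (h n)%:C) x%:C.
Proof. by move=> hx; split => //=; exact: cvg_cst. Qed.

Lemma ccvg_small u (w : nat -> R) : (forall n, normc (u n) <= w n) ->
  w n @[n --> \oo] --> (0 : R) -> ccvg u 0.
Proof.
move=> uw w0; have wN : - w n @[n --> \oo] --> (0 : R) by rewrite -oppr0; exact: cvgN.
split; apply: (squeeze_cvgr _ wN w0); apply: nearW => n; rewrite -ler_norml.
  exact: le_trans (Re_le_normc _) (uw n).
exact: le_trans (Im_le_normc _) (uw n).
Qed.

End complex_limits.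

Section complex_dominated_convergence.
Context d (X : measurableType d) (R : realType) (mu : {measure set X -> \bar R}).
Local Notation normc := (@ComplexField.Normc.normc R).

Lemma has_int_dct (f_ : nat -> X -> R[i]) (v_ : nat -> R[i]) (f : X -> R[i]) (G : X -> R) :
  (forall n, has_int mu (f_ n) (v_ n)) -> cmeas f ->
  mu.-integrable setT (EFin \o G) ->
  (forall n x, normc (f_ n x) <= G x) ->
  (forall x, ccvg (f_ ^~ x) (f x)) ->
  exists2 v, has_int mu f v & ccvg v_ v.
Proof.
move=> fv mf iG fG ff; case: (mf) => f1 f2.
have [i1 _ c1] := dominated_convergence measurableT
  (f_ := fun n x => (complex.Re (f_ n x))%:E) (f := fun x => (complex.Re (f x))%:E)
  (fun n => (measurable_EFinP _ _).2 (has_int_cmeas (fv n)).1)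
  ((measurable_EFinP _ _).2 f1)
  (ltac:(apply: aeW => x _; apply: cvg_EFin; [exact: nearW|exact: (ff x).1]))
  iG
  (ltac:(apply: aeW => x n _; rewrite lee_fin; exact: le_trans (Re_le_normc _) (fG n x))).
have [i2 _ c2] := dominated_convergence measurableT
  (f_ := fun n x => (complex.Im (f_ n x))%:E) (f := fun x => (complex.Im (f x))%:E)
  (fun n => (measurable_EFinP _ _).2 (has_int_cmeas (fv n)).2)
  ((measurable_EFinP _ _).2 f2)
  (ltac:(apply: aeW => x _; apply: cvg_EFin; [exact: nearW|exact: (ff x).2]))
  iG
  (ltac:(apply: aeW => x n _; rewrite lee_fin; exact: le_trans (Im_le_normc _) (fG n x))).
exists (cintegral mu setT f) => //; split => /=.
- have /fine_cvgP[_] : (\int[mu]_x (complex.Re (f_ n x))%:E)%E @[n --> \oo] -->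
     (fine (\int[mu]_x (complex.Re (f x))%:E)%E)%:E.
    by rewrite fineK//; exact: integrable_fin_num.
  apply: cvg_trans; apply: near_eq_cvg; apply: nearW => n /=.
  by case: (fv n) => _ <-.
- have /fine_cvgP[_] : (\int[mu]_x (complex.Im (f_ n x))%:E)%E @[n --> \oo] -->
     (fine (\int[mu]_x (complex.Im (f x))%:E)%E)%:E.
    by rewrite fineK//; exact: integrable_fin_num.
  apply: cvg_trans; apply: near_eq_cvg; apply: nearW => n /=.
  by case: (fv n) => _ <-.
Qed.

End complex_dominated_convergence.

(** * The fundamental theorem of calculus for improper integrals *)

Section complex_calculus.
Context (R : realType).
Local Notation Re := (@complex.Re R).
Local Notation Im := (@complex.Im R).
Implicit Types (f g : R -> R[i]) (x : R).

Definition ccont f x :=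
  (Re (f t) @[t --> x] --> Re (f x)) /\ (Im (f t) @[t --> x] --> Im (f x)).

Definition cderiv f x (l : R[i]) :=
  is_derive x 1 (fun t => Re (f t)) (Re l) /\ is_derive x 1 (fun t => Im (f t)) (Im l).

Lemma ccont_cst c x : ccont (fun=> c) x.
Proof. by split; exact: cvg_cst. Qed.

Lemma ccont_real (h : R -> R) x : {for x, continuous h} -> ccont (fun t => (h t)%:C) x.
Proof. by move=> ch; split => //=; exact: cvg_cst. Qed.

Lemma ccontD f g x : ccont f x -> ccont g x -> ccont (fun t => f t + g t) x.
Proof.
move=> [f1 f2] [g1 g2]; split.
  by under eq_fun do rewrite ReD; rewrite ReD; exact: cvgD.
by under eq_fun do rewrite ImD; rewrite ImD; exact: cvgD.
Qed.

Lemma ccontM f g x : ccont f x -> ccont g x -> ccont (fun t => f t * g t) x.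
Proof.
move=> [f1 f2] [g1 g2]; split.
  by under eq_fun do rewrite ReM; rewrite ReM; apply: cvgB; exact: cvgM.
by under eq_fun do rewrite ImM; rewrite ImM; apply: cvgD; exact: cvgM.
Qed.

Lemma ccont_cexp f x : ccont f x -> ccont (fun t => cexp (f t)) x.
Proof.
move=> [f1 f2]; split.
  under eq_fun do rewrite Re_cexp; rewrite Re_cexp.
  by apply: cvgM; apply: continuous_cvg => //; [exact: continuous_expR|exact: continuous_cos].
under eq_fun do rewrite Im_cexp; rewrite Im_cexp.
by apply: cvgM; apply: continuous_cvg => //; [exact: continuous_expR|exact: continuous_sin].
Qed.

Lemma cderiv_real (h : R -> R) x (l : R) : is_derive x 1 h l -> cderiv (fun t => (h t)%:C) x l%:C.
Proof. by move=> dh; split => //=; exact: is_derive_cst. Qed.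

Lemma cderivD f g x a b : cderiv f x a -> cderiv g x b -> cderiv (fun t => f t + g t) x (a + b).
Proof.
move=> [f1 f2] [g1 g2]; split.
  by under eq_fun do rewrite ReD; rewrite ReD; exact: is_deriveD.
by under eq_fun do rewrite ImD; rewrite ImD; exact: is_deriveD.
Qed.

Lemma cderivZ c f x a : cderiv f x a -> cderiv (fun t => c * f t) x (c * a).
Proof.
move=> [f1 f2]; split.
  under eq_fun do rewrite ReM; rewrite ReM.
  by apply: is_deriveB; exact: is_deriveZ.
under eq_fun do rewrite ImM; rewrite ImM.
by apply: is_deriveD; exact: is_deriveZ.
Qed.

Lemma is_derive_mul (h k : R -> R) x (dh dk : R) : is_derive x 1 h dh ->
  is_derive x 1 k dk -> is_derive x 1 (fun t => h t * k t) (h x * dk + k x * dh).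
Proof. by move=> hh hk; exact: (@is_deriveM R R h k x 1 dh dk hh hk). Qed.

Lemma cderiv_cexp f x a : cderiv f x a -> cderiv (fun t => cexp (f t)) x (a * cexp (f x)).
Proof.
move=> [f1 f2].
have e : is_derive x 1 (fun t => expR (Re (f t))) (expR (Re (f x)) * Re a).
  exact: (is_derive1_comp (is_derive_expR _) f1).
have c : is_derive x 1 (fun t => cos (Im (f t))) (- sin (Im (f x)) * Im a).
  exact: (is_derive1_comp (is_derive_cos _) f2).
have s : is_derive x 1 (fun t => sin (Im (f t))) (cos (Im (f x)) * Im a).
  exact: (is_derive1_comp (is_derive_sin _) f2).
split.
  under eq_fun do rewrite Re_cexp.
  apply: (is_derive_eq (is_derive_mul e c)).
  by rewrite ReM Re_cexp Im_cexp ; ring.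
under eq_fun do rewrite Im_cexp.
apply: (is_derive_eq (is_derive_mul e s)).
by rewrite ImM Re_cexp Im_cexp ; ring.
Qed.

End complex_calculus.

Section fundamental_theorem.
Context (R : realType).
Local Notation leb := (@lebesgue_measure R).
Local Notation Re := (@complex.Re R).
Local Notation Im := (@complex.Im R).
Local Notation normc := (@ComplexField.Normc.normc R).

Lemma integral_deriv_itv (h h' : R -> R) (a b : R) : a < b ->
  (forall x, a <= x <= b -> is_derive x 1 h (h' x)) ->
  (forall x, a <= x <= b -> {for x, continuous h'}) ->
  leb.-integrable setT (fun x => (if a <= x <= b then h' x else 0)%:E) /\
  (\int[leb]_x (if a <= x <= b then h' x else 0)%:E = (h b - h a)%:E)%E.
Proof.
move=> ab dh ch'.
have E : (fun x => (if a <= x <= b then h' x else 0)%:E) = (EFin \o h') \_ `[a, b].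
  apply/funext => x; rewrite patchE mem_setE /= in_itv /=.
  by case: ifP.
have ch : {within `[a, b], continuous h'}.
  apply: continuous_in_subspaceT => x; rewrite inE /= in_itv /= => xab; exact: ch'.
split.
  rewrite E; apply: (integrable_mkcond _ _).1 => //.
  by apply: continuous_compact_integrable; [exact: segment_compact|exact: ch].
rewrite E -integral_mkcond /=.
have hc x : a <= x <= b -> {for x, continuous h}.
  by move=> /dh [d _]; exact/differentiable_continuous/derivable1_diffP.
rewrite (@continuous_FTC2 _ _ h)//.
  split.
  - move=> x; rewrite in_itv/= => /andP[ax xb].
    by have [] := dh x (introT andP (conj (ltW ax) (ltW xb))).
  - by apply: cvg_at_right_filter; apply: hc; rewrite lexx ltW.
  - by apply: cvg_at_left_filter; apply: hc; rewrite lexx ltW.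
move=> x; rewrite in_itv/= => /andP[ax xb].
have [d e] := dh x (introT andP (conj (ltW ax) (ltW xb))).
by rewrite derive1E.
Qed.

Variables (E : R -> bool) (a b : nat -> R) (h h' : R -> R[i]).
Hypothesis ab : forall n, a n < b n.
Hypothesis abE : forall n x, a n <= x <= b n -> E x.
Hypothesis cover : forall x, E x -> \forall n \near \oo, a n <= x <= b n.
Hypothesis dh : forall x, E x -> cderiv h x (h' x).
Hypothesis ch' : forall x, E x -> ccont h' x.

Lemma has_int_deriv_itv n :
  has_int leb (fun x => if a n <= x <= b n then h' x else 0) (h (b n) - h (a n)).
Proof.
have [i1 e1] := @integral_deriv_itv (fun x => Re (h x)) (fun x => Re (h' x)) _ _ (ab n)
  (fun x xab => (dh (abE xab)).1) (fun x xab => (ch' (abE xab)).1).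
have [i2 e2] := @integral_deriv_itv (fun x => Im (h x)) (fun x => Im (h' x)) _ _ (ab n)
  (fun x xab => (dh (abE xab)).2) (fun x xab => (ch' (abE xab)).2).
have rif x : Re (if a n <= x <= b n then h' x else 0) = if a n <= x <= b n then Re (h' x) else 0.
  by case: ifP.
have iif x : Im (if a n <= x <= b n then h' x else 0) = if a n <= x <= b n then Im (h' x) else 0.
  by case: ifP.
split; first by split; [under eq_fun do rewrite rif|under eq_fun do rewrite iif].
rewrite /cintegral /Rintegral; under eq_integral do rewrite rif.
rewrite e1; under eq_integral do rewrite iif.
by rewrite e2; apply: complex_ext; rewrite ?ReD ?ImD ?ReN ?ImN.
Qed.

(** Dominated convergence along an exhaustion of [E] turns the fundamental
    theorem on segments into one for improper integrals. *)
Lemma has_int_ftc v L : has_int leb (fun x => if E x then h' x else 0) v ->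
  ccvg (fun n => h (b n) - h (a n)) L -> v = L.
Proof.
move=> hv hL; have [[i1 i2] _] := hv.
pose G x := `|Re (if E x then h' x else 0)| + `|Im (if E x then h' x else 0)|.
have iG : leb.-integrable setT (EFin \o G).
  exact: (integrableD _ (integrable_abse i1) (integrable_abse i2)).
have [||w hw cw] := @has_int_dct _ _ _ leb _ _ (fun x => if E x then h' x else 0) G
  has_int_deriv_itv (has_int_cmeas hv) iG.
- move=> n x; case: ifPn => [xab|_]; last first.
    by rewrite ComplexField.Normc.normc0 addr_ge0.
  rewrite /G (abE xab) -(ler_pXn2r (n:=2))// ?nnegrE ?normc_ge0 ?addr_ge0//.
  rewrite sqr_normc sqrrD !real_normK ?num_real//.
  by rewrite -subr_ge0 [X in 0 <= X](_ : _ = `|Re (h' x)| * `|Im (h' x)| *+ 2) ?mulrn_wge0 ?mulr_ge0//; ring.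
- move=> x; case: (boolP (E x)) => Ex.
    by split; apply: cvg_near_cst; near=> n; rewrite (_ : a n <= x <= b n)//; near: n;
      exact: cover.
  apply: ccvg_ext (ccvg_cst _) => n.
  by case: ifP => // /abE; rewrite (negPf Ex).
by rewrite (has_int_unique hv hw); exact: ccvg_unique cw hL.
Unshelve. all: by end_near.
Qed.

Hypothesis ndab : forall n, a n.+1 <= a n /\ b n <= b n.+1.

(** For a positive derivative integrability comes for free. *)
Lemma has_int_ftc_ge0 (L : R) :
  (forall x, E x -> 0 <= Re (h' x) /\ Im (h' x) = 0) ->
  ccvg (fun n => h (b n) - h (a n)) L%:C ->
  has_int leb (fun x => if E x then h' x else 0) L%:C.
Proof.
move=> h0 [hL _].
pose g n x := (Re (if a n <= x <= b n then h' x else 0))%:E.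
have Iif x : Im (if E x then h' x else 0) = 0.
  by case: ifP => // /h0[].
have mg n : measurable_fun setT (g n).
  by apply/measurable_EFinP; case: (has_int_cmeas (has_int_deriv_itv n)).
have g0 n x : setT x -> (0 <= g n x)%E.
  by move=> _; rewrite lee_fin; case: ifP => // /abE/h0[].
have cvgg x : g ^~ x @ \oo --> (Re (if E x then h' x else 0))%:E.
  apply: cvg_EFin; first exact: nearW.
  case: (boolP (E x)) => Ex.
    apply: cvg_near_cst; near=> n; rewrite /= (_ : a n <= x <= b n)//; near: n;
      exact: cover.
  rewrite (_ : _ \o _ = fun=> 0); first exact: cvg_cst.
  by apply/funext => n /=; case: ifP => // /abE; rewrite (negPf Ex).
have limg x : limn (g ^~ x) = (Re (if E x then h' x else 0))%:E.
  by apply/cvg_lim => //; exact: cvgg.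
have ndg x : setT x -> {homo g^~ x : n m / (n <= m)%N >-> (n <= m)%E}.
  move=> _; apply/nondecreasing_seqP => n; rewrite /g lee_fin.
  case: ifPn => [xab|_]; last by case: ifP => // /abE/h0[].
  rewrite (_ : a n.+1 <= x <= b n.+1)//; case: (ndab n) => an bn.
  by case/andP: xab => ax xb; rewrite (le_trans an)// (le_trans xb).
have := @cvg_monotone_convergence _ _ _ leb _ measurableT _ mg g0 ndg.
rewrite (funext limg).
have -> : (fun n => \int[leb]_x g n x)%E = (fun n => (Re (h (b n) - h (a n)))%:E).
  apply/funext => n; rewrite /g (has_int_Re_ge0 _ (has_int_deriv_itv n))//.
  by move=> x; case: ifP => // /abE/h0[].
move=> hL'.
have cL : (Re (h (b n) - h (a n)))%:E @[n --> \oo] --> L%:E.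
  by apply: cvg_EFin => //; exact: nearW.
have E1 : (\int[leb]_x (Re (if E x then h' x else 0))%:E = L%:E)%E.
  exact: (cvg_unique _ hL' cL).
have mE : measurable_fun setT (fun x => Re (if E x then h' x else 0)).
  apply/measurable_EFinP.
  exact: (@emeasurable_fun_cvg _ _ _ _ g (fun x => (Re (if E x then h' x else 0))%:E) mg
    (fun x _ => cvgg x)).
have i1 : leb.-integrable setT (fun x => (Re (if E x then h' x else 0))%:E).
  apply/integrableP; split; first exact/measurable_EFinP.
  rewrite (_ : (\int[leb]_x _)%E = L%:E) ?ltry// -E1.
  by apply: eq_integral => x _; rewrite /= ger0_norm//; case: ifP => // /h0[].
split; first split => //.
  by under eq_fun do rewrite Iif; exact: integrable0.
rewrite /cintegral /Rintegral E1; under eq_integral do rewrite Iif.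
by rewrite integral0.
Unshelve. all: by end_near.
Qed.

End fundamental_theorem.

(** * Interchange of integrals and real estimates *)

Section fubini_converse.
Context d1 d2 (X : measurableType d1) (Y : measurableType d2) (R : realType).
Variables (m1 : {sigma_finite_measure set X -> \bar R})
          (m2 : {sigma_finite_measure set Y -> \bar R}).

(** When the joint integral is known, the outer integral is a conclusion; reading
    a double integral in both orders evaluates new integrals in this way. *)
Lemma has_int_fubini_fst (f : X * Y -> R[i]) (g : X -> R[i]) v :
  has_int (prodm m1 m2) f v ->
  (forall x, has_int m2 (fun y => f (x, y)) (g x)) ->
  has_int m1 g v.
Proof.
move=> [[i1 i2] <-] fg.
have E1 : fubini_F m2 (fun z => (complex.Re (f z))%:E) = fun x => (complex.Re (g x))%:E.
  apply/funext => x; rewrite /fubini_F; case: (fg x) => [[? ?] <-].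
  by rewrite /= /Rintegral fineK//; exact: integrable_fin_num.
have E2 : fubini_F m2 (fun z => (complex.Im (f z))%:E) = fun x => (complex.Im (g x))%:E.
  apply/funext => x; rewrite /fubini_F; case: (fg x) => [[? ?] <-].
  by rewrite /= /Rintegral fineK//; exact: integrable_fin_num.
split.
  split; first by have := integrable_fubini_F i1; rewrite E1.
  by have := integrable_fubini_F i2; rewrite E2.
rewrite /cintegral /Rintegral -(integral12_prod_meas1 i1) -(integral12_prod_meas1 i2).
by rewrite E1 E2.
Qed.

Lemma prodm_swap (A : set (Y * X)) : measurable A ->
  prodm m2 m1 A = prodm m1 m2 ((fun z => (z.2, z.1)) @^-1` A).
Proof.
have mswap : measurable_fun [set: X * Y] (fun z : X * Y => (z.2, z.1)).
  by apply/measurable_fun_pairP; split; [exact: measurable_snd|exact: measurable_fst].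
move=> mA.
apply: (@product_measure_unique _ _ _ _ _ m2 m1
  (pushforward (prodm m1 m2) (fun z : X * Y => (z.2, z.1)))) => // B C mB mC.
rewrite /= /pushforward (_ : _ @^-1` _ = C `*` B).
  by rewrite /prodm product_measure1E// muleC.
by apply/seteqP; split=> -[x y] /= [].
Qed.

Lemma has_int_swap (f : X * Y -> R[i]) v : has_int (prodm m1 m2) f v ->
  has_int (prodm m2 m1) (fun z => f (z.2, z.1)) v.
Proof.
have mswap : measurable_fun [set: Y * X] (fun z : Y * X => (z.2, z.1)).
  by apply/measurable_fun_pairP; split; [exact: measurable_snd|exact: measurable_fst].
have mswap' : measurable_fun [set: X * Y] (fun z : X * Y => (z.2, z.1)).
  by apply/measurable_fun_pairP; split; [exact: measurable_snd|exact: measurable_fst].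
move=> H; apply/(has_int_preserving _ mswap' prodm_swap).
  exact: cmeas_comp mswap (has_int_cmeas H).
by apply: has_int_ext H => -[].
Qed.

End fubini_converse.

Section real_estimates.
Context (R : realType).
Implicit Types (x t K c : R).

Lemma ln_le_sub1 x : 0 < x -> ln x <= x - 1.
Proof. by move=> x0; have := @le_ln1Dx R (x - 1); rewrite addrCA subrr addr0; apply; lra. Qed.

Lemma mul_ln_le K t : 0 < K -> 0 < t -> K * ln t - t <= K * ln K.
Proof.
move=> K0 t0; have := ln_le_sub1 (divr_gt0 t0 K0); rewrite ln_div ?posrE// => H.
have : K * (ln t - ln K) <= K * (t / K - 1) by rewrite ler_pM2l.
by rewrite mulrBr mulrBr mulrCA divff ?gt_eqF// => ?; lra.
Qed.

Lemma cvg_expR_lin c : 0 < c -> expR (- (c * n%:R)) @[n --> \oo] --> (0 : R).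
Proof.
move=> c0; have /cvg_pinftyP := @cvgr_expR R; apply.
apply/cvgryPge => A; near=> n.
have : A / c <= n%:R by near: n; exact: nbhs_infty_ger.
by rewrite ler_pdivrMr// mulrC.
Unshelve. all: by end_near.
Qed.

Lemma cvg_expR_linS c : 0 < c -> expR (- (c * n.+1%:R)) @[n --> \oo] --> (0 : R).
Proof.
move=> c0; have := cvg_expR_lin c0.
by rewrite (cvg_shiftS (fun n => expR (- (c * n%:R)))).
Qed.

End real_estimates.

Section exhaustion.
Context (R : realType).

(** The segments from [pexh_l n] to [pexh_r n] exhaust the positive half-line. *)
Definition pexh_l (n : nat) : R := expR (- n.+1%:R).
Definition pexh_r (n : nat) : R := expR n.+1%:R.

Lemma pexh_lt n : pexh_l n < pexh_r n.
Proof. by rewrite ltr_expR -subr_gt0 opprK addr_gt0// ltr0n. Qed.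

Lemma pexh_pos n x : pexh_l n <= x <= pexh_r n -> 0 < x.
Proof. by move=> /andP[h _]; apply: lt_le_trans h; exact: expR_gt0. Qed.

Lemma pexh_cover x : 0 < x -> \forall n \near \oo, pexh_l n <= x <= pexh_r n.
Proof.
move=> x0; near=> n.
have : `|ln x| <= n%:R by near: n; exact: nbhs_infty_ger.
rewrite ler_norml => /andP[h1 h2].
have n1 : (n%:R : R) <= n.+1%:R by rewrite ler_nat.
by rewrite /pexh_l /pexh_r -[x in _ <= x <= _]lnK ?posrE// !ler_expR; apply/andP; split; lra.
Unshelve. all: by end_near.
Qed.

Lemma pexh_nd n : pexh_l n.+1 <= pexh_l n /\ pexh_r n <= pexh_r n.+1.
Proof. by rewrite !ler_expR lerN2 !ler_nat !ltnS leqnSn. Qed.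

Lemma cvg_pexh_l : pexh_l n @[n --> \oo] --> (0 : R).
Proof.
by have := cvg_expR_linS (@ltr01 R); under eq_fun do rewrite mul1r.
Qed.

Lemma cvg_pexh_r : expR (- pexh_r n) @[n --> \oo] --> (0 : R).
Proof.
have := cvg_expR_linS (@ltr01 R); under eq_fun do rewrite mul1r.
move=> h; apply: (squeeze_cvgr _ (cvg_cst 0) h); near=> n.
rewrite expR_ge0 ler_expR lerN2 /pexh_r.
by apply: le_trans (expR_ge1Dx _); rewrite lerDr.
Unshelve. all: by end_near.
Qed.

End exhaustion.

Section gamma_integral.
Context (R : realType).
Local Notation leb := (@lebesgue_measure R).
Local Notation Re := (@complex.Re R).
Local Notation Im := (@complex.Im R).
Local Notation normc := (@ComplexField.Normc.normc R).
Implicit Types (z a b : R[i]).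

Lemma measurable_gt0 d (X : measurableType d) (h : X -> R) :
  measurable_fun [set: X] h -> measurable_fun [set: X] (fun x => 0 < h x).
Proof. by move=> mh; apply: measurable_fun_ltr => //; exact: measurable_cst. Qed.

Lemma normc_if (b : bool) z w :
  normc (if b then z else w) = if b then normc z else normc w.
Proof. by case: b. Qed.

Lemma is_derive_ln_cst (c x : R) : 0 < x + c -> is_derive x 1 (fun t : R => ln (t + c)) (x + c)^-1.
Proof.
move=> xc; have d1 : is_derive x (1 : R) (fun t : R => t + c) 1.
  by apply: is_derive_eq; rewrite addr0.
by have := @is_derive1_comp R (@ln R) (fun t => t + c) x _ _ (is_derive1_ln xc) d1; rewrite mulr1.
Qed.

Lemma is_derive1_cvg (h : R -> R) (x l : R) : is_derive x 1 h l -> h t @[t --> x] --> h x.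
Proof. by move=> [dh _]; exact/differentiable_continuous/derivable1_diffP. Qed.

(** The integrand has the primitive [(t / (t + 1)) ^ r / r]; it serves as majorant
    for Euler's integral. *)
Lemma beta1_integral (r : R) : 0 < r ->
  has_int leb (fun t => if 0 < t
    then (expR ((r - 1) * ln t - (r + 1) * ln (t + 1)))%:C else 0) (r^-1)%:C.
Proof.
move=> r0.
pose h (t : R) : R[i] := r^-1%:C * cexp (r%:C * (ln t)%:C - r%:C * (ln (t + 1))%:C).
have hE t : h t = (r^-1 * expR (r * (ln t - ln (t + 1))))%:C.
  by rewrite /h -!rmorphM -rmorphB cexp_real -rmorphM -mulrBr.
pose h' (t : R) : R[i] := (expR ((r - 1) * ln t - (r + 1) * ln (t + 1)))%:C.
apply: (@has_int_ftc_ge0 R (fun t => 0 < t) (@pexh_l R) (@pexh_r R) h h').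
- exact: pexh_lt.
- exact: pexh_pos.
- exact: pexh_cover.
- move=> x x0; have x1 : 0 < x + 1 by rewrite addr_gt0.
  have := cderivZ r^-1%:C (cderiv_cexp (cderivD
    (cderivZ r%:C (cderiv_real (is_derive1_ln x0)))
    (cderivZ (- r%:C) (cderiv_real (is_derive_ln_cst x1))))).
  rewrite (_ : (fun t => _) = h); last by apply/funext => t; rewrite /h mulNr.
  congr (cderiv _ _ _).
  rewrite -!rmorphM -!rmorphN -!rmorphM -!rmorphD cexp_real -!rmorphM /h'; congr (_%:C).
  rewrite (_ : (r - 1) * ln x - (r + 1) * ln (x + 1) =
    (r * ln x + - r * ln (x + 1)) - (ln x + ln (x + 1))); last by ring.
  rewrite expRB expRD !lnK ?posrE//; field.
  by rewrite !gt_eqF.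
- move=> x x0; have x1 : 0 < x + 1 by rewrite addr_gt0.
  apply: ccont_real; apply: continuous_cvg; first exact: continuous_expR.
  apply: cvgB; apply: cvgMr.
    exact: is_derive1_cvg (is_derive1_ln x0).
  exact: is_derive1_cvg (is_derive_ln_cst x1).
- exact: pexh_nd.
- by move=> x x0; rewrite /h' /= expR_ge0.
- have c1 : ln (@pexh_l R n + 1) @[n --> \oo] --> (0 : R).
    rewrite -[X in _ --> X](ln1 R) -[X in _ --> ln X]add0r.
    apply: continuous_cvg; last by apply: cvgD; [exact: cvg_pexh_l|exact: cvg_cst].
    by rewrite add0r; exact: continuous_ln.
  have Er n : r^-1 * expR (r * (ln (pexh_r R n) - ln (pexh_r R n + 1))) =
      r^-1 * expR (- r * ln (pexh_l R n + 1)).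
    congr (_ * expR _); rewrite mulNr -mulrN; congr (_ * _).
    rewrite (_ : pexh_l R n + 1 = (pexh_r R n + 1) / pexh_r R n); last first.
      by rewrite mulrDl divff ?gt_eqF ?expR_gt0// mul1r /pexh_r /pexh_l expRN addrC.
    by rewrite ln_div ?posrE ?addr_gt0 ?expR_gt0// opprB.
  have c2 : expR (- r * ln (pexh_l R n + 1)) @[n --> \oo] --> expR (- r * 0).
    by apply: continuous_cvg; [exact: continuous_expR|exact: cvgMr].
  have {}c2 : r^-1 * expR (- r * ln (pexh_l R n + 1)) @[n --> \oo] --> r^-1.
    by rewrite mulr0 expR0 in c2; rewrite -[X in _ --> X]mulr1; exact: cvgMr.
  have c3 : r^-1 * expR (r * (ln (pexh_l R n) - ln (pexh_l R n + 1))) @[n --> \oo] --> (0 : R).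
    rewrite -[X in _ --> X](mulr0 r^-1); apply: cvgMr.
    apply: (squeeze_cvgr _ (cvg_cst 0) (cvg_expR_linS r0)); near=> n.
    rewrite expR_ge0 ler_expR -mulrN ler_pM2l// /pexh_l expRK gerBl ln_ge0//.
    by rewrite lerDr expR_ge0.
  apply: (@ccvg_ext _ (fun n => (r^-1 * expR (- r * ln (pexh_l R n + 1)) -
      r^-1 * expR (r * (ln (pexh_l R n) - ln (pexh_l R n + 1))))%:C)).
    by move=> n; rewrite -Er rmorphB /= !hE.
  by apply: ccvg_real; rewrite -[X in _ --> X]subr0; exact: cvgB.
Unshelve. all: by end_near.
Qed.

End gamma_integral.

(** * Euler's integral for the Gamma function *)

Section restriction.
Context d (X : measurableType d) (R : realType) (mu : {measure set X -> \bar R}).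

Lemma has_int_restrict (D : set X) (f g : X -> R[i]) v : measurable D ->
  (forall x, D x -> g x = f x) -> (forall x, ~ D x -> g x = 0) ->
  has_int mu g v -> cintegrable mu D f /\ cintegral mu D f = v.
Proof.
move=> mD gf g0 [[i1 i2] <-].
have E1 : (fun x => complex.Re (g x)) = (fun x => complex.Re (f x)) \_ D.
  apply/funext => x; rewrite patchE; case: ifPn => [/set_mem/gf ->//|].
  by rewrite notin_setE => /g0 ->.
have E2 : (fun x => complex.Im (g x)) = (fun x => complex.Im (f x)) \_ D.
  apply/funext => x; rewrite patchE; case: ifPn => [/set_mem/gf ->//|].
  by rewrite notin_setE => /g0 ->.
split.
  split; apply/(integrable_mkcond _ mD); rewrite restrict_EFin.
    by rewrite -E1.
  by rewrite -E2.
by rewrite /cintegral (Rintegral_mkcond _ D) [in X in _ +i* X](Rintegral_mkcond _ D) E1 E2.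
Qed.

End restriction.

Section gamma_function.
Context (R : realType).
Local Notation leb := (@lebesgue_measure R).
Local Notation Re := (@complex.Re R).
Local Notation Im := (@complex.Im R).
Local Notation normc := (@ComplexField.Normc.normc R).
Implicit Types (z a b : R[i]).

Definition gam z (t : R) : R[i] :=
  if 0 < t then rpow t (z - 1) * (expR (- t))%:C else 0.

Lemma measurable_expRN : measurable_fun [set: R] (fun t : R => expR (- t)).
Proof.
apply: (measurable_continuous_comp (k := fun t : R => - t)); first exact: continuous_expR.
exact: measurable_funN.
Qed.

Lemma cmeas_gam z : cmeas (gam z).
Proof.
apply: cmeas_if; [exact: measurable_gt0|apply: cmeasM|exact: cmeas_cst].
  exact: cmeas_rpow.
by apply: cmeas_real; exact: measurable_expRN.
Qed.

Lemma normc_gam z t :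
  normc (gam z t) = if 0 < t then expR ((Re z - 1) * ln t - t) else 0.
Proof.
rewrite /gam normc_if ComplexField.Normc.normc0; case: ifP => // t0.
rewrite ComplexField.Normc.normcM normc_rpowE normc_real ger0_norm ?expR_ge0//.
by rewrite -expRD !ReE.
Qed.

Lemma cintegrable_gam z : 0 < Re z -> cintegrable leb setT (gam z).
Proof.
move=> z0; have [[i1 _] _] := beta1_integral z0.
pose K := Re z + 1; have K0 : 0 < K by rewrite addr_gt0.
apply: (@cintegrable_dom _ _ _ leb _ (fun t => expR (1 + K * ln K) * Re (if 0 < t
    then (expR ((Re z - 1) * ln t - (Re z + 1) * ln (t + 1)))%:C else 0))).
- exact: cmeas_gam.
- exact: (integrableZl measurableT (expR (1 + K * ln K)) i1).
- move=> t; rewrite normc_gam; case: ifPn => t0 /=; last by rewrite mulr0.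
  rewrite -expRD ler_expR; have := mul_ln_le K0 (addr_gt0 t0 ltr01).
  by rewrite /K; lra.
Qed.

Lemma Gamma_pos z : 0 < Re z -> Gamma z = cintegral leb setT (gam z).
Proof.
move=> z0; have m0 : Num.truncn (1 - Re z) = 0%N.
  by apply/truncn0Pn; rewrite -ltNge; lra.
rewrite /Gamma m0 big_ord0 divr1 addr0.
have [||||_ ->//] := @has_int_restrict _ _ _ leb `]0, +oo[%classic
  (fun t : R => cpow t%:C (z - 1) * (expR (- t))%:C) (gam z) (cintegral leb setT (gam z)).
- exact: measurable_itv.
- by move=> t /=; rewrite in_itv/= andbT /gam => t0; rewrite t0 rpow_cpow.
- by move=> t /=; rewrite in_itv/= andbT /gam => /negP/negPf ->.
- by split => //; exact: cintegrable_gam.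
Qed.

Lemma has_int_gam z : 0 < Re z -> has_int leb (gam z) (Gamma z).
Proof. by move=> z0; split; [exact: cintegrable_gam|rewrite Gamma_pos]. Qed.

Lemma has_int_gam_scale z (c : R) : 0 < Re z -> 0 < c ->
  has_int leb (fun t => if 0 < t then rpow t (z - 1) * (expR (- (c * t)))%:C else 0)
    (Gamma z * rpow c (- z)).
Proof.
move=> z0 c0.
have := has_intZ (rpow c (1 - z)) (has_int_scale c0 (has_int_gam z0)).
rewrite mulrA -[c^-1%:C]rpow1 ?invr_gt0// rpowV// -rpowD mulrC (_ : 1 - z - 1 = - z); last by ring.
apply: has_int_ext => t; rewrite /gam pmulr_rgt0//; case: ifPn => t0; last by rewrite mulr0.
rewrite rpowM// !mulrA -rpowD (_ : 1 - z + (z - 1) = 0); last by ring.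
by rewrite rpow0 mul1r.
Qed.

(** The function [t ^ z * exp (- t)] has equal limits at both ends of the half-line,
    so that its derivative integrates to zero. *)
Lemma GammaS z : 0 < Re z -> Gamma (z + 1) = z * Gamma z.
Proof.
move=> z0; have z10 : 0 < Re (z + 1) by rewrite ReD addr_gt0.
pose h (t : R) : R[i] := cexp (z * (ln t)%:C + (- 1) * t%:C).
pose h' (t : R) : R[i] := (z * t^-1%:C + (- 1) * 1%:C) * h t.
have hv : has_int leb (fun t => if 0 < t then h' t else 0) (z * Gamma z + (- 1) * Gamma (z + 1)).
  have := has_intD (has_intZ z (has_int_gam z0)) (has_intZ (- 1) (has_int_gam z10)).
  apply: has_int_ext => t; rewrite /gam /h' /h; case: ifPn => t0; last by rewrite !mulr0 addr0.
  have -> : - 1 * t%:C = (- t)%:C by rewrite mulN1r rmorphN.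
  by rewrite cexpD cexp_real -rpowE addrK rpowD rpowN rpow1// fmorphV; ring.
apply/eqP; rewrite eq_sym -subr_eq0 -mulN1r; apply/eqP.
apply: (@has_int_ftc R (fun t => 0 < t) (@pexh_l R) (@pexh_r R) h h') hv _.
- exact: pexh_lt.
- exact: pexh_pos.
- exact: pexh_cover.
- move=> x x0; apply: cderiv_cexp; apply: cderivD; apply: cderivZ.
    exact: cderiv_real (is_derive1_ln x0).
  exact: cderiv_real.
- move=> x x0; apply: ccontM.
    apply: ccontD; last exact: ccont_cst.
    apply: ccontM; first exact: ccont_cst.
    by apply: ccont_real; apply: cvgV; [rewrite gt_eqF|exact: cvg_id].
  apply: ccont_cexp; apply: ccontD; apply: ccontM; try exact: ccont_cst.
    by apply: ccont_real; exact: is_derive1_cvg (is_derive1_ln x0).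
  by apply: ccont_real; exact: cvg_id.
- have normch t : normc (h t) = expR (Re z * ln t - t).
    by rewrite normc_cexp !ReE /=; congr expR; ring.
  have c1 : ccvg (fun n => h (pexh_l R n)) 0.
    apply: (ccvg_small _ (cvg_expR_linS z0)) => n.
    by rewrite normch /pexh_l expRK ler_expR mulrN gerBl expR_ge0.
  have c2 : ccvg (fun n => h (pexh_r R n)) 0.
    pose K := Re z + 1; have K0 : 0 < K by rewrite addr_gt0.
    apply: (@ccvg_small _ _ (fun n => expR (K * ln K) * expR (- n.+1%:R))) => [n|].
      rewrite normch -expRD ler_expR.
      have := mul_ln_le K0 (expR_gt0 n.+1%:R); rewrite /pexh_r expRK /K; lra.
    by rewrite -[X in _ --> X](mulr0 (expR (K * ln K))); apply: cvgMr; exact: cvg_pexh_l.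
  have := ccvgD c2 (ccvgM (ccvg_cst (- 1)) c1); rewrite mulr0 addr0.
  by apply: ccvg_ext => n; rewrite mulN1r.
Qed.

Lemma Gamma1 : Gamma (1 : R[i]) = 1.
Proof.
have one0 : 0 < Re 1 by exact: ltr01.
pose h (t : R) : R[i] := (- expR (- t))%:C.
pose h' (t : R) : R[i] := (expR (- t))%:C.
have hv : has_int leb (fun t => if 0 < t then h' t else 0) (Gamma 1).
  apply: has_int_ext (has_int_gam one0) => t.
  by rewrite /gam subrr rpow0 mul1r.
apply: (@has_int_ftc R (fun t => 0 < t) (@pexh_l R) (@pexh_r R) h h') hv _.
- exact: pexh_lt.
- exact: pexh_pos.
- exact: pexh_cover.
- move=> x x0; apply: cderiv_real.
  have := @is_deriveN _ _ _ _ _ _ _ (@is_derive1_comp R expR (-%R) x _ _ (is_derive_expR _) (is_deriveN _)).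
  by move=> /(_ 1 (is_derive_id _ _)); rewrite mulrN1 opprK.
- move=> x x0; apply: ccont_real; apply: continuous_cvg; first exact: continuous_expR.
  by apply: cvgN; exact: cvg_id.
- have c1 : expR (- pexh_l R n) @[n --> \oo] --> (1 : R).
    rewrite -(expR0 R); apply: continuous_cvg; first exact: continuous_expR.
    by rewrite -oppr0; apply: cvgN; exact: cvg_pexh_l.
  apply: (@ccvg_ext _ (fun n => (- expR (- pexh_r R n) - - expR (- pexh_l R n))%:C)).
    by move=> n; rewrite rmorphB.
  apply: ccvg_real; rewrite -[X in _ --> X]opprK -[X in _ --> X]add0r; apply: cvgB; last exact: cvgN.
  by rewrite -oppr0; apply: cvgN; exact: cvg_pexh_r.
Qed.

End gamma_function.

(** * The beta integral *)

Section beta_integral.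
Context (R : realType).
Local Notation leb := (@lebesgue_measure R).
Local Notation Re := (@complex.Re R).
Local Notation Im := (@complex.Im R).
Local Notation normc := (@ComplexField.Normc.normc R).
Implicit Types (z a b s : R[i]).

Lemma has_int0 d (X : measurableType d) (mu : {measure set X -> \bar R}) :
  has_int mu (fun=> 0) (0 : R[i]).
Proof.
split; first by split => /=; exact: integrable0.
by rewrite /cintegral /Rintegral /= !integral0.
Qed.

(** The double integral of this kernel is [Gamma a * Gamma b] if the integral over
    [z.2] comes first, and [Gamma (a + b)] times a beta integral otherwise. *)
Definition betaker a b (z : R * R) : R[i] :=
  if (0 < z.1) && (0 < z.2)
  then rpow z.2 (a - 1) * rpow z.1 (a + b - 1) * (expR (- (z.1 * (1 + z.2))))%:C else 0.

Lemma cmeas_betaker a b : cmeas (betaker a b).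
Proof.
apply: cmeas_if; last exact: cmeas_cst.
  by apply: measurable_and; apply: measurable_gt0; [exact: measurable_fst|exact: measurable_snd].
apply: cmeasM; first by apply: cmeasM; apply: cmeas_rpow;
  [exact: measurable_snd|exact: measurable_fst].
apply: cmeas_real; apply: (measurable_continuous_comp (k := fun z : R * R => - (z.1 * (1 + z.2)))).
  exact: continuous_expR.
apply: measurable_funN; apply: measurable_funM; first exact: measurable_fst.
by apply: measurable_funD; [exact: measurable_cst|exact: measurable_snd].
Qed.

Lemma normc_betaker a b (z : R * R) :
  normc (betaker a b z) = Re (betaker (Re a)%:C (Re b)%:C z).
Proof.
rewrite /betaker normc_if ComplexField.Normc.normc0; case: ifP => // _.
rewrite !ComplexField.Normc.normcM !normc_rpowE normc_real ger0_norm ?expR_ge0//.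
by rewrite -[1]/(1%:C) -!rmorphB -rmorphD -!rmorphB !rpow_realE -!rmorphM /= !ReE.
Qed.

Lemma betaker_fst a b (y : R) : 0 < Re a ->
  has_int leb (fun r => betaker a b (y, r)) (Gamma a * gam b y).
Proof.
move=> a0; rewrite /betaker /gam /=; case: ifPn => y0 /=; last by rewrite mulr0; exact: has_int0.
have := has_intZ (rpow y (a + b - 1) * (expR (- y))%:C) (has_int_gam_scale a0 y0).
rewrite (_ : _ * (_ * _) = Gamma a * (rpow y (b - 1) * (expR (- y))%:C)); last first.
  rewrite (_ : a + b - 1 = a + (b - 1)); last by ring.
  by rewrite rpowD rpowN; field; exact: rpow_neq0.
apply: has_int_ext => r; case: ifPn => r0; last by rewrite mulr0.
by rewrite mulrDr mulr1 opprD expRD rmorphM; ring.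
Qed.

Lemma betaker_integral a b : 0 < Re a -> 0 < Re b ->
  has_int (prodm leb leb) (betaker a b) (Gamma a * Gamma b).
Proof.
move=> a0 b0.
have a0' : 0 < Re (Re a)%:C by [].
have b0' : 0 < Re (Re b)%:C by [].
apply: (@has_int_fubini _ _ _ _ _ leb leb 1 (betaker a b) (betaker (Re a)%:C (Re b)%:C)
  (fun y => Gamma a * gam b y) (fun y => Gamma (Re a)%:C * gam (Re b)%:C y)
  (Gamma a * Gamma b) (Gamma (Re a)%:C * Gamma (Re b)%:C)).
- exact: cmeas_betaker.
- exact: cmeas_betaker.
- by move=> z; rewrite -normc_betaker normc_ge0.
- by move=> z; rewrite -normc_betaker mul1r.
- by move=> y; exact: betaker_fst.
- by move=> y; exact: betaker_fst.
- exact: has_intZ (has_int_gam b0).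
- exact: has_intZ (has_int_gam b0').
Qed.

Definition bker a s (r : R) : R[i] :=
  if 0 < r then rpow r (a - 1) * rpow (1 + r) (- s) else 0.

Lemma betaker_snd a b (r : R) : 0 < Re a -> 0 < Re b ->
  has_int leb (fun y => betaker a b (y, r)) (Gamma (a + b) * bker a (a + b) r).
Proof.
move=> a0 b0; have ab0 : 0 < Re (a + b) by rewrite ReD addr_gt0.
rewrite /betaker /bker /=; case: ifPn => r0; last first.
  by under eq_fun do rewrite andbF; rewrite mulr0; exact: has_int0.
have r1 : 0 < 1 + r by rewrite addr_gt0.
have := has_intZ (rpow r (a - 1)) (has_int_gam_scale ab0 r1).
rewrite (_ : _ * (_ * _) = Gamma (a + b) * (rpow r (a - 1) * rpow (1 + r) (- (a + b)))); last by ring.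
apply: has_int_ext => y; rewrite andbT; case: ifPn => y0; last by rewrite mulr0.
by rewrite mulrA (mulrC y).
Qed.

(** The double integral of [betaker] in its two orders. Dividing by [Gamma (a + b)]
    requires [Gamma_neq0], which is proved from this form. *)
Lemma beta_integral_mul a b : 0 < Re a -> 0 < Re b ->
  has_int leb (fun r => Gamma (a + b) * bker a (a + b) r) (Gamma a * Gamma b).
Proof.
move=> a0 b0; have := has_int_swap (betaker_integral a0 b0).
move=> /has_int_fubini_fst; apply=> r; exact: betaker_snd.
Qed.

(** A zero [z] of Gamma gives, by the beta integral with [a = b = z / 2], zeros
    [z / 2 ^ k]; hence [Gamma (1 + z / 2 ^ k) = 0] for all [k], although this
    tends to [Gamma 1 = 1]. *)
Lemma Gamma_neq0 z : 0 < Re z -> Gamma z != 0.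
Proof.
move=> z0; apply/eqP => Gz.
pose w k : R[i] := z * ((2^-1 : R) ^+ k)%:C.
have Rew k : Re (w k) = Re z * 2^-1 ^+ k by rewrite /w ReM /= mulr0 subr0.
have w0 k : 0 < Re (w k) by rewrite Rew mulr_gt0// exprn_gt0// invr_gt0.
have Gw k : Gamma (w k) = 0.
  elim: k => [|k IH]; first by rewrite /w expr0 mulr1.
  have wS : w k.+1 + w k.+1 = w k.
    rewrite /w -mulrDr -rmorphD exprS; congr (_ * _%:C).
    by field.
  have := beta_integral_mul (w0 k.+1) (w0 k.+1); rewrite wS IH => H.
  have := has_int_unique H; move=> /(_ 0) E0.
  suff : Gamma (w k.+1) * Gamma (w k.+1) = 0 by move/eqP; rewrite mulf_eq0 orbb => /eqP.
  by apply: E0; apply: has_int_ext (@has_int0 _ _ leb) => r; rewrite mul0r.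
have GwS k : Gamma (w k + 1) = 0 by rewrite GammaS// Gw mulr0.
have zr : 0 < Re ((Re z)%:C + 1) by rewrite ReD addr_gt0.
have w1 k : 0 < Re (w k + 1) by rewrite ReD addr_gt0.
have one0 : 0 < Re 1 by exact: ltr01.
have [[i1 _] _] := has_intD (has_int_gam one0) (has_int_gam zr).
have [|||v hv cv] := @has_int_dct _ _ _ leb (fun k => gam (w k + 1)) (fun=> 0) (gam 1)
  (fun t => Re (gam 1 t + gam ((Re z)%:C + 1) t)) _ (cmeas_gam 1) i1.
- by move=> k; rewrite -(GwS k); exact: has_int_gam.
- move=> k t; rewrite normc_gam /gam; case: ifPn => t0; last by rewrite !ReE addr0.
  rewrite subrr rpow0 mul1r addrK rpow_realE -rmorphM -rmorphD /=.
  rewrite ReD Re1 addrK -expRD Rew.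
  have k1 : 0 <= (2^-1 : R) ^+ k <= 1.
    by rewrite exprn_ge0 ?invr_ge0//= exprn_ile1 ?invr_ge0// invf_le1// ler1n.
  have [t1|t1] := leP (ln t) 0.
    apply: (@le_trans _ _ (expR (- t))); last by rewrite lerDl expR_ge0.
    by rewrite ler_expR gerDr mulr_ge0_le0// mulr_ge0 ?ltW//; case/andP: k1.
  apply: (@le_trans _ _ (expR (Re z * ln t - t))); last by rewrite lerDr expR_ge0.
  rewrite ler_expR lerD2r ler_pM2r// -[X in _ <= X]mulr1 ler_pM2l//.
  by case/andP: k1.
- move=> t; rewrite /gam; case: ifPn => t0; last exact: ccvg_cst.
  apply: ccvgM; last exact: ccvg_cst.
  apply: (@ccvg_ext _ (fun k => cexp (w k * (ln t)%:C))) => [k|]; first by rewrite addrK rpowE.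
  rewrite rpowE subrr; apply: ccvg_cexp; apply: ccvgM; last exact: ccvg_cst.
  rewrite -(mulr0 z); apply: ccvgM; first exact: ccvg_cst.
  by apply: ccvg_real; apply: cvg_expr; rewrite ger0_norm ?invr_ge0// invf_lt1// ltr1n.
have E1 := has_int_unique hv (has_int_gam one0).
have := ccvg_unique cv (ccvg_cst 0); rewrite E1 Gamma1 => /eqP.
by rewrite oner_eq0.
Qed.

Lemma beta_integral a s : 0 < Re a -> Re a < Re s ->
  has_int leb (bker a s) (Gamma a * Gamma (s - a) / Gamma s).
Proof.
move=> a0 as0; have b0 : 0 < Re (s - a) by rewrite ReD ReN subr_gt0.
have s0 : Gamma s != 0 by apply: Gamma_neq0; exact: lt_trans as0.
have := has_intZ (Gamma s)^-1 (beta_integral_mul a0 b0).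
rewrite addrCA subrr addr0 mulrC; apply: has_int_ext => r.
by rewrite mulrA mulVf// mul1r.
Qed.

Lemma beta_integral_scale a s (c : R) : 0 < Re a -> Re a < Re s -> 0 < c ->
  has_int leb (fun r => if 0 < r then rpow r (a - 1) * rpow (c + r) (- s) else 0)
    (rpow c (a - s) * (Gamma a * Gamma (s - a) / Gamma s)).
Proof.
move=> a0 as0 c0; have ci0 : 0 < c^-1 by rewrite invr_gt0.
have := has_intZ (rpow c (a - 1 - s)) (has_int_scale ci0 (beta_integral a0 as0)).
rewrite mulrA invrK -[c%:C]rpow1// -rpowD (_ : a - 1 - s + 1 = a - s); last by ring.
apply: has_int_ext => r; rewrite /bker pmulr_rgt0//; case: ifPn => r0; last by rewrite mulr0.
have -> : c + r = c * (1 + c^-1 * r) by rewrite mulrDr mulr1 mulrA divff ?gt_eqF// mul1r.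
have r1 : 0 < 1 + c^-1 * r by rewrite addr_gt0// mulr_gt0.
rewrite !rpowM// rpowV// rpowD !rpowN.
by field; rewrite !rpow_neq0.
Qed.

End beta_integral.

(** * The reciprocal of Gamma and Gauss's limit *)

Section reciprocal_gamma.
Context (R : realType).
Local Notation leb := (@lebesgue_measure R).
Local Notation Re := (@complex.Re R).
Implicit Types (z : R[i]).

(** The number of factors in the analytic continuation can be increased at will. *)
Lemma Gamma_shift z M : 1 - Re z < M.+1%:R ->
  Gamma z = Gamma (z + M%:R) / \prod_(k < M) (z + k%:R).
Proof.
have key m : 0 < Re (z + m%:R) -> cintegral leb `]0, +oo[
    (fun t : R => cpow t%:C (z + m%:R - 1) * (expR (- t))%:C) = Gamma (z + m%:R).
  move=> zm; rewrite Gamma_pos//.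
  have [||||_ ->//] := @has_int_restrict _ _ _ leb `]0, +oo[%classic
    (fun t : R => cpow t%:C (z + m%:R - 1) * (expR (- t))%:C) (gam (z + m%:R))
    (cintegral leb setT (gam (z + m%:R))).
  - exact: measurable_itv.
  - by move=> t /=; rewrite in_itv/= andbT /gam => t0; rewrite t0 rpow_cpow.
  - by move=> t /=; rewrite in_itv/= andbT /gam => /negP/negPf ->.
  - by split => //; exact: cintegrable_gam.
have pos m : 1 - Re z < m.+1%:R -> 0 < Re (z + m%:R).
  by rewrite ReD Re_nat -natr1; lra.
set m0 := Num.truncn (1 - Re z) => zM.
have m0M : (m0 <= M)%N by rewrite truncn_le_nat.
rewrite [LHS]/Gamma -/m0 key; last by apply: pos; exact: truncnS_gt.
elim: M m0M zM => [|M IH]; first by rewrite leqn0 => /eqP ->.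
rewrite leq_eqVlt => /predU1P[<-//|]; rewrite ltnS => m0M zM.
have zM' : 1 - Re z < M.+1%:R by rewrite -truncn_le_nat.
rewrite IH// big_ord_recr /= -natr1 addrA GammaS ?pos//.
have zM0 : z + M%:R != 0 by apply: Re_neq0; exact: pos.
by rewrite (mulrC (z + M%:R)) -mulf_div divff// mulr1.
Qed.

(** The reciprocal of Gamma satisfies the functional equation everywhere, the
    poles of Gamma included. *)
Lemma rGammaS z : (Gamma z)^-1 = z * (Gamma (z + 1))^-1.
Proof.
pose M := Num.truncn (1 - Re z).
have zM := truncnS_gt (1 - Re z).
rewrite (@Gamma_shift z M.+1); last by rewrite (lt_trans zM)// ltr_nat.
rewrite (@Gamma_shift (z + 1) M); last by rewrite ReD Re1; apply: le_lt_trans zM; lra.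
rewrite -addrA -natr1 (addrC M%:R); set g := Gamma _; clearbody g.
rewrite !invf_div big_ord_recl /= addr0 (eq_bigr (fun k : 'I_M => z + 1 + k%:R)).
  by rewrite mulrA.
by move=> k _; rewrite /= -addrA -natr1 (addrC 1).
Qed.

End reciprocal_gamma.

Section gauss_limit.
Context (R : realType).
Local Notation leb := (@lebesgue_measure R).
Local Notation Re := (@complex.Re R).
Local Notation normc := (@ComplexField.Normc.normc R).
Implicit Types (z : R[i]) (x s t : R).

(** Concavity of the logarithm between [1] and [1 + x / s]. *)
Lemma ln1D_mono x s t : 0 <= x -> 0 < s -> s <= t ->
  s * ln (1 + x / s) <= t * ln (1 + x / t).
Proof.
move=> x0 s0 st; have t0 : 0 < t by exact: lt_le_trans st.
have xs : 0 < 1 + x / s by rewrite ltr_pwDl// divr_ge0// ltW.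
have xt : 0 < 1 + x / t by rewrite ltr_pwDl// divr_ge0// ltW.
have h1 := ln_le_sub1 (divr_gt0 xs xt); have h2 := ln_le_sub1 (divr_gt0 (@ltr01 R) xt).
rewrite !ln_div ?posrE// ln1 in h1 h2.
have : s * (ln (1 + x / s) - ln (1 + x / t)) + (t - s) * (0 - ln (1 + x / t)) <=
    s * ((1 + x / s) / (1 + x / t) - 1) + (t - s) * (1 / (1 + x / t) - 1).
  by apply: lerD; apply: ler_wpM2l => //; [exact: ltW|rewrite subr_ge0].
rewrite [X in _ <= X](_ : _ = 0); first by lra.
by field; rewrite !gt_eqF//= addrC -[x + t]addrC; nra.
Qed.

Lemma cvg_ln1D x : 0 <= x -> n.+1%:R * ln (1 + x / n.+1%:R) @[n --> \oo] --> x.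
Proof.
move=> x0.
have c0 : x / n.+1%:R @[n --> \oo] --> (0 : R).
  rewrite -[X in _ --> X](mulr0 x); apply: cvgMr; exact: cvg_harmonic.
have cl : x / (1 + x / n.+1%:R) @[n --> \oo] --> x.
  rewrite -[X in _ --> X]mulr1; apply: cvgMr; rewrite -[X in _ --> X]invr1.
  apply: cvgV; first exact: oner_neq0.
  by rewrite -[X in _ --> X]addr0; apply: cvgD => //; exact: cvg_cst.
apply: (squeeze_cvgr _ cl (cvg_cst x)); apply: nearW => n.
have n0 : 0 < n.+1%:R :> R by rewrite ltr0n.
have xn : 0 < 1 + x / n.+1%:R by rewrite ltr_pwDl// divr_ge0// ltW.
apply/andP; split; last first.
  rewrite -ler_pdivlMl// [leRHS]mulrC; have := ln_le_sub1 xn.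
  by set y := x / _; lra.
have := ln_le_sub1 (divr_gt0 (@ltr01 R) xn); rewrite ln_div ?posrE// ln1 => h.
rewrite -ler_pdivrMl//.
have -> : n.+1%:R^-1 * (x / (1 + x / n.+1%:R)) = 1 - 1 / (1 + x / n.+1%:R).
  by field; rewrite !gt_eqF//=; nra.
by move: h; set y := 1 / _; lra.
Qed.

(** Gauss's limit, from the beta integral [B (z, n)] rescaled by [n]. *)
Lemma Gamma_gauss z : 0 < Re z ->
  ccvg (fun n => rpow n.+1%:R z * Gamma n.+1%:R / Gamma (z + n.+1%:R)) 1.
Proof.
move=> z0.
pose f n (x : R) : R[i] := if 0 < x
  then rpow x (z - 1) * rpow (1 + x / n.+1%:R) (- (z + n.+1%:R)) else 0.
have n0 n : 0 < n.+1%:R :> R by rewrite ltr0n.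
have hf n : has_int leb (f n) (rpow n.+1%:R z * (Gamma z * Gamma n.+1%:R / Gamma (z + n.+1%:R))).
  have zn : Re z < Re (z + n.+1%:R) by rewrite ReD Re_nat ltrDl.
  have ni0 : 0 < n.+1%:R^-1 :> R by rewrite invr_gt0.
  have := has_intZ (rpow n.+1%:R (z - 1)) (has_int_scale ni0 (beta_integral z0 zn)).
  rewrite (_ : z + n.+1%:R - z = n.+1%:R); last by rewrite addrC addKr.
  rewrite mulrA invrK -[n.+1%:R%:C]rpow1// -rpowD subrK.
  apply: has_int_ext => x; rewrite /f /bker pmulr_rgt0//; case: ifPn => x0; last by rewrite mulr0.
  rewrite rpowM// rpowV// rpowN mulrA mulVKf ?rpow_neq0//.
  by rewrite (mulrC _ x).
(* The majorant is [x ^ (Re z - 1) * (1 + x / N0) ^ (- N0)], integrable as [Re z < N0]. *)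
pose N0 := (Num.truncn (Re z)).+1; have zN0 : Re z < N0%:R by exact: truncnS_gt.
have N00 : 0 < N0%:R :> R by rewrite ltr0n.
have z0' : 0 < Re (Re z)%:C by [].
have zN0' : Re (Re z)%:C < Re N0%:R by rewrite Re_nat.
have ni0 : 0 < N0%:R^-1 :> R by rewrite invr_gt0.
have [[iG _] _] := has_intZ ((rpow N0%:R (Re z - 1)%:C)) (has_int_scale ni0 (beta_integral z0' zN0')).
have [||v hv cv] := @has_int_dct _ _ _ leb (fun n => f (n + N0.-1)%N) _ (gam z) _
   (fun n => hf (n + N0.-1)%N) (cmeas_gam z) iG.
- move=> n x; rewrite /f /bker pmulr_rgt0//; case: ifPn => x0; last first.
    by rewrite ComplexField.Normc.normc0 mulr0.
  have a1 : 0 < 1 + x / (n + N0.-1).+1%:R by rewrite ltr_pwDl// divr_ge0// ltW.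
  have a2 : 0 < 1 + N0%:R^-1 * x by rewrite ltr_pwDl// mulr_ge0// ltW.
  rewrite ComplexField.Normc.normcM !normc_rpowE.
  rewrite -[1%R : R[i]]/(1%:C) -rmorphB rpowM// rpowV// rpowN mulrA mulVKf ?rpow_neq0//.
  have -> : (- N0%:R : R[i]) = (- N0%:R)%:C by rewrite rmorphN rmorph_nat.
  rewrite !rpow_realE -rmorphM /= !ReE ler_pM2l ?expR_gt0// ler_expR.
  have := @ln1D_mono x N0%:R (n + N0.-1).+1%:R (ltW x0) N00.
  rewrite ler_nat -addnS /= leq_addl (mulrC N0%:R^-1) => /(_ isT).
  have : 0 <= ln (1 + x / (n + N0)%:R) by rewrite ln_ge0// lerDl divr_ge0// ltW.
  rewrite !mulNr lerN2 mulrDl; nra.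
- move=> x; rewrite /f /gam; case: ifPn => x0; last exact: ccvg_cst.
  apply: ccvgM; first exact: ccvg_cst.
  apply/(@ccvg_shift _ (N0.-1) (fun n => rpow (1 + x / n.+1%:R) (- (z + n.+1%:R)))).
  apply: (@ccvg_ext _ (fun n => cexp ((- z) * (ln (1 + x / n.+1%:R))%:C +
      (- (n.+1%:R * ln (1 + x / n.+1%:R)))%:C))) => [n|].
    rewrite rpowE; congr cexp; rewrite rmorphN rmorphM rmorph_nat; ring.
  rewrite -cexp_real -[X in cexp X]add0r; apply: ccvg_cexp; apply: ccvgD; last first.
    by apply: ccvg_real; apply: cvgN; apply: cvg_ln1D; exact: ltW.
  rewrite -(mulr0 (- z)); apply: ccvgM; first exact: ccvg_cst.
  apply: ccvg_real; rewrite -(ln1 R); apply: continuous_cvg; first exact: continuous_ln.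
  rewrite -[X in _ --> X]addr0; apply: cvgD; first exact: cvg_cst.
  by rewrite -[X in _ --> X](mulr0 x); apply: cvgMr; exact: cvg_harmonic.
- have Gz := Gamma_neq0 z0.
  apply/(@ccvg_shift _ N0.-1).
  rewrite (has_int_unique hv (has_int_gam z0)) in cv.
  have := ccvgM (ccvg_cst (Gamma z)^-1) cv; rewrite mulVf//.
  have alg (g y w r : R[i]) : g != 0 -> g^-1 * (r * (g * y / w)) = r * y / w.
    by move=> g0; rewrite mulrCA -!mulrA mulKf.
  by apply: ccvg_ext => n; exact: alg.
Qed.

End gauss_limit.

(** * Cauchy's beta integral: recursion *)

(** [det] powers in size one: [q] to the power [- {s || t}]. *)
HB.lock Definition qpow (R : realType) (q s t : R[i]) : R[i] :=
  cexp (- (s * rlog q + t * (rlog q)^*)).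

Section half_plane_power.
Context (R : realType).
Local Notation Re := (@complex.Re R).
Local Notation Im := (@complex.Im R).
Local Notation normc := (@ComplexField.Normc.normc R).
Implicit Types (q s t : R[i]).

Lemma qpowE q s t : qpow q s t = cexp (- (s * rlog q + t * (rlog q)^*)).
Proof. by rewrite qpow.unlock. Qed.

Lemma cmeas_qpow d (X : measurableType d) (f : X -> R[i]) s t :
  cmeas f -> cmeas (fun x => qpow (f x) s t).
Proof.
move=> mf; have ml := cmeas_rlog mf; under eq_fun do rewrite qpowE.
apply: cmeas_cexp; apply: cmeasN; apply: cmeasD; apply: cmeasM => //; try exact: cmeas_cst.
exact: cmeasJ.
Qed.

Lemma qpow_neq0 q s t : qpow q s t != 0.
Proof. by rewrite qpowE cexp_neq0. Qed.

Lemma qpowZ (a : R) q s t : 0 < a -> q != 0 ->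
  qpow (a%:C * q) s t = rpow a (- (s + t)) * qpow q s t.
Proof.
move=> a0 q0; rewrite !qpowE rpowE -cexpD; congr cexp.
rewrite rlogZ//; move: (rlog q) => l.
by apply: complex_ext; rewrite !(ReE, ImE) /=; ring.
Qed.

Lemma qpowD q s t s' t' : qpow q (s + s') (t + t') = qpow q s t * qpow q s' t'.
Proof. by rewrite !qpowE -cexpD; congr cexp; ring. Qed.

Lemma qpow00 q : qpow q 0 0 = 1.
Proof. by rewrite qpowE !mul0r addr0 oppr0 cexp0. Qed.

Lemma qpow10 q : 0 < Re q -> qpow q 1 0 = q^-1.
Proof. by move=> q0; rewrite qpowE mul1r mul0r addr0 cexpN cexp_rlog. Qed.

Lemma qpow01 q : 0 < Re q -> qpow q 0 1 = (q^*)^-1.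
Proof. by move=> q0; rewrite qpowE mul1r mul0r add0r cexpN cexpJ cexp_rlog. Qed.

Lemma normc_qpow q s t :
  normc (qpow q s t) = expR (- (Re (s + t) * ln (normc q)) + (Im s - Im t) * Im (rlog q)).
Proof. by rewrite qpowE normc_cexp !ReE /rlog /=; congr expR; ring. Qed.

(** Domination by the same function with real, equal exponents. *)
Definition qmean s t : R[i] := ((Re s + Re t) / 2)%:C.

Lemma qpow_mean q s t :
  qpow q (qmean s t) (qmean s t) = (expR (- (Re (s + t) * ln (normc q))))%:C.
Proof.
rewrite qpowE -mulrDr -cexp_real; congr cexp.
by apply: complex_ext; rewrite ?ReE ?ImE /rlog /=; field.
Qed.

Lemma normc_qpow_le q s t : normc (qpow q s t) <=
  expR (`|Im s - Im t| * (pi / 2)) * Re (qpow q (qmean s t) (qmean s t)).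
Proof.
rewrite normc_qpow qpow_mean /= -expRD ler_expR addrC lerD2r.
apply: (le_trans (ler_norm _)); rewrite normrM ler_wpM2l//.
exact: ltW (normc_rlog_arg _).
Qed.

Lemma Re_qpow_mean_ge0 q s t : 0 <= Re (qpow q (qmean s t) (qmean s t)).
Proof. by rewrite qpow_mean expR_ge0. Qed.

Lemma qmean_sum s t : Re (qmean s t + qmean s t) = Re (s + t).
Proof. by rewrite !ReE /=; field. Qed.

End half_plane_power.

Section cauchy_integral.
Context (R : realType).
Local Notation leb := (@lebesgue_measure R).
Local Notation Re := (@complex.Re R).
Local Notation Im := (@complex.Im R).
Local Notation normc := (@ComplexField.Normc.normc R).
Implicit Types (s t : R[i]) (x : R).

Definition cline s t x : R[i] := qpow (1 +i* x) s t.

Lemma cmeas_cline s t : cmeas (cline s t).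
Proof. by apply: cmeas_qpow; split => //=; exact: measurable_cst. Qed.

Lemma ln_normc_line x : ln (normc (1 +i* x)) = ln (1 + x ^+ 2) / 2.
Proof.
rewrite /= expr1n.
have x0 : 0 < 1 + x ^+ 2 by rewrite ltr_pwDl// sqr_ge0.
rewrite -[in RHS](sqr_sqrtr (ltW x0)) lnXn ?sqrtr_gt0//.
by rewrite mulr2n; field.
Qed.

(** In terms of [atan x], the argument of [1 + i x]. *)
Lemma clineE s t x : cline s t x =
  cexp (- (s + t) * (ln (1 + x ^+ 2) / 2)%:C + (- 'i%C * (s - t)) * (atan x)%:C).
Proof.
rewrite /cline qpowE; congr cexp; rewrite /rlog ln_normc_line /= divr1.
by apply: complex_ext; rewrite ?ReE ?ImE /=; ring.
Qed.

Lemma is_derive_ln1D2 x : is_derive x 1 (fun u : R => ln (1 + u ^+ 2) / 2) (x / (1 + x ^+ 2)).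
Proof.
have x0 : 0 < 1 + x ^+ 2 by rewrite ltr_pwDl// sqr_ge0.
have d1 : is_derive x (1 : R) (fun u : R => 1 + u * u) (x * 1 + x * 1).
  have := @is_deriveD _ _ _ _ _ _ _ _ _ (@is_derive_cst _ _ R (1 : R) x 1)
    (is_derive_mul (@is_derive_id _ _ x 1) (@is_derive_id _ _ x 1)).
  by rewrite add0r.
have d2 := @is_derive1_comp R (@ln R) _ x _ _ (is_derive1_ln x0) d1.
have H : is_derive x 1 (fun u : R => ln (1 + u ^+ 2) / 2)
    (ln (1 + x * x) * 0 + 2^-1 * ((1 + x ^+ 2)^-1 * (x * 1 + x * 1))).
  exact: (is_derive_mul d2 (@is_derive_cst _ _ R (2^-1 : R) x 1)).
by apply: (is_derive_eq H); field; rewrite gt_eqF.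
Qed.

Lemma normc_cline s t x : normc (cline s t x) <=
  expR (`|Im s - Im t| * (pi / 2)) * expR (- (Re (s + t) * (ln (1 + x ^+ 2) / 2))).
Proof.
by rewrite /cline; apply: (le_trans (normc_qpow_le _ _ _)); rewrite qpow_mean ln_normc_line.
Qed.

Lemma has_int_reflect (f : R -> R[i]) v :
  has_int leb f v -> has_int leb (fun x => f (- x)) v.
Proof.
move=> H; pose phi (x : measurableTypeR R) : measurableTypeR R := - x.
have mphi : measurable_fun setT phi by exact: measurable_funN.
apply: ((has_int_preserving v mphi _ (has_int_cmeas H)).1 H) => A mA.
exact: esym (lebesgue_measureN mA).
Qed.

(** Comparison with [(2 + |x|) ^ (- p)] for [p = Re (s + t)], a shifted beta integral
    on each half-line. *)
Lemma cintegrable_cline s t : 1 < Re (s + t) -> cintegrable leb setT (cline s t).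
Proof.
move=> p1; set p := Re (s + t) in p1.
have one0 : 0 < Re 1 by exact: ltr01.
have p1' : Re 1 < Re p%:C by [].
have H := has_int_shift 1 (beta_integral one0 p1').
(* The constant [8 ^ (p / 2)] comes from [(2 + y) ^ 2 <= 8 * (1 + y ^ 2)]. *)
have [[iG _] _] := has_intZ (expR (`|Im s - Im t| * (pi / 2)) * expR (p / 2 * ln 8))%:C
  (has_intD H (has_int_reflect H)).
have x20 x : 0 < 1 + x ^+ 2 by rewrite ltr_pwDl// sqr_ge0.
apply: (@cintegrable_dom _ _ _ leb _ _ (cmeas_cline s t) iG) => x.
apply: (le_trans (normc_cline _ _ _)); rewrite -/p ReM /= mul0r subr0 -mulrA.
rewrite ler_pM2l ?expR_gt0// -ler_pdivrMl ?expR_gt0// -expRN -expRD.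
have bk y : 0 < y -> Re (bker 1 p%:C y) = expR (- (p * ln (1 + y))).
  by move=> y0; rewrite /bker y0 subrr rpow0 mul1r -rmorphN rpow_realE mulNr.
have bk0 y : 0 <= Re (bker 1 p%:C y).
  by rewrite /bker; case: ifP => //; rewrite subrr rpow0 mul1r -rmorphN rpow_realE /= expR_ge0.
have key y : 0 <= y -> expR (- (p / 2 * ln 8) + - (p * (ln (1 + y ^+ 2) / 2))) <= Re (bker 1 p%:C (y + 1)).
  move=> y0; have y1 : 0 < 1 + (y + 1) by lra.
  rewrite bk ?ler_expR; last by lra.
  have : ln ((1 + (y + 1)) ^+ 2) <= ln (8 * (1 + y ^+ 2)).
    by rewrite ler_ln ?posrE ?mulr_gt0 ?exprn_gt0//; nra.
  rewrite lnXn// lnM ?posrE// -mulr_natr => h.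
  by nra.
rewrite ReD; case: (leP 0 x) => x0.
  by apply: (le_trans (key _ x0)); rewrite lerDl.
have nx0 : 0 <= - x by lra.
by have := key _ nx0; rewrite sqrrN => /le_trans; apply; rewrite lerDr.
Qed.

Definition cint s t : R[i] := cintegral leb setT (cline s t).

Lemma has_int_cline s t : 1 < Re (s + t) -> has_int leb (cline s t) (cint s t).
Proof. by move=> p1; split => //; exact: cintegrable_cline. Qed.

Lemma clineSl s t x : cline (s + 1) t x = cline s t x / (1 +i* x).
Proof.
rewrite /cline -[t in LHS]addr0 qpowD qpow10//=; exact: ltr01.
Qed.

Lemma clineSr s t x : cline s (t + 1) x = cline s t x / (1 -i* x).
Proof.
rewrite /cline -[s in LHS]addr0 qpowD qpow01//=; exact: ltr01.
Qed.

Definition rexh (n : nat) : R := n.+1%:R.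

(** The derivative of the integrand integrates to zero. *)
Lemma cint_parts s t : 0 < Re (s + t) -> s * cint (s + 1) t = t * cint s (t + 1).
Proof.
move=> p0.
have p1 : 1 < Re (s + 1 + t) by move: p0; rewrite !ReE; lra.
have p2 : 1 < Re (s + (t + 1)) by move: p0; rewrite !ReE; lra.
pose h' x := (- 'i%C * s) * cline (s + 1) t x + ('i%C * t) * cline s (t + 1) x.
have hv := has_intD (has_intZ (- 'i%C * s) (has_int_cline p1)) (has_intZ ('i%C * t) (has_int_cline p2)).
suff /eqP : (- 'i%C * s) * cint (s + 1) t + ('i%C * t) * cint s (t + 1) = 0.
  rewrite mulNr mulNr addrC subr_eq0 -!mulrA => /eqP.
  have i0 : 'i%C != 0 :> R[i] by rewrite eq_complex /= eqxx/= oner_eq0.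
  by move/(mulfI i0).
have dh x : cderiv (cline s t) x (h' x).
  have := cderiv_cexp (cderivD
    (cderivZ (- (s + t)) (cderiv_real (is_derive_ln1D2 x)))
    (cderivZ (- 'i%C * (s - t)) (cderiv_real (is_derive1_atan x)))).
  rewrite -clineE (_ : (fun u => cexp _) = cline s t); last by apply/funext => u; rewrite clineE.
  congr (cderiv _ _ _); rewrite /h' clineSl clineSr.
  have x20 : 1 + x ^+ 2 != 0 by rewrite gt_eqF// ltr_pwDl// sqr_ge0.
  have h1 : (1 +i* x) != 0 :> R[i] by rewrite eq_complex /= oner_eq0.
  have h2 : (1 -i* x) != 0 :> R[i] by rewrite eq_complex /= oner_eq0.
  have h12 : (1 +i* x) * (1 -i* x) = (1 + x ^+ 2)%:C.
    by apply: complex_ext; rewrite !(ReE, ImE) /=; ring.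
  have e1 : (1 +i* x)^-1 = (1 + x ^+ 2)^-1%:C * (1 -i* x).
    by apply: (mulfI h1); rewrite mulfV// mulrCA h12 -rmorphM mulVf.
  have e2 : (1 -i* x)^-1 = (1 + x ^+ 2)^-1%:C * (1 +i* x).
    by apply: (mulfI h2); rewrite mulfV// mulrCA (mulrC (1 -i* x)) h12 -rmorphM mulVf.
  rewrite e1 e2; move: (cline s t x) (1 + x ^+ 2)^-1 => c y.
  by apply: complex_ext; rewrite !(ReE, ImE) /=; ring.
apply: (@has_int_ftc R xpredT (fun n => - rexh n) rexh (cline s t) h' _ _ _ _ _ _ _ hv).
- by move=> n; rewrite gtrN// ltr0n.
- by [].
- move=> x _; near=> n; rewrite -ler_norml.
  apply: (@le_trans _ _ n%:R); last by rewrite ler_nat.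
  by near: n; exact: nbhs_infty_ger.
- by [].
- move=> x _; have cc s' t' : ccont (cline s' t') x.
    rewrite (_ : cline s' t' = fun u => cexp (- (s' + t') * (ln (1 + u ^+ 2) / 2)%:C +
      (- 'i%C * (s' - t')) * (atan u)%:C)); last by apply/funext => u; rewrite clineE.
    apply: ccont_cexp; apply: ccontD; apply: ccontM; try exact: ccont_cst.
      apply: ccont_real; exact: is_derive1_cvg (is_derive_ln1D2 x).
    by apply: ccont_real; exact: continuous_atan.
  by apply: ccontD; apply: ccontM; try exact: ccont_cst; exact: cc.
- have lim (x_ : nat -> R) : (forall n, normc (cline s t (x_ n)) <=
      expR (`|Im s - Im t| * (pi / 2)) * expR (- (Re (s + t) * ln n.+1%:R))) ->
      ccvg (fun n => cline s t (x_ n)) 0.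
    move=> hx; apply: (ccvg_small hx).
    rewrite -[X in _ --> X](mulr0 (expR (`|Im s - Im t| * (pi / 2)))); apply: cvgMr.
    have /cvg_pinftyP := @cvgr_expR R; apply; apply/cvgryPge => A; near=> n.
    have : expR (A / Re (s + t)) <= n%:R by near: n; exact: nbhs_infty_ger.
    rewrite -ler_ln ?posrE ?expR_gt0//; last first.
      by rewrite ltr0n; near: n; exact: nbhs_infty_gt.
    rewrite expRK ler_pdivrMr// mulrC => /le_trans; apply.
    rewrite ler_pM2l// ler_ln ?posrE ?ltr0n// ?ler_nat//.
    by near: n; exact: nbhs_infty_gt.
  have bound n (x : R) : x ^+ 2 = n.+1%:R ^+ 2 -> normc (cline s t x) <=
      expR (`|Im s - Im t| * (pi / 2)) * expR (- (Re (s + t) * ln n.+1%:R)).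
    move=> x2; apply: (le_trans (normc_cline _ _ _)); rewrite ler_pM2l ?expR_gt0//.
    rewrite ler_expR lerN2 ler_pM2l// x2 ler_pdivlMr// mulr_natr -lnXn// ler_ln ?posrE.
    - by rewrite lerDr.
    - by rewrite exprn_gt0.
    - by rewrite ltr_pwDl// sqr_ge0.
  have l1 := lim rexh (fun n => bound n _ erefl).
  have l2 : ccvg (fun n => cline s t (- rexh n)) 0 by apply: lim => n; apply: bound; rewrite sqrrN.
  have := ccvgD l1 (ccvgM (ccvg_cst (- 1)) l2); rewrite mulr0 addr0.
  by apply: ccvg_ext => n; rewrite mulN1r.
Unshelve. all: by end_near.
Qed.

(** Because [(1 + i x) + (1 - i x) = 2]. *)
Lemma cint_sum s t : 0 < Re (s + t) ->
  2 * cint (s + 1) (t + 1) = cint (s + 1) t + cint s (t + 1).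
Proof.
move=> p0.
have p1 : 1 < Re (s + 1 + t) by move: p0; rewrite !ReE; lra.
have p2 : 1 < Re (s + (t + 1)) by move: p0; rewrite !ReE; lra.
have p3 : 1 < Re (s + 1 + (t + 1)) by move: p0; rewrite !ReE; lra.
apply: (has_int_unique (has_intZ 2 (has_int_cline p3))).
apply: has_int_ext (has_intD (has_int_cline p1) (has_int_cline p2)) => x.
rewrite !(clineSl, clineSr).
have h1 : (1 +i* x) != 0 :> R[i] by rewrite eq_complex /= oner_eq0.
have h2 : (1 -i* x) != 0 :> R[i] by rewrite eq_complex /= oner_eq0.
have -> : 2 = (1 +i* x) + (1 -i* x) :> R[i].
  by apply: complex_ext; rewrite !(ReE, ImE) /= ?subrr.
by field; rewrite h1 h2.
Qed.

(** The two relations between neighbours solve to a first order recursion. *)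
Lemma cintSr s t : 1 < Re (s + t) -> 2 * t * cint s (t + 1) = (s + t - 1) * cint s t.
Proof.
move=> p1; have p0 : 0 < Re (s - 1 + t) by move: p1; rewrite !ReE; lra.
have := cint_sum p0; have := cint_parts p0; rewrite subrK => e1 e2.
rewrite mulrAC e2 mulrDl [in X in _ + X]mulrC -e1; ring.
Qed.

Lemma cintSl s t : 1 < Re (s + t) -> 2 * s * cint (s + 1) t = (s + t - 1) * cint s t.
Proof.
move=> p1; have p0 : 0 < Re (s + (t - 1)) by move: p1; rewrite !ReE; lra.
have := cint_sum p0; have := cint_parts p0; rewrite subrK => e1 e2.
rewrite mulrAC e2 mulrDl [in X in X + _]mulrC e1; ring.
Qed.

(** The primitive is [atan]. *)
Lemma cint11 : cint 1 1 = pi%:C.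
Proof.
have p1 : 1 < Re (1 + 1) by rewrite !ReE; lra.
have hv := has_int_cline p1.
have E x : cline 1 1 x = (1 + x ^+ 2)^-1%:C.
  have x0 : 0 < 1 + x ^+ 2 by rewrite ltr_pwDl// sqr_ge0.
  rewrite clineE subrr mulr0 mul0r addr0 -[1 + 1](rmorph_nat (real_complex R) 2) -rmorphN -rmorphM.
  by rewrite cexp_real mulNr mulrC divfK// expRN lnK.
apply: (@has_int_ftc R xpredT (fun n => - rexh n) rexh (fun x => (atan x)%:C) (cline 1 1) _ _ _ _ _ _ _ hv).
- by move=> n; rewrite gtrN// ltr0n.
- by [].
- move=> x _; near=> n; rewrite -ler_norml.
  apply: (@le_trans _ _ n%:R); last by rewrite ler_nat.
  by near: n; exact: nbhs_infty_ger.
- by move=> x _; rewrite E; apply: cderiv_real; exact: is_derive1_atan.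
- move=> x _; rewrite (_ : cline 1 1 = fun x => (1 + x ^+ 2)^-1%:C); last exact/funext.
  apply: ccont_real; apply: cvgV; first by rewrite gt_eqF// ltr_pwDl// sqr_ge0.
  by apply: cvgD; [exact: cvg_cst|rewrite expr2; apply: cvgM; exact: cvg_id].
- have l : atan (rexh n) @[n --> \oo] --> (pi / 2 : R).
    have /cvg_pinftyP := @cvgy_atan R; apply; apply/cvgryPge => A; near=> n.
    apply: (@le_trans _ _ n%:R); last by rewrite ler_nat.
    by near: n; exact: nbhs_infty_ger.
  apply: (@ccvg_ext _ (fun n => (atan (rexh n) + atan (rexh n))%:C)).
    by move=> n; rewrite atanN -rmorphB opprK.
  by apply: ccvg_real; rewrite [X in _ --> X](splitr pi); exact: cvgD.
Unshelve. all: by end_near.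
Qed.

End cauchy_integral.

(** * Cauchy's beta integral: value *)

Section cauchy_formula.
Context (R : realType).
Local Notation leb := (@lebesgue_measure R).
Local Notation Re := (@complex.Re R).
Local Notation Im := (@complex.Im R).
Local Notation normc := (@ComplexField.Normc.normc R).
Implicit Types (s t : R[i]) (x : R).

Lemma cline_addn s t n x :
  cline (s + n%:R) (t + n%:R) x = cline s t x * (expR (- (n%:R * ln (1 + x ^+ 2))))%:C.
Proof.
rewrite !clineE -cexp_real -cexpD; congr cexp; rewrite -!(rmorph_nat (real_complex R)).
by apply: complex_ext; rewrite !(ReE, ImE) /=; field.
Qed.

(** Laplace's method at the saddle point [0]. *)
Lemma cint_laplace s t : 1 < Re (s + t) ->
  ccvg (fun n => (Num.sqrt n.+1%:R)%:C * cint (s + n.+1%:R) (t + n.+1%:R)) (Num.sqrt pi)%:C.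
Proof.
move=> p1; pose rt n : R := Num.sqrt n.+1%:R.
have rt0 n : 0 < rt n by rewrite sqrtr_gt0 ltr0n.
have ri0 n : 0 < (rt n)^-1 by rewrite invr_gt0.
have rt2 n x : ((rt n)^-1 * x) ^+ 2 = x ^+ 2 / n.+1%:R.
  by rewrite exprMn exprVn sqr_sqrtr ?ler0n// mulrC.
pose f n x := cline (s + n.+1%:R) (t + n.+1%:R) ((rt n)^-1 * x).
have hf n : has_int leb (f n) ((rt n)%:C * cint (s + n.+1%:R) (t + n.+1%:R)).
  have pn : 1 < Re (s + n.+1%:R + (t + n.+1%:R)).
    by move: p1; rewrite !ReE; have := ler0n R n.+1; lra.
  by have := has_int_scale (ri0 n) (has_int_cline pn); rewrite invrK.
have p11 : 1 < Re (1 + 1) by rewrite !ReE; lra.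
pose C := expR (`|Im s - Im t| * (pi / 2)).
have [[iG _] _] := has_intZ C%:C (has_int_cline p11).
have x20 x : 0 < 1 + x ^+ 2 by rewrite ltr_pwDl// sqr_ge0.
have c11 x : cline 1 1 x = (expR (- ln (1 + x ^+ 2)))%:C.
  have := @cline_addn 0 0 1 x; rewrite !add0r mul1r => ->.
  by rewrite /cline qpow00 mul1r.
have mg : cmeas (fun x : R => (gauss_fun x)%:C).
  by apply: cmeas_real; exact: measurable_gauss_fun.
have [||v hv cv] := @has_int_dct _ _ _ leb f _ (fun x => (gauss_fun x)%:C) _ hf mg iG.
- move=> n x; rewrite /f cline_addn c11 rt2 -rmorphM ComplexField.Normc.normcM /=.
  rewrite -[Num.sqrt _]/(normc (_)%:C) normc_real ger0_norm ?expR_ge0//.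
  apply: ler_pM; rewrite ?normc_ge0 ?expR_ge0//.
    apply: (le_trans (normc_cline _ _ _)); rewrite -/C -[leRHS]mulr1 ler_pM2l ?expR_gt0//.
    rewrite -[leRHS](expR0 R) ler_expR oppr_le0 mulr_ge0//; first lra.
    by rewrite divr_ge0// ln_ge0// lerDl sqr_ge0.
  rewrite ler_expR lerN2.
  have := @ln1D_mono R (x ^+ 2) 1 n.+1%:R (sqr_ge0 _) ltr01.
  by rewrite ler1n divr1 mul1r => /(_ isT).
- move=> x; apply: (@ccvg_ext _ (fun n => cline s t ((rt n)^-1 * x) *
      (expR (- (n.+1%:R * ln (1 + x ^+ 2 / n.+1%:R))))%:C)).
    by move=> n; rewrite /f cline_addn rt2.
  rewrite -[(gauss_fun x)%:C]mul1r; apply: ccvgM; last first.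
    apply: ccvg_real; apply: continuous_cvg; first exact: continuous_expR.
    by apply: cvgN; apply: cvg_ln1D; exact: sqr_ge0.
  have c0 : x ^+ 2 / n.+1%:R @[n --> \oo] --> (0 : R).
    by rewrite -[X in _ --> X](mulr0 (x ^+ 2)); apply: cvgMr; exact: cvg_harmonic.
  apply: (@ccvg_ext _ (fun n => cexp (- (s + t) * (ln (1 + x ^+ 2 / n.+1%:R) / 2)%:C +
     (- 'i%C * (s - t)) * (atan ((rt n)^-1 * x))%:C))).
    by move=> n; rewrite clineE rt2.
  rewrite -[X in ccvg _ X](cexp0 R); apply: ccvg_cexp; rewrite -[X in ccvg _ X]addr0.
  apply: ccvgD.
    rewrite -(mulr0 (- (s + t))); apply: ccvgM; first exact: ccvg_cst.
    apply: ccvg_real; rewrite -[X in _ --> X](mul0r 2^-1); apply: cvgMl.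
    rewrite -(ln1 R); apply: continuous_cvg; first exact: continuous_ln.
    by rewrite -[X in _ --> X]addr0; apply: cvgD => //; exact: cvg_cst.
  rewrite -(mulr0 (- 'i%C * (s - t))); apply: ccvgM; first exact: ccvg_cst.
  apply: ccvg_real; rewrite -(@atan0 R); apply: continuous_cvg; first exact: continuous_atan.
  have c1 : Num.sqrt (x ^+ 2 / n.+1%:R) @[n --> \oo] --> (0 : R).
    by rewrite -sqrtr0; apply: continuous_cvg => //; exact: sqrt_continuous.
  have c1N : - Num.sqrt (x ^+ 2 / n.+1%:R) @[n --> \oo] --> (0 : R).
    by rewrite -oppr0; exact: cvgN.
  apply: (squeeze_cvgr _ c1N c1); apply: nearW => n.
  by rewrite -ler_norml -rt2 sqrtr_sqr.
- suff <- : v = (Num.sqrt pi)%:C by [].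
  apply: (has_int_unique hv); split.
    by split => /=; [exact: integrableT_gauss|exact: integrable0].
  rewrite /cintegral /Rintegral /= integralT_gauss.
  by under eq_integral do rewrite /=; rewrite integral0.
Qed.

(** Both sides of the formula obey the recursion of [cintSl] and [cintSr] and
    agree at [(1, 1)]; their ratio is invariant under [(s, t) := (s + 1, t + 1)],
    and tends to the same limit for all [(s, t)]. *)
Lemma cint_pos s t : 0 < Re s -> 0 < Re t -> 1 < Re (s + t) ->
  cint s t = pi%:C * rpow 2 (2 - s - t) * Gamma (s + t - 1) / (Gamma s * Gamma t).
Proof.
(* [H] is [pi * 2 ^ (2 - s - t)] if the formula holds; [g] is the quotient in Gauss's limit. *)
pose H (s t : R[i]) := cint s t * (Gamma s * Gamma t) / Gamma (s + t - 1).
have H1 (a b : R[i]) : 0 < Re a -> 0 < Re b -> 1 < Re (a + b) ->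
    H a b = 4 * H (a + 1) (b + 1).
  move=> a0 b0 ab.
  have ab0 : 0 < Re (a + b - 1) by move: ab; rewrite !ReE; lra.
  have ab1 : 1 < Re (a + 1 + b) by move: ab; rewrite !ReE; lra.
  rewrite /H !GammaS// (_ : a + 1 + (b + 1) - 1 = a + b - 1 + 1 + 1); last by ring.
  rewrite (@GammaS _ (a + b - 1 + 1)); last by rewrite ReD Re1 addr_gt0.
  rewrite GammaS//.
  have e1 := cintSl ab; have e2 := cintSr ab1.
  have G0 := Gamma_neq0 ab0.
  have n1 : a + b - 1 != 0 by exact: Re_neq0.
  have n2 : a + b != 0 by apply: Re_neq0; move: ab; rewrite !ReE; lra.
  have na : a != 0 by exact: Re_neq0.
  have nb : b != 0 by exact: Re_neq0.
  have -> : cint (a + 1) (b + 1) = (a + b) * (a + b - 1) * cint a b / (4 * a * b).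
    have two : 2 != 0 :> R[i] by rewrite pnatr_eq0.
    have : cint (a + 1) b = (a + b - 1) * cint a b / (2 * a).
      by rewrite -e1; field; rewrite na.
    move=> e3; rewrite e3 in e2.
    have -> : cint (a + 1) (b + 1) = (2 * b * cint (a + 1) (b + 1)) / (2 * b) by field; rewrite nb.
    by rewrite e2; field; rewrite na nb.
  by rewrite subrK; field; rewrite na nb n1 G0 n2.
have HS (a b : R[i]) n : 0 < Re a -> 0 < Re b -> 1 < Re (a + b) ->
    H a b = 4 ^+ n * H (a + n%:R) (b + n%:R).
  clearbody H; elim: n => [|n IH] a0 b0 ab; first by rewrite !addr0 mul1r.
  rewrite IH// H1; first by rewrite exprSr -mulrA -(natr1 n) !addrA.
  - by rewrite ReD Re_nat ltr_wpDr.
  - by rewrite ReD Re_nat ltr_wpDr.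
  - by move: ab; rewrite !ReE; have := ler0n R n; lra.
pose g n (z : R[i]) : R[i] := rpow n.+1%:R z * Gamma n.+1%:R / Gamma (z + n.+1%:R).
pose y n (a b : R[i]) := (Num.sqrt n.+1%:R)%:C * cint (a + n.+1%:R) (b + n.+1%:R).
pose c n : R[i] := 4 ^+ n.+1 * (Gamma n.+1%:R) ^+ 2 * n.+1%:R / Gamma (2 * n.+1)%:R / (Num.sqrt n.+1%:R)%:C.
have HE (a b : R[i]) n : 0 < Re a -> 0 < Re b -> 1 < Re (a + b) ->
    H a b * rpow 2 (a + b - 1) * (g n a * g n b) = c n * y n a b * g (2 * n).+1 (a + b - 1).
  move=> a0 b0 ab; rewrite (HS a b n.+1)// /H /g /y /c.
  have n0 : 0 < n.+1%:R :> R by rewrite ltr0n.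
  have -> : (2 * n).+2 = (2 * n.+1)%N by rewrite mulnS addnC addn2.
  have G1 : Gamma (a + n.+1%:R) != 0 by apply: Gamma_neq0; rewrite ReD Re_nat addr_gt0.
  have G2 : Gamma (b + n.+1%:R) != 0 by apply: Gamma_neq0; rewrite ReD Re_nat addr_gt0.
  have G3 : Gamma (2 * n.+1)%:R != 0 :> R[i] by apply: Gamma_neq0; rewrite Re_nat ltr0n.
  have e1 : a + n.+1%:R + (b + n.+1%:R) - 1 = a + b - 1 + (2 * n.+1)%:R.
    by rewrite mul2n -addnn natrD; ring.
  have G4 : Gamma (a + b - 1 + (2 * n.+1)%:R) != 0.
    by apply: Gamma_neq0; move: ab; rewrite !ReE; have := ler0n R (2 * n.+1); lra.
  rewrite e1 (_ : rpow (2 * n.+1)%:R (a + b - 1) =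
    rpow 2 (a + b - 1) * rpow n.+1%:R (a + b - 1)); last by rewrite natrM rpowM.
  have rs : (Num.sqrt n.+1%:R)%:C != 0 :> R[i].
    by rewrite eq_complex /= eqxx andbT sqrtr_eq0 -ltNge.
  have -> : rpow n.+1%:R (a + b - 1) = rpow n.+1%:R a * rpow n.+1%:R b / n.+1%:R.
    by rewrite !rpowD rpowN rpow1// rmorph_nat.
  have nn : n.+1%:R != 0 :> R[i] by rewrite pnatr_eq0.
  move: (cint _ _) (Gamma (a + _)) (Gamma (b + _)) (Gamma (a + b - 1 + _)) (Gamma (2 * n.+1)%:R) G1 G2 G3 G4.
  move=> F G1 G2 G4 G3 n1 n2 n3 n4.
  move: (4 ^+ n.+1) (Gamma n.+1%:R) (rpow n.+1%:R a) (rpow n.+1%:R b) (Num.sqrt _)%:C rs.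
  move=> x1 x2 x3 x4 x5 rs; move: (n.+1%:R : R[i]) nn => N nn.
  by field; rewrite n1 n2 n3 n4 rs nn.
have gl z : 0 < Re z -> ccvg (g ^~ z) 1 by exact: Gamma_gauss.
have g2l z : 0 < Re z -> ccvg (fun n => g (2 * n).+1 z) 1.
  move=> z0; have [h1 h2] := gl z z0.
  have dbl : (fun n => (2 * n).+1) n @[n --> \oo] --> \oo.
    by apply/cvgnyPge => A; near=> n; apply: (@leq_trans n);
      [near: n; exact: nbhs_infty_ge|rewrite mul2n -addnn -addnS leq_addr].
  by split; [exact: (cvg_comp _ _ dbl h1)|exact: (cvg_comp _ _ dbl h2)].
have yl (a b : R[i]) : 1 < Re (a + b) -> ccvg (fun n => y n a b) (Num.sqrt pi)%:C by exact: cint_laplace.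
move=> s0 t0 p1.
have o0 : 0 < Re 1 by exact: ltr01.
have p11 : 1 < Re (1 + 1) by rewrite !ReE; lra.
have pp : 0 < Re (s + t - 1) by move: p1; rewrite !ReE; lra.
have H11 : H 1 1 * rpow 2 (1 + 1 - 1) = 2 * pi%:C.
  by rewrite /H cint11 addrK Gamma1 !mulr1 invr1 mulr1 rpow1// rmorph_nat mulrC.
have l1 := ccvgM (ccvgM (ccvg_cst (H s t * rpow 2 (s + t - 1))) (ccvgM (gl _ s0) (gl _ t0)))
  (ccvgM (yl _ _ p11) (g2l _ o0)).
have l2 := ccvgM (ccvgM (ccvg_cst (2 * pi%:C)) (ccvgM (gl _ o0) (gl _ o0)))
  (ccvgM (yl _ _ p1) (g2l _ pp)).
have E : H s t * rpow 2 (s + t - 1) = 2 * pi%:C.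
  have sp : (Num.sqrt pi)%:C != 0 :> R[i].
    by rewrite eq_complex /= eqxx andbT sqrtr_eq0 -ltNge pi_gt0.
  apply: (mulIf sp); rewrite !mulr1 in l1 l2; apply: (ccvg_unique _ l2).
  apply: ccvg_ext l1 => n; have e1 := HE s t n s0 t0 p1; have e2 := HE 1 1 n o0 o0 p11.
  rewrite H11 addrK in e2; rewrite e1 e2.
  by move: (c n) (y n s t) (y n 1 1) (g _ _) (g _ _) => c1 c2 c3 c4 c5; ring.
have G1 := Gamma_neq0 s0; have G2 := Gamma_neq0 t0; have G3 := Gamma_neq0 pp.
have -> : cint s t = H s t * Gamma (s + t - 1) / (Gamma s * Gamma t).
  by rewrite /H; field; rewrite G1 G2 G3.
have -> : H s t = 2 * pi%:C / rpow 2 (s + t - 1) by rewrite -E; field; exact: rpow_neq0.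
rewrite -rpowN (_ : 2 - s - t = - (s + t - 1) + 1); last by ring.
by rewrite rpowD rpow1// rmorph_nat; ring.
Unshelve. all: by end_near.
Qed.

End cauchy_formula.

Section cauchy_formula_general.
Context (R : realType).
Local Notation leb := (@lebesgue_measure R).
Local Notation Re := (@complex.Re R).
Implicit Types (s t : R[i]).

(** The value of Cauchy's beta integral, with the Gamma functions in the denominator
    as factors [1 / Gamma] so that it is entire in [s] and [t] for fixed [s + t]. *)
Definition ccst s t : R[i] :=
  pi%:C * rpow 2 (2 - s - t) * Gamma (s + t - 1) * ((Gamma s)^-1 * (Gamma t)^-1).

Lemma ccstC s t : ccst s t = ccst t s.
Proof. by rewrite /ccst addrAC (addrC s) [(Gamma s)^-1 * _]mulrC. Qed.

Lemma ccst_shift s t : 1 < Re (s + t) -> 2 * s * ccst (s + 1) t = (s + t - 1) * ccst s t.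
Proof.
move=> p1; have p0 : 0 < Re (s + t - 1) by move: p1; rewrite !ReE; lra.
rewrite /ccst (_ : s + 1 + t - 1 = s + t - 1 + 1); last by ring.
rewrite GammaS// (_ : 2 - s - t = 2 - (s + 1) - t + 1); last by ring.
rewrite [rpow 2 (_ + 1)]rpowD rpow1// rmorph_nat (rGammaS s).
by move: (Gamma (s + t - 1)) (Gamma (s + 1))^-1 (Gamma t)^-1 => x y z; ring.
Qed.


(** The recursions of both sides reach every [(s, t)] with [Re (s + t) > 1] from the
    quadrant [Re s > 0], [Re t > 0]. *)
Lemma cint_general s t : 1 < Re (s + t) -> cint s t = ccst s t.
Proof.
have stepl (a b : R[i]) : 1 < Re (a + b) -> cint (a + 1) b = ccst (a + 1) b -> cint a b = ccst a b.
  move=> p1 E; have n0 : a + b - 1 != 0 by apply: Re_neq0; move: p1; rewrite !ReE; lra.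
  by apply: (mulfI n0); rewrite -cintSl// -ccst_shift// E.
have stepr (a b : R[i]) : 1 < Re (a + b) -> cint a (b + 1) = ccst a (b + 1) -> cint a b = ccst a b.
  move=> p1 E; have n0 : a + b - 1 != 0 by apply: Re_neq0; move: p1; rewrite !ReE; lra.
  apply: (mulfI n0); rewrite -cintSr// E ccstC [in RHS]ccstC (addrC a) -ccst_shift//.
  by rewrite addrC.
have left n (a b : R[i]) : 0 < Re (a + n%:R) -> 0 < Re b -> 1 < Re (a + b) -> cint a b = ccst a b.
  elim: n a => [|n IH] a.
    rewrite addr0 => a0 b0 p1; rewrite cint_pos// /ccst -invfM mulrA//.
  move=> a0 b0 p1; apply: stepl => //; apply: IH => //.
    by rewrite -addrA nat1r.
  by move: p1; rewrite !ReE; lra.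
have right m n (a b : R[i]) : 0 < Re (a + n%:R) -> 0 < Re (b + m%:R) -> 1 < Re (a + b) ->
    cint a b = ccst a b.
  elim: m b => [|m IH] b; first by rewrite addr0; exact: left.
  move=> a0 b0 p1; apply: stepr => //; apply: IH => //.
    by rewrite -addrA nat1r.
  by move: p1; rewrite !ReE; lra.
apply: (right (Num.truncn (1 - Re t)) (Num.truncn (1 - Re s))).
  by rewrite ReD Re_nat; have := truncnS_gt (1 - Re s); rewrite -natr1; lra.
by rewrite ReD Re_nat; have := truncnS_gt (1 - Re t); rewrite -natr1; lra.
Qed.

(** Integral of [q] to the power [- {s || t}] over a vertical line. *)
Lemma has_int_line (x y0 : R) s t : 0 < x -> 1 < Re (s + t) ->
  has_int leb (fun y => qpow (x +i* (y + y0)) s t) (ccst s t * rpow x (1 - s - t)).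
Proof.
move=> x0 p1; have xi0 : 0 < x^-1 by rewrite invr_gt0.
have := has_int_shift y0 (has_intZ (rpow x (- (s + t))) (has_int_scale xi0 (has_int_cline p1))).
rewrite invrK cint_general// -[x%:C]rpow1// mulrA -rpowD mulrC (_ : - (s + t) + 1 = 1 - s - t); last by ring.
apply: has_int_ext => y; rewrite /cline -qpowZ//; last by rewrite eq_complex /= oner_eq0.
congr qpow; apply: complex_ext; rewrite ?(ReE, ImE) /=; first by ring.
by rewrite mul0r addr0 mulrA divff ?gt_eqF// mul1r.
Qed.

End cauchy_formula_general.

Section gaussian_line.
Context (R : realType).
Local Notation leb := (@lebesgue_measure R).

Lemma has_int_gauss (a u : R) : 0 < a ->
  has_int leb (fun x => (expR (- (a * (x + u) ^+ 2)))%:C) (Num.sqrt (pi / a))%:C.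
Proof.
move=> a0; have sa : 0 < Num.sqrt a by rewrite sqrtr_gt0.
have H : has_int leb (fun x => (gauss_fun x)%:C) (Num.sqrt pi)%:C.
  split; first by split => /=; [exact: integrableT_gauss|exact: integrable0].
  rewrite /cintegral /Rintegral /= integralT_gauss.
  by under eq_integral do rewrite /=; rewrite integral0.
have := has_int_shift u (has_int_scale sa H).
rewrite -rmorphM mulrC -sqrtrV ?ltW// -sqrtrM ?pi_ge0//.
by apply: has_int_ext => x; rewrite /gauss_fun exprMn sqr_sqrtr// ltW.
Qed.

Lemma has_int_gauss2 (a u w : R) : 0 < a ->
  has_int (prodm leb leb) (fun z => (expR (- (a * ((z.1 + u) ^+ 2 + (z.2 + w) ^+ 2))))%:C) (pi / a)%:C.
Proof.
move=> a0; have pa : 0 <= pi / a by rewrite divr_ge0 ?pi_ge0 ?ltW.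
pose f (z : R * R) : R[i] := (expR (- (a * ((z.1 + u) ^+ 2 + (z.2 + w) ^+ 2))))%:C.
have mf : cmeas f.
  apply: cmeas_real.
  apply: (measurable_continuous_comp (k := fun z : R * R => - (a * ((z.1 + u) ^+ 2 + (z.2 + w) ^+ 2)))).
    exact: continuous_expR.
  apply: measurable_funN; apply: measurable_funM => //.
  by apply: measurable_funD; apply: measurable_funX; apply: measurable_funD.
have inner (x : R) : has_int leb (fun y => f (x, y))
    ((Num.sqrt (pi / a))%:C * (expR (- (a * (x + u) ^+ 2)))%:C).
  rewrite mulrC; apply: has_int_ext (has_intZ (expR (- (a * (x + u) ^+ 2)))%:C (has_int_gauss w a0)) => y.
  by rewrite /f -rmorphM -expRD /= mulrDr opprD.
have outer := has_intZ (Num.sqrt (pi / a))%:C (has_int_gauss u a0).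
have -> : (pi / a)%:C = (Num.sqrt (pi / a))%:C * (Num.sqrt (pi / a))%:C.
  by rewrite -rmorphM -expr2 sqr_sqrtr.
apply: (@has_int_fubini _ _ _ _ _ leb leb 1 f f _ _ _ _ mf mf _ _ inner inner outer outer).
- by move=> z; rewrite /f /= expR_ge0.
- by move=> z; rewrite /f mul1r normc_real ger0_norm ?expR_ge0.
Qed.

End gaussian_line.

(** * Positive definite matrices over the complex numbers *)

Local Open Scope sesquilinear_scope.

Section hermitian.
Context (R : realType).
Local Notation C := R[i].
Local Notation Re := (@complex.Re R).
Local Notation Im := (@complex.Im R).
Local Notation normc := (@ComplexField.Normc.normc R).

Lemma conjcE (z : C) : Num.conj z = conjc z. Proof. by []. Qed.

Lemma ReJ (z : C) : Re (Num.conj z) = Re z. Proof. by rewrite conjcE ReC. Qed.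

Lemma adjM m n p (A : 'M[C]_(m, n)) (B : 'M[C]_(n, p)) : (A *m B)^t* = B^t* *m A^t*.
Proof. by rewrite trmx_mul map_mxM. Qed.

Lemma adjK m n (A : 'M[C]_(m, n)) : A^t*^t* = A.
Proof. by apply/matrixP => i j; rewrite !mxE conjCK. Qed.

Lemma adjD m n (A B : 'M[C]_(m, n)) : (A + B)^t* = A^t* + B^t*.
Proof. by apply/matrixP => i j; rewrite !mxE rmorphD. Qed.

Lemma adjN m n (A : 'M[C]_(m, n)) : (- A)^t* = - A^t*.
Proof. by apply/matrixP => i j; rewrite !mxE rmorphN. Qed.

Lemma adj1 n : (1%:M : 'M[C]_n)^t* = 1%:M.
Proof. by rewrite trmx1 map_mx1. Qed.

Lemma adj_inv n (A : 'M[C]_n) : (invmx A)^t* = invmx (A^t*).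
Proof. by rewrite trmx_inv map_invmx. Qed.

Lemma det_adj n (A : 'M[C]_n) : \det (A^t*) = Num.conj (\det A).
Proof. by rewrite det_map_mx det_tr. Qed.

Definition qform n (A : 'M[C]_n) (v : 'cV[C]_n) : R := Re ((v^t* *m A *m v) 0 0).

Definition posd n (A : 'M[C]_n) := A^t* = A /\ forall v, v != 0 -> 0 < qform A v.

Lemma adj_mx11 (A : 'M[C]_1) : (A^t*) 0 0 = Num.conj (A 0 0).
Proof. by rewrite !mxE. Qed.

Lemma herm_form_real n (A : 'M[C]_n) (v : 'cV[C]_n) : A^t* = A -> Im ((v^t* *m A *m v) 0 0) = 0.
Proof.
move=> hA; set z := _ 0 0.
have : Num.conj z = z.
  by rewrite /z -adj_mx11 !adjM adjK hA mulmxA.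
rewrite conjcE => /(congr1 Im); rewrite ImC => /eqP.
by rewrite -subr_eq0 -opprD oppr_eq0 -mulr2n mulrn_eq0 => /eqP.
Qed.

Lemma herm_diag_real n (A : 'M[C]_n) k : A^t* = A -> Im (A k k) = 0.
Proof.
move=> /(congr1 (fun M : 'M[C]_n => Im (M k k))); rewrite !mxE conjcE ImC => /eqP.
by rewrite -subr_eq0 -opprD oppr_eq0 -mulr2n mulrn_eq0 => /eqP.
Qed.

Lemma posdefP n (A : 'M[C]_n) : posdefmx A <-> posd A.
Proof.
split=> -[hA pA].
  have hA' : A^t* = A.
    by move/is_hermitianmxP : hA; rewrite expr0 scale1r => <-.
  split=> // v /pA; rewrite ltcE => /andP[_]; exact.
split.
  by apply/is_hermitianmxP; rewrite expr0 scale1r hA.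
by move=> v v0; rewrite ltcE /= herm_form_real// eqxx/=; exact: pA.
Qed.

Lemma qform0 n (A : 'M[C]_n) : qform A 0 = 0.
Proof. by rewrite /qform mulmx0 mxE. Qed.

Lemma qformD n (A B : 'M[C]_n) v : qform (A + B) v = qform A v + qform B v.
Proof. by rewrite /qform mulmxDr mulmxDl mxE ReD. Qed.

Lemma qform_cong n m (A : 'M[C]_n) (P : 'M[C]_(n, m)) v :
  qform (P^t* *m A *m P) v = qform A (P *m v).
Proof. by rewrite /qform adjM !mulmxA. Qed.

Lemma qform_adj n (A : 'M[C]_n) v : qform (A^t*) v = qform A v.
Proof.
by rewrite /qform -ReJ -adj_mx11 !adjM !adjK mulmxA.
Qed.

Lemma posd_ge0 n (A : 'M[C]_n) v : posd A -> 0 <= qform A v.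
Proof.
by move=> [_ pA]; have [->|/pA/ltW//] := eqVneq v 0; rewrite qform0.
Qed.

Lemma posdD n (A B : 'M[C]_n) : posd A -> posd B -> posd (A + B).
Proof.
move=> [hA pA] [hB pB]; split; first by rewrite adjD hA hB.
by move=> v v0; rewrite qformD addr_gt0// ?pA ?pB.
Qed.

Lemma posd1 n : posd (1%:M : 'M[C]_n).
Proof.
split; first exact: adj1.
move=> v v0; rewrite /qform mulmx1 mxE Re_sum.
have [i vi0] : exists i, v i 0 != 0.
  apply/existsP; apply: contraNT v0; rewrite negb_exists => /forallP v0.
  by apply/eqP/matrixP => i j; rewrite ord1 mxE; apply/eqP; have := v0 i; rewrite negbK.
have sq j : Re (v^t* 0 j * v j 0) = normc (v j 0) ^+ 2.
  by rewrite !mxE conjcE mulrC mulcJ.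
rewrite (bigD1 i)//= sq ltr_pwDl//.
  by rewrite exprn_gt0// normc_gt0.
by apply: sumr_ge0 => j _; rewrite sq sqr_ge0.
Qed.

(** A matrix with positive definite real part has trivial kernel. *)
Lemma dissip_unit n (A : 'M[C]_n) : (forall v, v != 0 -> 0 < qform A v) -> A \in unitmx.
Proof.
move=> pA; rewrite -unitmx_tr unitmxE unitfE; apply/det0P => -[v v0 vA].
have : v^T != 0 by rewrite trmx_eq0.
move=> /pA; rewrite /qform -mulmxA -[A]trmxK -trmx_mul vA trmx0 mulmx0 mxE.
by rewrite ltxx.
Qed.

Lemma posd_unit n (A : 'M[C]_n) : posd A -> A \in unitmx.
Proof. by move=> [_ /dissip_unit]. Qed.

Lemma mulmx_unit_neq0 n (P : 'M[C]_n) (v : 'cV[C]_n) : P \in unitmx -> v != 0 -> P *m v != 0.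
Proof.
by move=> uP; apply: contra_neq => Pv0; rewrite -[v](mulKmx uP) Pv0 mulmx0.
Qed.

Lemma posd_cong n (A P : 'M[C]_n) : posd A -> P \in unitmx -> posd (P^t* *m A *m P).
Proof.
move=> [hA pA] uP; split; first by rewrite !adjM adjK hA mulmxA.
by move=> v v0; rewrite qform_cong pA// mulmx_unit_neq0.
Qed.

Lemma posd_inv n (A : 'M[C]_n) : posd A -> posd (invmx A).
Proof.
move=> pA; have uA := posd_unit pA; have [hA _] := pA.
have -> : invmx A = (invmx A)^t* *m A *m invmx A by rewrite adj_inv hA mulVmx// mul1mx.
by apply: posd_cong => //; rewrite unitmx_inv.
Qed.

Lemma adj_block p q r s (A1 : 'M[C]_(p, q)) (A2 : 'M[C]_(p, r)) (A3 : 'M[C]_(s, q))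
    (A4 : 'M[C]_(s, r)) :
  (block_mx A1 A2 A3 A4)^t* = block_mx (A1^t*) (A3^t*) (A2^t*) (A4^t*).
Proof. by rewrite tr_block_mx map_block_mx. Qed.

Lemma herm_block p q (A : 'M[C]_(p + q)) : A^t* = A ->
  A = block_mx (ulsubmx A) (ursubmx A) ((ursubmx A)^t*) (drsubmx A) /\ (drsubmx A)^t* = drsubmx A.
Proof.
rewrite -{1 2}[A]submxK adj_block => /eq_block_mx[_ E _ hD]; rewrite -E.
by rewrite adjK; split => //; rewrite -{1}[A]submxK; congr block_mx.
Qed.

Lemma det_schur p q (P : 'M[C]_p) (B : 'M[C]_(p, q)) (B' : 'M[C]_(q, p)) (D : 'M[C]_q) :
  P \in unitmx -> \det (block_mx P B B' D) = \det P * \det (D - B' *m invmx P *m B).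
Proof.
move=> uP.
have -> : block_mx P B B' D =
    block_mx 1%:M 0 (B' *m invmx P) 1%:M *m block_mx P B 0 (D - B' *m invmx P *m B).
  by rewrite mulmx_block !mul1mx !mul0mx !addr0 mulmxKV// [_ *m B + _]addrC subrK.
by rewrite det_mulmx det_lblock !det1 !mul1r det_ublock.
Qed.

(** Completing the square in the first block. *)
Lemma qform_block p q (P : 'M[C]_p) (B : 'M[C]_(p, q)) (D : 'M[C]_q) u v : posd P ->
  qform (block_mx P B (B^t*) D) (col_mx u v) =
  qform P (u + invmx P *m B *m v) + qform (D - B^t* *m invmx P *m B) v.
Proof.
move=> pP; have uP := posd_unit pP; have [hP _] := pP.
pose L : 'M[C]_(p + q) := block_mx 1%:M (invmx P *m B) 0 1%:M.
pose M := block_mx P 0 0 (D - B^t* *m invmx P *m B).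
have -> : block_mx P B (B^t*) D = L^t* *m M *m L.
  rewrite /L /M adj_block !mulmx_block adjM adj_inv hP !adj1.
  rewrite trmx0 map_mx0 !mul1mx !mulmx1 !mul0mx !mulmx0 !addr0 !add0r.
  rewrite mulmxA mulmxV// mul1mx mulmxKV//.
  congr block_mx.
  by rewrite mulmxA addrC subrK.
rewrite qform_cong /L mul_block_col !mul1mx mul0mx add0r.
rewrite /qform /M tr_col_mx map_row_mx mul_row_block !mulmx0 addr0 add0r mul_row_col.
by rewrite mxE ReD.
Qed.

Lemma posd_block p q (P : 'M[C]_p) (B : 'M[C]_(p, q)) (D : 'M[C]_q) : posd P -> D^t* = D ->
  posd (block_mx P B (B^t*) D) <-> posd (D - B^t* *m invmx P *m B).
Proof.
move=> pP hD; have uP := posd_unit pP; have [hP _] := pP.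
have hS : (D - B^t* *m invmx P *m B)^t* = D - B^t* *m invmx P *m B.
  by rewrite adjD adjN !adjM adjK adj_inv hP hD mulmxA.
split=> [[_ pA]|[_ pS]]; split => //.
- move=> v v0; have := pA (col_mx (- (invmx P *m B *m v)) v).
  rewrite qform_block// addNr qform0 add0r; apply.
  by apply: contra_neq v0 => /eqP; rewrite col_mx_eq0 => /andP[_ /eqP].
- by rewrite tr_block_mx map_block_mx hP hD adjK.
- move=> w; rewrite -[w]vsubmxK; set u := usubmx w; set v := dsubmx w => w0.
  rewrite qform_block//; have [v0|v0] := eqVneq v 0.
    have u0 : u != 0.
      by apply: contra_neq w0 => u0; rewrite v0 u0; apply/eqP; rewrite col_mx_eq0 !eqxx.
    by rewrite v0 mulmx0 addr0 qform0 addr0; case: pP => _; apply.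
  by rewrite ltr_wpDl ?pS// posd_ge0.
Qed.

Lemma posd_ulsub p q (P : 'M[C]_p) (B : 'M[C]_(p, q)) B' (D : 'M[C]_q) :
  posd (block_mx P B B' D) -> posd P.
Proof.
move=> [hA pA]; split.
  by move: hA; rewrite tr_block_mx map_block_mx => /eq_block_mx[].
move=> u u0; have := pA (col_mx u 0); rewrite /qform tr_col_mx map_row_mx mul_row_block.
rewrite mul_row_col mulmx0 addr0 trmx0 map_mx0 mul0mx addr0; apply.
by apply: contra_neq u0 => /eqP; rewrite col_mx_eq0 => /andP[/eqP].
Qed.

End hermitian.

(** * Measure-preserving maps *)

Section measure_preserving.
Context (R : realType).

Definition mpres d d' (X : measurableType d) (Y : measurableType d')
    (mu : {measure set X -> \bar R}) (nu : {measure set Y -> \bar R}) (phi : X -> Y) :=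
  measurable_fun [set: X] phi /\ forall A, measurable A -> nu A = mu (phi @^-1` A).

Lemma mpres_comp d d' d'' (X : measurableType d) (Y : measurableType d')
    (Z : measurableType d'') (mu : {measure set X -> \bar R})
    (nu : {measure set Y -> \bar R}) (xi : {measure set Z -> \bar R}) phi psi :
  mpres mu nu phi -> mpres nu xi psi -> mpres mu xi (psi \o phi).
Proof.
move=> [mphi nuE] [mpsi xiE]; split; first exact: measurableT_comp.
move=> A mA; rewrite xiE// nuE// -[X in measurable X]setTI; exact: mpsi.
Qed.

Lemma mpres_prod d1 d2 d1' d2' (X1 : measurableType d1) (X2 : measurableType d2)
    (Y1 : measurableType d1') (Y2 : measurableType d2')
    (m1 : {sigma_finite_measure set X1 -> \bar R})
    (m2 : {sigma_finite_measure set X2 -> \bar R})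
    (n1 : {sigma_finite_measure set Y1 -> \bar R})
    (n2 : {sigma_finite_measure set Y2 -> \bar R}) f g :
  mpres m1 n1 f -> mpres m2 n2 g ->
  mpres (prodm m1 m2) (prodm n1 n2) (fun z => (f z.1, g z.2)).
Proof.
move=> [mf n1E] [mg n2E].
have mfg : measurable_fun [set: X1 * X2] (fun z => (f z.1, g z.2)).
  apply/measurable_fun_pairP; split => /=.
    exact: (measurableT_comp mf measurable_fst).
  exact: (measurableT_comp mg measurable_snd).
split => // A mA.
apply: (@product_measure_unique _ _ _ _ _ n1 n2
  (pushforward (prodm m1 m2) (fun z => (f z.1, g z.2)))) => // B C mB mC.
rewrite /= /pushforward (_ : _ @^-1` _ = (f @^-1` B) `*` (g @^-1` C)); last first.
  by apply/seteqP; split=> -[x y].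
rewrite /prodm product_measure1E ?n1E ?n2E//; rewrite -[X in measurable X]setTI.
  exact: mf.
exact: mg.
Qed.

Lemma mpres_swap d1 d2 (X1 : measurableType d1) (X2 : measurableType d2)
    (m1 : {sigma_finite_measure set X1 -> \bar R})
    (m2 : {sigma_finite_measure set X2 -> \bar R}) :
  mpres (prodm m1 m2) (prodm m2 m1) (fun z => (z.2, z.1)).
Proof.
split=> [|A mA]; last exact: prodm_swap.
by apply/measurable_fun_pairP; split; [exact: measurable_snd|exact: measurable_fst].
Qed.

Section interchange.
Context d1 d2 d3 d4 (X1 : measurableType d1) (X2 : measurableType d2)
  (X3 : measurableType d3) (X4 : measurableType d4)
  (m1 : {sigma_finite_measure set X1 -> \bar R})
  (m2 : {sigma_finite_measure set X2 -> \bar R})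
  (m3 : {sigma_finite_measure set X3 -> \bar R})
  (m4 : {sigma_finite_measure set X4 -> \bar R}).

(** On rectangles, whose sides are not rectangles themselves, the two measures are
    compared by Tonelli's theorem. *)
Lemma mpres_interchange :
  mpres (prodm (prodm m1 m2) (prodm m3 m4)) (prodm (prodm m1 m3) (prodm m2 m4))
    (fun z => ((z.1.1, z.2.1), (z.1.2, z.2.2))).
Proof.
pose phi (z : (X1 * X2) * (X3 * X4)) := ((z.1.1, z.2.1), (z.1.2, z.2.2)).
have mphi : measurable_fun setT phi.
  have ffst : measurable_fun setT (@fst (X1 * X2) (X3 * X4)) by exact: measurable_fst.
  have fsnd : measurable_fun setT (@snd (X1 * X2) (X3 * X4)) by exact: measurable_snd.
  apply/measurable_fun_pairP; split; apply/measurable_fun_pairP; split => /=.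
  - exact: (measurableT_comp measurable_fst ffst).
  - exact: (measurableT_comp measurable_fst fsnd).
  - exact: (measurableT_comp measurable_snd ffst).
  - exact: (measurableT_comp measurable_snd fsnd).
split => // E mE.
apply: (@product_measure_unique _ _ _ _ _ (prodm m1 m3) (prodm m2 m4)
  (pushforward (prodm (prodm m1 m2) (prodm m3 m4)) phi)) => // A B mA mB.
have mA' := measurable_fun_xsection m3 mA.
have mB' := measurable_fun_xsection m4 mB.
rewrite /= /pushforward {1}/prodm /product_measure1.
transitivity (\int[prodm m1 m2]_z (m3 (xsection A z.1) * m4 (xsection B z.2)))%E.
  apply: eq_integral => -[a b] _; rewrite /=.
  rewrite (_ : xsection _ (a, b) = xsection A a `*` xsection B b).
    by rewrite /prodm product_measure1E//; exact: measurable_xsection.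
  by apply/seteqP; split=> -[c d]; rewrite /xsection /= !in_setE.
have mf : measurable_fun setT (fun z : X1 * X2 => m3 (xsection A z.1) * m4 (xsection B z.2))%E.
  apply: emeasurable_funM.
    exact: (measurableT_comp mA' measurable_fst).
  exact: (measurableT_comp mB' measurable_snd).
transitivity (\int[m1]_x \int[m2]_y (m3 (xsection A x) * m4 (xsection B y)))%E.
  rewrite -[LHS]/(\int[(m1 \x m2)%E]_z (m3 (xsection A z.1) * m4 (xsection B z.2)))%E.
  by rewrite (fubini_tonelli1 _ mf)// => z; rewrite mule_ge0.
under eq_integral do rewrite ge0_integralZl//.
rewrite ge0_integralZr//.
by apply: integral_ge0 => x _.
Qed.

End interchange.

Lemma mpres_tcons m : mpres (prodm (lebesgue_tuple R m) (@lebesgue_measure R))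
  (lebesgue_tuple R m.+1) (fun z => tcons (z.2, z.1)).
Proof.
have H : mpres (prodm (@lebesgue_measure R) (lebesgue_tuple R m)) (lebesgue_tuple R m.+1) (@tcons R m).
  split=> [|A mA]; [exact: measurable_tcons|by []].
exact: mpres_comp (mpres_swap _ _) H.
Qed.

End measure_preserving.

(** * Gaussian integrals and powers of quadratic forms *)

Section matrix_measurability.
Context d (X : measurableType d) (R : realType).
Local Notation C := R[i].

Definition mxmeas m n (F : X -> 'M[C]_(m, n)) := forall i j, cmeas (fun x => F x i j).

Lemma mxmeas_cst m n (A : 'M[C]_(m, n)) : mxmeas (fun=> A).
Proof. by move=> i j; exact: cmeas_cst. Qed.

Lemma mxmeasD m n (F G : X -> 'M[C]_(m, n)) : mxmeas F -> mxmeas G -> mxmeas (fun x => F x + G x).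
Proof. by move=> mF mG i j; under eq_fun do rewrite mxE; exact: cmeasD. Qed.

Lemma mxmeasN m n (F : X -> 'M[C]_(m, n)) : mxmeas F -> mxmeas (fun x => - F x).
Proof. by move=> mF i j; under eq_fun do rewrite mxE; exact: cmeasN. Qed.

Lemma mxmeas_mul m n p (F : X -> 'M[C]_(m, n)) (G : X -> 'M[C]_(n, p)) :
  mxmeas F -> mxmeas G -> mxmeas (fun x => F x *m G x).
Proof.
move=> mF mG i j; under eq_fun do rewrite mxE.
by apply: cmeas_sum => k _; exact: cmeasM.
Qed.

Lemma mxmeas_adj m n (F : X -> 'M[C]_(m, n)) : mxmeas F -> mxmeas (fun x => (F x)^t*).
Proof. by move=> mF i j; under eq_fun do rewrite !mxE conjcE; exact: cmeasJ. Qed.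

Lemma cmeas_det n (F : X -> 'M[C]_n) : mxmeas F -> cmeas (fun x => \det (F x)).
Proof.
move=> mF; apply: cmeas_sum => s _; apply: cmeasM; first exact: cmeas_cst.
by apply: cmeas_prod => i _.
Qed.

Lemma measurable_qform n (A : 'M[C]_n) (F : X -> 'cV[C]_n) :
  mxmeas F -> measurable_fun [set: X] (fun x => qform A (F x)).
Proof.
move=> mF; suff [] : cmeas (fun x => ((F x)^t* *m A *m F x) 0 0) by [].
apply: mxmeas_mul => //; apply: mxmeas_mul; last exact: mxmeas_cst.
exact: mxmeas_adj.
Qed.

End matrix_measurability.

Section complex_vectors.
Context (R : realType).
Local Notation C := R[i].
Local Notation leb := (@lebesgue_measure R).
Local Notation normc := (@ComplexField.Normc.normc R).
Local Notation Re := (@complex.Re R).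
Local Notation Im := (@complex.Im R).

Local Notation vlebesgue m := (prodm (lebesgue_tuple R m) (lebesgue_tuple R m)).

Definition vec m (z : m.-tuple R * m.-tuple R) : 'cV[C]_m :=
  \col_k (tnth z.1 k +i* tnth z.2 k).

Lemma mxmeas_vec m : mxmeas (@vec m).
Proof.
move=> i j; under eq_fun do rewrite mxE; split => /=.
  exact: (measurableT_comp (measurable_tnth i) measurable_fst).
exact: (measurableT_comp (measurable_tnth i) measurable_snd).
Qed.

Definition vcons m (z : (m.-tuple R * m.-tuple R) * (R * R)) :=
  (tcons (z.2.1, z.1.1), tcons (z.2.2, z.1.2)).

Lemma mpres_vcons m : mpres (prodm (vlebesgue m) (prodm leb leb)) (vlebesgue m.+1) (@vcons m).
Proof.
exact: mpres_comp (mpres_interchange _ _ _ _) (mpres_prod (mpres_tcons R m) (mpres_tcons R m)).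
Qed.

Lemma vec_vcons m (z : (m.-tuple R * m.-tuple R) * (R * R)) :
  vec (vcons z) = col_mx ((z.2.1 +i* z.2.2)%:M : 'M[C]_1) (vec z.1) :> 'cV[C]_(1 + m).
Proof.
apply/matrixP => k j; rewrite ord1 mxE; case: (split_ordP k) => l ->.
  by rewrite col_mxEu !mxE ord1 eqxx mulr1n !(tnth_nth 0).
by rewrite col_mxEd !mxE !(tnth_nth 0).
Qed.

Lemma has_int_total d (X : measurableType d) (mu : {measure set X -> \bar R}) (c : C) :
  (mu setT = 1)%E -> has_int mu (fun=> c) c.
Proof.
move=> mu1; have H (a : R) : mu.-integrable setT (fun=> a%:E).
  by apply/integrableP; split; [exact: measurable_cst|rewrite integral_cst//= mu1 mule1 ltry].
split; first by split.
rewrite /cintegral /Rintegral !integral_cst//= mu1 !mule1 /=.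
by case: c.
Qed.

Lemma vlebesgue0 : ((vlebesgue 0) setT = 1)%E.
Proof.
rewrite -setXTT /prodm product_measure1E//=.
by rewrite /= !diracE !in_setT mule1.
Qed.

(** Completing the square in the first coordinate splits off a Gaussian in one
    complex variable and leaves the form given by the Schur complement. *)
Lemma has_int_gaussian m (A : 'M[C]_m) (w : 'cV[C]_m) : posd A ->
  has_int (vlebesgue m) (fun z => (expR (- qform A (vec z + w)))%:C)
    ((pi ^+ m)%:C / \det A).
Proof.
elim: m A w => [|m IH] A w pA.
  rewrite det_mx00 expr0 divr1.
  apply: has_int_ext (has_int_total _ vlebesgue0) => z.
  by rewrite (flatmx0 (_ + w)) qform0 oppr0 expR0.
have mf k (B : 'M[C]_k) (u : 'cV[C]_k) :
    cmeas (fun z => (expR (- qform B (vec z + u)))%:C).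
  apply: cmeas_real; apply: (measurable_continuous_comp (h := @expR R)); first exact: continuous_expR.
  apply: measurable_funN; apply: measurable_qform; apply: mxmeasD; [exact: mxmeas_vec|exact: mxmeas_cst].
have [mv mvE] := mpres_vcons m.
apply/(has_int_preserving _ mv mvE (mf _ A w)).
pose A' : 'M[C]_(1 + m) := A; pose w' : 'cV[C]_(1 + m) := w.
pose P := ulsubmx A'; pose B := ursubmx A'; pose D := drsubmx A'.
have [hA _] := pA; have [AE hD] := @herm_block R 1 m A' hA; rewrite -/P -/B -/D in AE hD.
have pA' : posd (block_mx P B (B^t*) D) by rewrite -AE.
have pP : posd P := posd_ulsub pA'.
pose S := D - B^t* *m invmx P *m B.
have pS : posd S := (posd_block _ pP hD).1 pA'.
have dP : \det P = (P 0 0) by rewrite det_mx11.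
pose p := Re (P 0 0).
have PE : P 0 0 = p%:C by apply: complex_ext => //=; case: pP => /herm_diag_real.
have qP (u : 'cV[C]_1) : qform P u = p * (Re (u 0 0) ^+ 2 + Im (u 0 0) ^+ 2).
  rewrite /qform (mx11_scalar P) PE mul_mx_scalar -scalemxAl mxE mxE big_ord1.
  by rewrite !mxE conjcE !ReM /= !ReC !ImC; ring.
have p0 : 0 < p.
  case: pP => _ /(_ (const_mx 1)); rewrite qP !mxE /= expr0n /= expr1n addr0 mulr1; apply.
  by apply/eqP => /matrixP/(_ 0 0); rewrite !mxE; apply/eqP; rewrite oner_eq0.
have fE z : qform A (vec (vcons z) + w) =
   p * ((z.2.1 + Re ((usubmx w' + invmx P *m B *m (vec z.1 + dsubmx w')) 0 0)) ^+ 2 +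
        (z.2.2 + Im ((usubmx w' + invmx P *m B *m (vec z.1 + dsubmx w')) 0 0)) ^+ 2) +
   qform S (vec z.1 + dsubmx w').
  have -> : vec (vcons z) + w =
      col_mx ((z.2.1 +i* z.2.2)%:M + usubmx w') (vec z.1 + dsubmx w') :> 'cV[C]_(1 + m).
    by rewrite -add_col_mx vsubmxK vec_vcons.
  transitivity (qform (block_mx P B (B^t*) D)
      (col_mx ((z.2.1 +i* z.2.2)%:M + usubmx w') (vec z.1 + dsubmx w'))).
    by rewrite -AE.
  rewrite qform_block// qP.
  rewrite -addrA [in X in Re X]mxE [in X in Im X]mxE ReD ImD.
  by rewrite !mxE eqxx mulr1n.
pose f := (fun z => (expR (- qform A (vec z + w)))%:C) \o @vcons m.
have inner z : has_int (prodm leb leb) (fun u => f (z, u))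
    ((pi / p)%:C * (expR (- qform S (vec z + dsubmx w')))%:C).
  set c := (usubmx w' + invmx P *m B *m (vec z + dsubmx w')) 0 0.
  rewrite mulrC; apply: has_int_ext (has_intZ (expR (- qform S (vec z + dsubmx w')))%:C
    (has_int_gauss2 (Re c) (Im c) p0)) => u.
  by rewrite /f /= fE /= -rmorphM -expRD /= -/c opprD addrC.
have outer := has_intZ (pi / p)%:C (IH S (dsubmx w') pS).
have -> : (pi ^+ m.+1)%:C / \det A = (pi / p)%:C * ((pi ^+ m)%:C / \det S).
  have -> : \det A = p%:C * \det S.
    by rewrite -PE -dP -det_schur ?posd_unit// -AE.
  by rewrite exprS !rmorphM/= fmorphV/= invfM mulrACA.
apply: (@has_int_fubini _ _ _ _ _ (vlebesgue m) (prodm leb leb) 1 f f _ _ _ _ _ _ _ _ inner inner outer outer).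
- by apply: cmeas_comp => //; exact: mf.
- by apply: cmeas_comp => //; exact: mf.
- by move=> z; rewrite /f /= expR_ge0.
- by move=> z; rewrite /f /comp mul1r normc_real /= ger0_norm ?expR_ge0.
Qed.

(** Euler's integral [Gamma p * c ^ (- p)] as an integral of exponentials [exp (- c t)]
    reduces the power to Gaussians; the exponent [p - m] comes from
    [det (t A) = t ^ m * det A]. *)
Lemma has_int_quadratic m (A : 'M[C]_m) (w : 'cV[C]_m) p (c : R) : posd A ->
  m%:R < Re p -> 0 < c ->
  has_int (vlebesgue m) (fun z => rpow (c + qform A (vec z + w)) (- p))
    ((pi ^+ m)%:C / \det A * (Gamma (p - m%:R) / Gamma p * rpow c (m%:R - p))).
Proof.
move=> pA mp c0.
have p0 : 0 < Re p by exact: le_lt_trans mp.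
pose f q (z : measurableTypeR R * (m.-tuple R * m.-tuple R)) : C :=
  if 0 < z.1 then rpow z.1 (q - 1) * (expR (- ((c + qform A (vec z.2 + w)) * z.1)))%:C else 0.
have mf q : cmeas (f q).
  have f1 : measurable_fun setT (fst : measurableTypeR R * (m.-tuple R * m.-tuple R) -> _) by exact: measurable_fst.
  apply: cmeas_if.
  - exact: measurable_gt0.
  - apply: cmeasM; first exact: cmeas_rpow.
    apply: cmeas_real; apply: (measurable_continuous_comp (h := @expR R)); first exact: continuous_expR.
    apply: measurable_funN; apply: measurable_funM => //; apply: measurable_funD => //.
    apply: measurable_qform; apply: mxmeasD; last exact: mxmeas_cst.
    by move=> i j; exact: (cmeas_comp (measurable_snd) (@mxmeas_vec m i j)).
  - exact: cmeas_cst.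
have inner q t : has_int (vlebesgue m) (fun z => f q (t, z))
   ((pi ^+ m)%:C / \det A *
    (if 0 < t then rpow t (q - m%:R - 1) * (expR (- (c * t)))%:C else 0)).
  rewrite /f /=; case: ltP => t0; last first.
    by rewrite mulr0; exact: has_int0.
  have qt v : qform (t%:C *: A) v = t * qform A v.
    by rewrite /qform -scalemxAr -scalemxAl mxE ReM /= mul0r subr0.
  have ptA : posd (t%:C *: A).
    case: pA => hA pA; split=> [|v v0]; last by rewrite qt mulr_gt0// pA.
    by apply/matrixP => i j; rewrite -[in RHS]hA !mxE rmorphM/= conjcE conjc_real.
  have := has_intZ (rpow t (q - 1) * (expR (- (c * t)))%:C) (has_int_gaussian w ptA).
  have -> : (pi ^+ m)%:C / \det A * (rpow t (q - m%:R - 1) * (expR (- (c * t)))%:C) =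
      rpow t (q - 1) * (expR (- (c * t)))%:C * ((pi ^+ m)%:C / \det (t%:C *: A)).
    rewrite detZ (_ : q - m%:R - 1 = (q - 1) - m%:R); last by rewrite addrAC.
    rewrite [rpow t (q - 1 - _)]rpowD rpowN rpow_nat// !rmorphXn/=.
    move: (rpow t (q - 1)) (expR _)%:C (pi%:C ^+ m) (\det A) => x y z D.
    have : t%:C ^+ m != 0 by rewrite expf_neq0// eq_complex /= eqxx andbT gt_eqF.
    move: (t%:C ^+ m) => T T0; rewrite [(T * D)^-1]invfM; move: T^-1 D^-1 => a b; ring.
  apply: has_int_ext => z.
  by rewrite -mulrA -rmorphM -expRD /= qt -opprD mulrDl [qform A _ * _]mulrC.
have outer q (q0 : 0 < Re (q - m%:R)) :=
  has_intZ ((pi ^+ m)%:C / \det A) (@has_int_gam_scale R (q - m%:R) c q0 c0).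
have pm0 : 0 < Re (p - m%:R) by rewrite !ReE subr_gt0.
have pm0' : 0 < Re ((Re p)%:C - m%:R) by rewrite !ReE subr_gt0.
have joint : has_int (prodm leb (vlebesgue m)) (f p)
    ((pi ^+ m)%:C / \det A * (Gamma (p - m%:R) * rpow c (- (p - m%:R)))).
  apply: (@has_int_fubini _ _ _ _ _ leb (vlebesgue m) 1 (f p) (f (Re p)%:C) _ _ _ _
    (mf _) (mf _) _ _ (inner _) (inner _) (outer _ pm0) (outer _ pm0')).
  - move=> z; rewrite /f; case: ifP => // _.
    rewrite (_ : (Re p)%:C - 1 = (Re p - 1)%:C); last by rewrite raddfB.
    by rewrite rpow_realE -rmorphM /= mulr_ge0 ?expR_ge0.
  - move=> z; rewrite /f mul1r normc_if; case: ifP => [_|_]; last by rewrite normc_real normr0.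
    rewrite (_ : (Re p)%:C - 1 = (Re p - 1)%:C); last by rewrite raddfB.
    rewrite rpow_realE -rmorphM /=.
    by rewrite ComplexField.Normc.normcM normc_rpowE normc_real (ger0_norm (expR_ge0 _)) !ReE.
have Gp0 : Gamma p != 0 by exact: Gamma_neq0.
have fst_int (z : m.-tuple R * m.-tuple R) :
    has_int leb (fun t => f p (t, z)) (Gamma p * rpow (c + qform A (vec z + w)) (- p)).
  have cq : 0 < c + qform A (vec z + w) by rewrite ltr_pwDl// posd_ge0.
  exact: (has_int_gam_scale p0 cq).
have := has_intZ (Gamma p)^-1 (has_int_fubini_fst (has_int_swap joint) fst_int).
rewrite opprB.
have -> : (Gamma p)^-1 * ((pi ^+ m)%:C / \det A * (Gamma (p - m%:R) * rpow c (m%:R - p))) =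
  (pi ^+ m)%:C / \det A * (Gamma (p - m%:R) / Gamma p * rpow c (m%:R - p)).
  by move: (Gamma p)^-1 (Gamma _) => a b; ring.
by apply: has_int_ext => z; rewrite mulKf.
Qed.

End complex_vectors.

(** * Schur complement of a bordered dissipative matrix *)

Section form_identities.
Context (R : realType) (n : nat).
Local Notation C := R[i].
Local Notation Re := (@complex.Re R).

Lemma Re_add11 (A B : 'M[C]_1) : Re ((A + B) 0 0) = Re (A 0 0) + Re (B 0 0).
Proof. by rewrite mxE ReD. Qed.

Lemma Re_sub11 (A B : 'M[C]_1) : Re ((A - B) 0 0) = Re (A 0 0) - Re (B 0 0).
Proof. by rewrite Re_add11 mxE ReN. Qed.

Lemma qform_sub (H : 'M[C]_n) (y h t : 'cV[C]_n) : H^t* = H -> H *m h = t ->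
  qform H (y - h) = qform H y - 2 * Re ((t^t* *m y) 0 0) + Re ((t^t* *m h) 0 0).
Proof.
move=> hH Hh; have hHt : h^t* *m H = t^t* by rewrite -{1}hH -adjM Hh.
have yt : Re ((y^t* *m t) 0 0) = Re ((t^t* *m y) 0 0).
  by rewrite -ReJ -adj_mx11 adjM adjK.
rewrite /qform adjD adjN mulmxDl mulNmx hHt mulmxBr !mulmxBl.
rewrite -[y^t* *m H *m h]mulmxA Hh !Re_sub11 yt.
move: (Re _) (Re _) (Re _) => a b c; ring.
Qed.

Lemma Re_form_sub (Q : 'M[C]_n) (y t : 'cV[C]_n) :
  Re (((t + t - Q *m y)^t* *m y) 0 0) = 2 * Re ((t^t* *m y) 0 0) - qform Q y.
Proof.
rewrite adjD adjN adjD adjM mulmxDl mulmxDl mulNmx Re_sub11 Re_add11 -qform_adj.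
by rewrite /qform mulr_natl mulr2n.
Qed.

End form_identities.

Section bordered.
Context (R : realType) (n : nat).
Local Notation C := R[i].
Local Notation normc := (@ComplexField.Normc.normc R).
Local Notation Re := (@complex.Re R).
Local Notation Im := (@complex.Im R).
Variables (T S : 'M[C]_n).
Hypotheses (pT : posd T) (hS : S^t* = - S).

Let H := 1%:M + T.
Let Q := H + S.

Let pH : posd H. Proof. exact: posdD (posd1 _ _) pT. Qed.
Let uH : H \in unitmx. Proof. exact: posd_unit. Qed.

Lemma qform_skew v : qform S v = 0.
Proof.
have : qform S v = - qform S v.
  by rewrite -{1}qform_adj hS /qform mulmxN mulNmx mxE ReN.
by move=> /eqP; rewrite -addr_eq0 -mulr2n mulrn_eq0 => /eqP.
Qed.

Let qQ v : qform Q v = qform H v.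
Proof. by rewrite /Q qformD qform_skew addr0. Qed.

Lemma skew_shift_unit : Q \in unitmx.
Proof. by apply: dissip_unit => v v0; rewrite qQ; case: pH => _; apply. Qed.

Let uQ := skew_shift_unit.

(** The Hermitian part of [invmx Q]. *)
Definition hinv := (invmx Q)^t* *m H *m invmx Q.

Lemma posd_hinv : posd hinv.
Proof. by apply: posd_cong => //; rewrite unitmx_inv. Qed.

Lemma det_hinv : \det hinv = \det H / (\det Q * (\det Q)^*).
Proof.
by rewrite !det_mulmx det_adj !det_inv rmorphV ?unitfE -?unitfE -?unitmxE// conjcE invfM; ring.
Qed.

(** Difference of the resolvents at [0] and [1]. *)
Definition resd := invmx T - invmx H.

Let resdM : resd = invmx T *m invmx H.
Proof.
have uT := posd_unit pT.
have E1 : invmx T = invmx T *m H *m invmx H by rewrite mulmxK.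
have E2 : invmx H = invmx T *m T *m invmx H by rewrite mulVmx// mul1mx.
by rewrite /resd {1}E1 {2}E2 -mulmxBl -mulmxBr addrK mulmx1.
Qed.

Let resdE : resd = (invmx H)^t* *m (invmx T + 1%:M) *m invmx H.
Proof.
have [hH _] := pH; have uT := posd_unit pT.
have -> : invmx T + 1%:M = H *m invmx T by rewrite mulmxDl mul1mx mulmxV.
have E : invmx H *m (H *m invmx T) = invmx T := mulKmx uH _.
by rewrite adj_inv hH E resdM.
Qed.

Lemma posd_resd : posd resd.
Proof.
rewrite resdE; apply: posd_cong; last by rewrite unitmx_inv.
exact: posdD (posd_inv pT) (posd1 _ _).
Qed.

Lemma det_resd : \det resd = (\det T * \det H)^-1.
Proof.
by rewrite resdM det_mulmx !det_inv invfM.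
Qed.

Definition bshift (t : 'cV[C]_n) := S *m invmx H *m t.

(** The Schur complement of [Q] in the matrix [1 + T + S] bordered by the
    last columns [t] of the Hermitian and [v] of the skew part. *)
Definition bschur (t v : 'cV[C]_n) (tn sn : R) : C :=
  (1 + tn +i* sn) - ((t - v)^t* *m invmx Q *m (t + v)) 0 0.

(** With [y = Q^-1 (t + v)], one has [t - v = 2 t - Q y], so that the real part of the
    subtracted form is [2 Re (t, y) - H [y]]; completing the square about [H^-1 t]
    gives the term in [v]. *)
Lemma Re_bschur t v tn sn : Re (bschur t v tn sn) =
  1 + (tn - qform (invmx T) t) + qform resd t + qform hinv (v - bshift t).
Proof.
have [hH _] := pH.
pose y := invmx Q *m (t + v).
have Qy : Q *m y = t + v by rewrite mulKVmx.
have vw : invmx Q *m (v - bshift t) = y - invmx H *m t.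
  have -> : v - bshift t = (t + v) - Q *m (invmx H *m t).
    by rewrite /Q mulmxDl mulKVmx// /bshift -!mulmxA opprD addrACA subrr add0r.
  by rewrite mulmxBr mulKmx.
pose h := invmx H *m t.
have Hh : H *m h = t by rewrite mulKVmx.
have -> : qform hinv (v - bshift t) = qform H (y - h) by rewrite qform_cong vw.
rewrite (qform_sub y hH Hh) -qQ.
have hE : qform (invmx H) t = Re ((t^t* *m h) 0 0) by rewrite /qform mulmxA.
have qy : Re (((t - v)^t* *m invmx Q *m (t + v)) 0 0) = 2 * Re ((t^t* *m y) 0 0) - qform Q y.
  rewrite -mulmxA -/y; have -> : t - v = t + t - Q *m y by rewrite Qy opprD addrA addrK.
  exact: Re_form_sub.
have -> : qform resd t = qform (invmx T) t - qform (invmx H) t.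
  by rewrite /qform mulmxBr mulmxBl Re_sub11.
have -> : Re (bschur t v tn sn) = 1 + tn - Re (((t - v)^t* *m invmx Q *m (t + v)) 0 0).
  by rewrite /bschur ReD ReN.
rewrite qy hE.
move: (Re ((t^t* *m y) 0 0)) (Re ((t^t* *m h) 0 0)) (qform Q y) (qform (invmx T) t) => a b c d.
ring.
Qed.

End bordered.

(** * Integration over the last row and column *)

Section border_integral.
Context (R : realType) (n : nat).
Local Notation C := R[i].
Local Notation leb := (@lebesgue_measure R).
Local Notation LV := (prodm (lebesgue_tuple R n) (lebesgue_tuple R n)).
Local Notation V := (n.-tuple R * n.-tuple R)%type.
Local Notation RR := (measurableTypeR R).
Local Notation normc := (@ComplexField.Normc.normc R).
Local Notation Re := (@complex.Re R).
Local Notation Im := (@complex.Im R).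
Variables (T S : 'M[C]_n).
Hypotheses (pT : posd T) (hS : S^t* = - S).

Lemma normc_rpow (x : R) (a : C) : normc (rpow x a) = Re (rpow x (Re a)%:C).
Proof. by rewrite normc_rpowE rpow_realE. Qed.

Lemma Re_rpow_ge0 (x b : R) : 0 <= Re (rpow x b%:C).
Proof. by rewrite rpow_realE expR_ge0. Qed.

Lemma Re_rpowM (x b : R) (z : C) : Re (rpow x b%:C * z) = Re (rpow x b%:C) * Re z.
Proof. by rewrite rpow_realE ReM /= mul0r subr0. Qed.

Definition rterm (z : V * RR) : R := z.2 - qform (invmx T) (vec z.1).

Definition qterm (z : (V * RR) * (V * RR)) : C :=
  bschur T S (vec z.1.1) (vec z.2.1) z.1.2 z.2.2.

Lemma measurable_rterm : measurable_fun [set: V * RR] rterm.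
Proof.
apply: measurable_funB; first exact: measurable_snd.
by apply: measurable_qform => k j; exact: (cmeas_comp measurable_fst (@mxmeas_vec R n k j)).
Qed.

Lemma cmeas_qterm : cmeas qterm.
Proof.
have m1 : measurable_fun setT (fun z : (V * RR) * (V * RR) => z.1) by exact: measurable_fst.
have m2 : measurable_fun setT (fun z : (V * RR) * (V * RR) => z.2) by exact: measurable_snd.
have mv1 : mxmeas (fun z : (V * RR) * (V * RR) => vec z.1.1).
  by move=> k j; exact: (cmeas_comp (measurableT_comp measurable_fst m1) (@mxmeas_vec R n k j)).
have mv2 : mxmeas (fun z : (V * RR) * (V * RR) => vec z.2.1).
  by move=> k j; exact: (cmeas_comp (measurableT_comp measurable_fst m2) (@mxmeas_vec R n k j)).
apply: cmeasB.
  split => /=.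
    apply: measurable_funD => //; exact: (measurableT_comp measurable_snd m1).
  by apply: measurable_funD => //; exact: (measurableT_comp measurable_snd m2).
apply: mxmeas_mul; last by apply: mxmeasD.
apply: mxmeas_mul; last exact: mxmeas_cst.
by apply: mxmeas_adj; apply: mxmeasD => //; exact: mxmeasN.
Qed.

Let N := resd T.
Let A := hinv T S.

Let rN0 t : 0 <= qform N t. Proof. exact/posd_ge0/posd_resd. Qed.

Let Eq (x : V * RR) (v : V) (s : RR) : qterm (x, (v, s)) =
  (1 + rterm x + qform N (vec x.1) + qform A (vec v - bshift T S (vec x.1))) +i*
  (s + Im (qterm (x, (v, 0)))).
Proof.
apply: complex_ext; rewrite /=; first exact: Re_bschur.
by rewrite /qterm /bschur !ImD !ImN /=; ring.
Qed.

(** Integration over the last column of the skew part. *)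
Lemma has_int_skew_border (x : V * RR) s t : n%:R < Re (s + t - 1) -> 0 < rterm x ->
  has_int (prodm LV leb) (fun y => qpow (qterm (x, y)) s t)
    (ccst s t * ((pi ^+ n)%:C / \det A * (Gamma (s + t - 1 - n%:R) / Gamma (s + t - 1) *
     rpow (1 + rterm x + qform N (vec x.1)) (n%:R - (s + t - 1))))).
Proof.
move=> np r0; set c := 1 + rterm x + _.
have c0 : 0 < c by rewrite /c ltr_pwDl// addr_gt0.
have inner s' t' v : 1 < Re (s' + t') -> has_int leb (fun y => qpow (qterm (x, (v, y))) s' t')
    (ccst s' t' * rpow (c + qform A (vec v - bshift T S (vec x.1))) (- (s' + t' - 1))).
  move=> p1; rewrite opprB opprD addrA.
  have x0 := ltr_pwDl c0 (posd_ge0 (vec v - bshift T S (vec x.1)) (posd_hinv pT hS)).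
  apply: has_int_ext (has_int_line (Im (qterm (x, (v, 0)))) x0 p1) => y.
  by congr qpow; rewrite [RHS]Eq.
have outer s' t' : n%:R < Re (s' + t' - 1) -> has_int LV (fun v =>
    ccst s' t' * rpow (c + qform A (vec v - bshift T S (vec x.1))) (- (s' + t' - 1)))
    (ccst s' t' * ((pi ^+ n)%:C / \det A * (Gamma (s' + t' - 1 - n%:R) / Gamma (s' + t' - 1) *
     rpow c (n%:R - (s' + t' - 1))))).
  by move=> p1; apply: has_intZ; exact: (has_int_quadratic _ (posd_hinv pT hS) p1 c0).
have mq s' t' : cmeas (fun y => qpow (qterm (x, y)) s' t').
  apply: cmeas_qpow; apply: (cmeas_comp _ cmeas_qterm).
  by apply/measurable_fun_pairP; split; [exact: measurable_cst|exact: measurable_id].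
have p1 : 1 < Re (s + t).
  by move: np; rewrite ReD ReN Re1; have := ler0n R n; lra.
have np' : n%:R < Re (qmean s t + qmean s t - 1) by rewrite ReD qmean_sum -ReD.
have p1' : 1 < Re (qmean s t + qmean s t) by rewrite qmean_sum.
exact: (@has_int_fubini _ _ _ _ _ LV leb _ _ _ _ _ _ _ (mq s t) (mq (qmean s t) (qmean s t))
  (fun=> Re_qpow_mean_ge0 _ _ _) (fun=> normc_qpow_le _ _ _)
  (fun v => inner s t v p1) (fun v => inner _ _ v p1') (outer s t np) (outer _ _ np')).
Qed.

(** For fixed [t] the corner enters through [rterm], its excess over the form
    [invmx T] at [t], over which one has a beta integral; [t] comes last. *)
Lemma has_int_herm_border a b : 0 < Re (a + 1) -> n%:R < Re (b - a - 1) ->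
  has_int (prodm LV leb) (fun x => if 0 < rterm x then
      rpow (rterm x) a * rpow (1 + rterm x + qform N (vec x.1)) (- b) else 0)
    ((Gamma (a + 1) * Gamma (b - a - 1) / Gamma b) *
     ((pi ^+ n)%:C / \det N * (Gamma (b - a - 1 - n%:R) / Gamma (b - a - 1)))).
Proof.
pose f a b (x : V * RR) : C := if 0 < rterm x then
      rpow (rterm x) a * rpow (1 + rterm x + qform N (vec x.1)) (- b) else 0.
move=> a0 nb.
have mf a' b' : cmeas (f a' b').
  apply: cmeas_if; first by apply: measurable_gt0; exact: measurable_rterm.
    apply: cmeasM; apply: cmeas_rpow; first exact: measurable_rterm.
    apply: measurable_funD; first by apply: measurable_funD => //; exact: measurable_rterm.
    by apply: measurable_qform => k j; exact: (cmeas_comp measurable_fst (@mxmeas_vec R n k j)).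
  exact: cmeas_cst.
have inner a' b' t : 0 < Re (a' + 1) -> n%:R < Re (b' - a' - 1) ->
    has_int leb (fun y => f a' b' (t, y)) ((Gamma (a' + 1) * Gamma (b' - a' - 1) / Gamma b') *
      rpow (1 + qform N (vec t + 0)) (- (b' - a' - 1))).
  move=> a0' nb'.
  have ab : Re (a' + 1) < Re b'.
    by move: nb'; rewrite !ReE; have := ler0n R n; lra.
  have c0 : 0 < 1 + qform N (vec t) by rewrite ltr_pwDl.
  have := has_int_shift (- qform (invmx T) (vec t)) (beta_integral_scale a0' ab c0).
  rewrite addr0 addrK (_ : b' - (a' + 1) = b' - a' - 1); last by rewrite opprD addrA.
  rewrite (_ : a' + 1 - b' = - (b' - a' - 1)); last by ring.
  rewrite mulrC; apply: has_int_ext => y; rewrite /f /rterm /=.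
  by rewrite [1 + qform _ _ + _]addrAC.
have outer a' b' : 0 < Re (a' + 1) -> n%:R < Re (b' - a' - 1) -> has_int LV (fun t =>
      (Gamma (a' + 1) * Gamma (b' - a' - 1) / Gamma b') *
      rpow (1 + qform N (vec t + 0)) (- (b' - a' - 1)))
    ((Gamma (a' + 1) * Gamma (b' - a' - 1) / Gamma b') *
     ((pi ^+ n)%:C / \det N * (Gamma (b' - a' - 1 - n%:R) / Gamma (b' - a' - 1)))).
  move=> a0' nb'; apply: has_intZ.
  have := has_int_quadratic 0 (posd_resd pT) nb' ltr01.
  by rewrite rpow1l mulr1.
have a0' : 0 < Re ((Re a)%:C + 1) by move: a0; rewrite !ReE.
have nb' : n%:R < Re ((Re b)%:C - (Re a)%:C - 1) by move: nb; rewrite !ReE.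
apply: (@has_int_fubini _ _ _ _ _ LV leb 1 (f a b) (f (Re a)%:C (Re b)%:C) _ _ _ _
  (mf _ _) (mf _ _) _ _ (fun t => inner a b t a0 nb) (fun t => inner _ _ t a0' nb')
  (outer _ _ a0 nb) (outer _ _ a0' nb')).
- by move=> x; rewrite /f; case: ifP => // _; rewrite -raddfN Re_rpowM mulr_ge0 ?Re_rpow_ge0.
- move=> x; rewrite /f mul1r normc_if; case: ifP => _; last by rewrite normc_real normr0.
  by rewrite -raddfN Re_rpowM ComplexField.Normc.normcM !normc_rpow ReN.
Qed.

Let bconst a s t : C :=
  (ccst s t * ((pi ^+ n)%:C / \det A * (Gamma (s + t - 1 - n%:R) / Gamma (s + t - 1)))) *
  ((Gamma (a + 1) * Gamma (s + t - 1 - n%:R - a - 1) / Gamma (s + t - 1 - n%:R)) *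
   ((pi ^+ n)%:C / \det N *
    (Gamma (s + t - 1 - n%:R - a - 1 - n%:R) / Gamma (s + t - 1 - n%:R - a - 1)))).

Let bconstE a s t : 0 < Re (a + 1) -> 0 < Re (s + t - a - (2 * n + 2)%:R) ->
  bconst a s t = (rpow 2 (2 - s - t) * (pi ^+ (2 * n + 1))%:C *
      (Gamma (a + 1) * Gamma (s + t - a - (2 * n + 2)%:R) * ((Gamma s)^-1 * (Gamma t)^-1))) *
     (\det (1%:M + T + S) * (\det (1%:M + T + S))^* * \det T).
Proof.
move=> a0 c0; have n0 := ler0n R n.
have g1 : Gamma (s + t - 1) != 0.
  by apply: Gamma_neq0; move: a0 c0; rewrite !ReE natrD natrM; lra.
have g2 : Gamma (s + t - 1 - n%:R) != 0.
  by apply: Gamma_neq0; move: a0 c0; rewrite !ReE natrD natrM; lra.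
have g3 : Gamma (s + t - 1 - n%:R - a - 1) != 0.
  by apply: Gamma_neq0; move: a0 c0; rewrite !ReE natrD natrM; lra.
rewrite /bconst (det_hinv pT hS) (det_resd pT) /ccst.
have -> : s + t - 1 - n%:R - a - 1 - n%:R = s + t - a - (2 * n + 2)%:R.
  by rewrite natrD natrM; ring.
have d0 : \det (1%:M + T) != 0.
  by rewrite -unitfE -unitmxE; exact: posd_unit (posdD (posd1 _ _) pT).
have t0 : \det T != 0 by rewrite -unitfE -unitmxE; exact: posd_unit.
have q0 : \det (1%:M + T + S) != 0.
  by rewrite -unitfE -unitmxE; exact: skew_shift_unit.
have q0' : (\det (1%:M + T + S))^* != 0 by rewrite conjc_eq0.
rewrite exprD mulnC exprM expr1 !rmorphM/= !rmorphXn/=.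
move: g1 g2 g3 d0 t0 q0 q0'; set q := \det (1%:M + T + S); set d := \det (1%:M + T); set dT := \det T.
set x1 := Gamma (s + t - 1); set x2 := Gamma (s + t - 1 - n%:R).
set x3 := Gamma (s + t - 1 - n%:R - a - 1); set x4 := Gamma (a + 1).
set x5 := Gamma (s + t - a - _); set x6 := (Gamma s)^-1; set x7 := (Gamma t)^-1.
set r := rpow _ _; set p := pi%:C.
clearbody x1 x2 x3 x4 x5 x6 x7 r p q d dT.
move=> g1 g2 g3 d0 t0 q0 q0'; move: (p ^+ n) => pn.
by field; rewrite g1 g2 g3 d0 t0 q0 -/(conjc q) q0'.
Qed.

(** The Gamma functions and the factor [det (1 + T)] created by one step are cancelled
    by the next, which leaves the determinants of [T] and [1 + T + S] only. *)
Lemma has_int_border a s t : 0 < Re (a + 1) -> 0 < Re (s + t - a - (2 * n + 2)%:R) ->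
  has_int (prodm (prodm LV leb) (prodm LV leb)) (fun z => if 0 < rterm z.1 then
      rpow (rterm z.1) a * qpow (qterm z) s t else 0)
    ((rpow 2 (2 - s - t) * (pi ^+ (2 * n + 1))%:C *
      (Gamma (a + 1) * Gamma (s + t - a - (2 * n + 2)%:R) * ((Gamma s)^-1 * (Gamma t)^-1))) *
     (\det (1%:M + T + S) * (\det (1%:M + T + S))^* * \det T)).
Proof.
move=> a0 c0; rewrite -bconstE//.
pose f a s t (z : (V * RR) * (V * RR)) : C :=
  if 0 < rterm z.1 then rpow (rterm z.1) a * qpow (qterm z) s t else 0.
have mf a' s' t' : cmeas (f a' s' t').
  have mr : measurable_fun setT (fun z : (V * RR) * (V * RR) => rterm z.1).
    exact: (measurableT_comp measurable_rterm measurable_fst).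
  apply: cmeas_if; first exact: measurable_gt0.
    by apply: cmeasM; [exact: cmeas_rpow|exact/cmeas_qpow/cmeas_qterm].
  exact: cmeas_cst.
have inner a' s' t' x : 0 < Re (a' + 1) -> 0 < Re (s' + t' - a' - (2 * n + 2)%:R) ->
  has_int (prodm LV leb) (fun y => f a' s' t' (x, y))
    ((ccst s' t' * ((pi ^+ n)%:C / \det A * (Gamma (s' + t' - 1 - n%:R) / Gamma (s' + t' - 1)))) *
     (if 0 < rterm x then rpow (rterm x) a' *
        rpow (1 + rterm x + qform N (vec x.1)) (- (s' + t' - 1 - n%:R)) else 0)).
  move=> a0' c0'; rewrite /f /=; case: ltP => r0; last by rewrite mulr0; exact: has_int0.
  have np : n%:R < Re (s' + t' - 1).
    by move: a0' c0'; rewrite !ReE natrD natrM; have := ler0n R n; lra.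
  have := has_intZ (rpow (rterm x) a') (has_int_skew_border np r0).
  rewrite [- (s' + t' - 1 - n%:R)]opprB.
  move: (rpow (rterm x) a') (ccst s' t') (_ / \det A) (Gamma _ / _) (rpow (1 + _ + _) _).
  move=> x1 x2 x3 x4 x5.
  by rewrite (_ : x1 * _ = x2 * (x3 * x4) * (x1 * x5)); last by ring.
have outer a' s' t' : 0 < Re (a' + 1) -> 0 < Re (s' + t' - a' - (2 * n + 2)%:R) ->
  has_int (prodm LV leb) (fun x =>
    ((ccst s' t' * ((pi ^+ n)%:C / \det A * (Gamma (s' + t' - 1 - n%:R) / Gamma (s' + t' - 1)))) *
     (if 0 < rterm x then rpow (rterm x) a' *
        rpow (1 + rterm x + qform N (vec x.1)) (- (s' + t' - 1 - n%:R)) else 0)))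
   (bconst a' s' t').
  move=> a0' c0'; apply: has_intZ; apply: has_int_herm_border => //.
  by move: a0' c0'; rewrite !ReE natrD natrM; have := ler0n R n; lra.
have a0' : 0 < Re ((Re a)%:C + 1) by move: a0; rewrite !ReE.
have c0' : 0 < Re (qmean s t + qmean s t - (Re a)%:C - (2 * n + 2)%:R).
  by move: c0; rewrite !(ReD, ReN) -!ReD qmean_sum.
apply: (@has_int_fubini _ _ _ _ _ (prodm LV leb) (prodm LV leb) (expR (`|Im s - Im t| * (pi / 2)))
  (f a s t) (f (Re a)%:C (qmean s t) (qmean s t)) _ _ _ _
  (mf _ _ _) (mf _ _ _) _ _ (fun x => inner a s t x a0 c0) (fun x => inner _ _ _ x a0' c0')
  (outer _ _ _ a0 c0) (outer _ _ _ a0' c0')).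
- move=> z; rewrite /f; case: ifP => // _.
  by rewrite Re_rpowM mulr_ge0 ?Re_rpow_ge0 ?Re_qpow_mean_ge0.
- move=> z; rewrite /f normc_if; case: ifP => _; last by rewrite normc_real normr0 mulr0.
  rewrite Re_rpowM ComplexField.Normc.normcM normc_rpow mulrCA ler_wpM2l ?Re_rpow_ge0//.
  exact: normc_qpow_le.
Qed.

End border_integral.

(** * Coordinates of a bordered matrix *)

Section tuple_coordinates.
Context (R : realType).
Local Notation leb := (@lebesgue_measure R).
Local Notation RR := (measurableTypeR R).

Definition box d (A : 'I_d -> set RR) : set (d.-tuple R) := [set t | forall i, A i (tnth t i)].

Lemma measurable_box d (A : 'I_d -> set RR) :
  (forall i, measurable (A i)) -> measurable (box A).
Proof.
move=> mA; rewrite (_ : box A = \bigcap_(i in [set: 'I_d])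
   ((fun t : d.-tuple R => tnth t i) @^-1` A i)); last first.
  by apply/seteqP; split=> t h i; [move=> _; exact: (h i)|exact: (h i I)].
apply: fin_bigcap_measurable => // i _; rewrite -[X in measurable X]setTI.
exact: (@measurable_tnth _ RR d i).
Qed.

Lemma measurable_boxE d :
  @measurable _ (d.-tuple R) = <<s [set B | exists2 A, (forall i, measurable (A i)) & B = @box d A] >>.
Proof.
apply/seteqP; split; last first.
  apply: smallest_sub; first exact: sigma_algebra_measurable.
  by move=> _ [A mA ->]; exact: measurable_box.
apply: smallest_sub; first exact: smallest_sigma_algebra.
rewrite -bigcup_seq => B /= [k _ [A mA <-]]; apply: sub_sigma_algebra.
exists (fun l => if l == k then A else setT) => [l|]; first by case: ifP.
apply/seteqP; split=> t /=.
  by move=> [_ h] l; case: eqP => [->|].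
by move=> /(_ k); rewrite eqxx.
Qed.

Lemma lebesgue_box d (A : 'I_d -> set RR) : (forall i, measurable (A i)) ->
  lebesgue_tuple R d (box A) = (\prod_(i < d) leb (A i))%E.
Proof. exact: lebesgue_tuple_box. Qed.

(** Lebesgue measure on tuples is characterised by its values on boxes. *)
Lemma mpres_tuple d dX (X : measurableType dX) (mu : {measure set X -> \bar R})
    (phi : X -> d.-tuple R) :
  (forall i, measurable_fun [set: X] (fun x => tnth (phi x) i : RR)) ->
  (forall A : 'I_d -> set RR, (forall i, measurable (A i)) ->
    mu (phi @^-1` box A) = (\prod_(i < d) leb (A i))%E) ->
  mpres mu (lebesgue_tuple R d) phi.
Proof.
move=> mphi boxE.
have mphi' : measurable_fun [set: X] phi by apply/measurable_fun_tnthP => i; exact: mphi.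
split => // A mA; have /sigma_finiteP[F [TF ndF Foo]] := sigma_finiteT leb.
have setI_box : setI_closed [set B | exists2 A, (forall i, measurable (A i)) & B = @box d A].
  move=> _ _ [A1 mA1 ->] [A2 mA2 ->]; exists (fun i => A1 i `&` A2 i).
    by move=> i; exact: measurableI.
  apply/seteqP; split=> t; first by move=> [h1 h2] i; split.
  by move=> h; split=> i; have [] := h i.
apply: (measure_unique _ (fun k => box (fun=> F k)) (measurable_boxE d) setI_box _ _
  (lebesgue_tuple R d) (pushforward mu phi)) => //.
- by move=> k; exists (fun=> F k) => // i; have [] := Foo k.
- apply/seteqP; split=> // t _.
  have hk i : exists k, F k (tnth t i).
    by have : [set: R] (tnth t i) by []; rewrite TF => -[k _ Fk]; exists k.
  exists (\max_i (projT1 (cid (hk i)))) => // i.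
  move: (projT2 (cid (hk i))) => /=; apply/subsetPset/ndF.
  exact: (leq_bigmax i).
- move=> _ [B mB ->]; transitivity (\prod_(i < d) leb (B i))%E; first exact: lebesgue_box.
  exact/esym/boxE.
- move=> k; have [mF Fk] := Foo k.
  have E : (lebesgue_tuple R d (box (fun=> F k)) <= \prod_(i < d) leb (F k))%E.
    by rewrite le_eqVlt; apply/orP; left; apply/eqP; exact: lebesgue_box.
  apply: le_lt_trans E _; suff /andP[] : (0 <= \prod_(i < d) leb (F k) < +oo)%E by [].
  elim/big_ind : _ => [|x y /andP[x0 xoo] /andP[y0 yoo]|_ _].
  + by rewrite lee01 ltry.
  + by rewrite mule_ge0//= lte_mul_pinfty// ge0_fin_numE.
  + by rewrite measure_ge0.
Qed.

Lemma prodmE d1 d2 (X : measurableType d1) (Y : measurableType d2)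
    (m1 : {sigma_finite_measure set X -> \bar R}) (m2 : {sigma_finite_measure set Y -> \bar R})
    (B : set X) (D : set Y) b d : measurable B -> measurable D -> m1 B = b -> m2 D = d ->
  prodm m1 m2 (B `*` D) = (b * d)%E.
Proof. by move=> mB mD <- <-; rewrite /prodm product_measure1E. Qed.

(** The real parts of the last column are stored in the last column and the imaginary
    parts in the last row, as [herm_of] and [skewherm_of] expect. *)
Definition hcons n (z : (n * n).-tuple R * ((n.-tuple R * n.-tuple R) * R)) :
    (n.+1 * n.+1).-tuple R :=
  [tuple mxvec (\matrix_(k < n.+1, m < n.+1) match unlift ord_max k, unlift ord_max m with
    | Some k', Some m' => Defs.coord z.1 k' m'
    | Some k', None => tnth z.2.1.1 k'
    | None, Some m' => tnth z.2.1.2 m'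
    | None, None => z.2.2 end) 0 i | i < n.+1 * n.+1].

Lemma coord_hcons n (z : (n * n).-tuple R * ((n.-tuple R * n.-tuple R) * R)) k m :
  Defs.coord (hcons z) k m = match unlift ord_max k, unlift ord_max m with
    | Some k', Some m' => Defs.coord z.1 k' m'
    | Some k', None => tnth z.2.1.1 k'
    | None, Some m' => tnth z.2.1.2 m'
    | None, None => z.2.2 end.
Proof. by rewrite /Defs.coord tnth_mktuple mxvecE mxE. Qed.

Lemma prod_mxvec n (F : 'I_(n * n) -> \bar R) :
  (\prod_(i < n * n) F i = \prod_(k < n) \prod_(m < n) F (mxvec_index k m))%E.
Proof.
rewrite (reindex _ (curry_mxvec_bij n n)) pair_bigA /=.
by apply: eq_bigr => -[].
Qed.

Lemma prod_bordered n (F : 'I_n.+1 -> 'I_n.+1 -> \bar R) :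
  (\prod_(k < n.+1) \prod_(m < n.+1) F k m =
  (\prod_(k < n) \prod_(m < n) F (lift ord_max k) (lift ord_max m)) *
  ((\prod_(k < n) F (lift ord_max k) ord_max) *
   (\prod_(m < n) F ord_max (lift ord_max m)) * F ord_max ord_max))%E.
Proof.
have E (k : 'I_n) : widen_ord (leqnSn n) k = lift ord_max k.
  by apply/esym/val_inj; exact: lift_max.
have S (G : 'I_n.+1 -> \bar R) :
    (\prod_(k < n.+1) G k = \prod_(k < n) G (lift ord_max k) * G ord_max)%E.
  by rewrite big_ord_recr; congr (_ * _)%E; apply: eq_bigr => k _; rewrite E.
rewrite S; under eq_bigr do rewrite S.
by rewrite big_split /= S !muleA.
Qed.

Lemma mpres_hcons n : mpres
  (prodm (lebesgue_tuple R (n * n))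
    (prodm (prodm (lebesgue_tuple R n) (lebesgue_tuple R n)) leb))
  (lebesgue_tuple R (n.+1 * n.+1)) (@hcons n).
Proof.
have mz2 := @measurable_snd _ _ ((n * n).-tuple R) ((n.-tuple R * n.-tuple R) * RR)%type.
have mz1 := measurableT_comp measurable_fst mz2.
apply: mpres_tuple => [i|A mA].
  case/mxvec_indexP: i => k m.
  under eq_fun do rewrite -/(Defs.coord _ k m) coord_hcons.
  case: (unlift ord_max k) => [k'|]; case: (unlift ord_max m) => [m'|].
  - exact: (measurableT_comp (measurable_tnth _) measurable_fst).
  - exact: (measurableT_comp (measurable_tnth _) (measurableT_comp measurable_fst mz1)).
  - exact: (measurableT_comp (measurable_tnth _) (measurableT_comp measurable_snd mz1)).
  - exact: (measurableT_comp measurable_snd mz2).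
rewrite prod_mxvec prod_bordered.
pose A' k m := A (mxvec_index k m).
pose pr (i : 'I_(n * n)) := enum_val (cast_ord (esym (mxvec_cast n n)) i) : 'I_n * 'I_n.
have prE k m : pr (mxvec_index k m) = (k, m).
  by rewrite /pr /mxvec_index cast_ordK enum_rankK.
rewrite (_ : _ @^-1` _ =
  box (fun i : 'I_(n * n) => A' (lift ord_max (pr i).1) (lift ord_max (pr i).2)) `*`
  ((box (fun k => A' (lift ord_max k) ord_max) `*` box (fun m => A' ord_max (lift ord_max m)))
    `*` A' ord_max ord_max)); last first.
  apply/seteqP; split=> -[x [[u v] c]] /=.
    move=> h; have h' k m : A' k m (Defs.coord (hcons (x, ((u, v), c))) k m) by exact: h.
    split=> [i|]; last split; first 1 last; try split.
    - move=> k; have := h' (lift ord_max k) ord_max.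
      by rewrite coord_hcons liftK unlift_none.
    - move=> m; have := h' ord_max (lift ord_max m).
      by rewrite coord_hcons liftK unlift_none.
    - by have := h' ord_max ord_max; rewrite coord_hcons unlift_none.
    - case/mxvec_indexP: i => k m; rewrite prE /=.
      by have := h' (lift ord_max k) (lift ord_max m); rewrite coord_hcons !liftK.
  move=> [h1 [[h2 h3] h4]] i; case/mxvec_indexP: i => k m.
  rewrite -/(Defs.coord _ k m) coord_hcons /=.
  case: (unliftP ord_max k) => [k'|] ->; case: (unliftP ord_max m) => [m'|] -> //.
  - by have := h1 (mxvec_index k' m'); rewrite prE.
  - exact: h2.
  - exact: h3.
have mA' k m : measurable (A' k m) by exact: mA.
have mb1 : measurable (box (fun k => A' (lift ord_max k) ord_max)) by exact: measurable_box.
have mb2 : measurable (box (fun m => A' ord_max (lift ord_max m))) by exact: measurable_box.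
apply: prodmE.
- exact: measurable_box.
- by apply: measurableX => //; exact: measurableX.
- transitivity (\prod_(i < n * n) leb (A' (lift ord_max (pr i).1) (lift ord_max (pr i).2)))%E.
    exact: lebesgue_box.
  by rewrite prod_mxvec; apply: eq_bigr => k _; apply: eq_bigr => m _; rewrite prE.
- by apply: prodmE => //; [exact: measurableX|apply: prodmE => //; exact: lebesgue_box].
Qed.

End tuple_coordinates.

(** * Pivots and positive definiteness *)

Section peeling.
Context (R : realType).
Local Notation C := R[i].
Local Notation normc := (@ComplexField.Normc.normc R).
Local Notation Re := (@complex.Re R).
Local Notation Im := (@complex.Im R).

Definition ulpart n (A : 'M[C]_n.+1) : 'M[C]_n := mxsub (lift ord_max) (lift ord_max) A.

(** The last pivot of Gaussian elimination. *)
Definition pivot n (A : 'M[C]_n.+1) : C := \det A / \det (ulpart A).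

(** The same matrix, indexed so that its last row and column form blocks. *)
Definition blk n (A : 'M[C]_n.+1) : 'M[C]_(n + 1) :=
  mxsub (cast_ord (addn1 n)) (cast_ord (addn1 n)) A.

Lemma cast_ord_lshift n (k : 'I_n) : cast_ord (addn1 n) (lshift 1 k) = lift ord_max k.
Proof. by apply/esym/val_inj; exact: lift_max. Qed.

Lemma cast_ord_rshift n (k : 'I_1) : cast_ord (addn1 n) (rshift n k) = ord_max.
Proof. by apply: val_inj; rewrite ord1 /= addn0. Qed.

Lemma blkE n (A : 'M[C]_n.+1) (P : 'M[C]_n) (B : 'cV[C]_n) (B' : 'rV[C]_n) (D : C) :
  (forall k m, A (lift ord_max k) (lift ord_max m) = P k m) ->
  (forall k, A (lift ord_max k) ord_max = B k 0) ->
  (forall m, A ord_max (lift ord_max m) = B' 0 m) ->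
  A ord_max ord_max = D -> blk A = block_mx P B B' D%:M.
Proof.
move=> eP eB eB' eD; apply/matrixP => k m; rewrite mxE.
case: (split_ordP k) => k' ->; case: (split_ordP m) => m' ->;
  rewrite ?cast_ord_lshift ?cast_ord_rshift ?block_mxEul ?block_mxEur ?block_mxEdl ?block_mxEdr.
- exact: eP.
- by rewrite eB ord1.
- by rewrite eB' ord1.
- by rewrite eD !ord1 mxE eqxx.
Qed.

Lemma det_blk n (A : 'M[C]_n.+1) : \det (blk A) = \det A.
Proof.
rewrite /blk; move: (addn1 n) A; case: _ / => A; congr (\det _).
by apply/matrixP => k m; rewrite mxE !cast_ord_id.
Qed.

Lemma posd_blk n (A : 'M[C]_n.+1) : posd (blk A) <-> posd A.
Proof.
rewrite /blk; move: (addn1 n) A; case: _ / => A.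
by rewrite (_ : mxsub _ _ A = A)//; apply/matrixP => k m; rewrite mxE !cast_ord_id.
Qed.

Lemma herm_blk n (A : 'M[C]_n.+1) : A^t* = A ->
  blk A = block_mx (ulpart A) (\col_k A (lift ord_max k) ord_max)
    ((\col_k A (lift ord_max k) ord_max)^t*) (A ord_max ord_max)%:M.
Proof.
move=> hA; apply: blkE => [k m|k|m|] //; rewrite ?mxE //.
by rewrite -[in LHS]hA !mxE.
Qed.

Lemma pivot_block n (A : 'M[C]_n.+1) (B : 'cV[C]_n) (B' : 'rV[C]_n) (D : C) :
  blk A = block_mx (ulpart A) B B' D%:M -> ulpart A \in unitmx ->
  pivot A = D - (B' *m invmx (ulpart A) *m B) 0 0.
Proof.
move=> E u; rewrite /pivot -det_blk E det_schur// mulrC mulKf ?det_mx11; last first.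
  by rewrite -unitfE -unitmxE.
by rewrite mxE mxE [in X in _ + X]mxE eqxx mulr1n.
Qed.

Lemma posd11 (X : 'M[C]_1) : X^t* = X -> posd X <-> 0 < Re (X 0 0).
Proof.
move=> hX; have qX (u : 'cV[C]_1) : qform X u = Re (X 0 0) * normc (u 0 0) ^+ 2.
  have XE : X 0 0 = (Re (X 0 0))%:C.
    by apply: complex_ext => //=; exact: herm_diag_real.
  move: XE; move: (Re (X 0 0)) => p XE.
  rewrite /qform (mx11_scalar X) XE mul_mx_scalar -scalemxAl mxE mxE big_ord1.
  by rewrite !mxE conjcE [_^* * _]mulrC mulcJ -rmorphM.
split=> [[_ pX]|X0].
  have := pX (const_mx 1); rewrite qX mxE.
  rewrite (_ : normc 1 = 1) ?expr1n ?mulr1; last by rewrite (normc_real 1) normr1.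
  by apply; apply/eqP => /matrixP/(_ 0 0); rewrite !mxE; apply/eqP; rewrite oner_eq0.
split=> // v v0; rewrite qX mulr_gt0// exprn_gt0// normc_gt0.
by apply: contra_neq v0 => v0; apply/matrixP => k l; rewrite !ord1 v0 mxE.
Qed.

(** Sylvester's criterion, one step. *)
Lemma posd_recr n (A : 'M[C]_n.+1) : A^t* = A ->
  posd A <-> posd (ulpart A) /\ 0 < Re (pivot A).
Proof.
move=> hA; have E := herm_blk hA; set B := (\col_k _) in E; set D := (_ ord_max ord_max) in E.
have hD : (D%:M : 'M[C]_1)^t* = D%:M.
  rewrite tr_scalar_mx map_scalar_mx; congr _%:M.
  by have := congr1 (fun M : 'M[C]_n.+1 => M ord_max ord_max) hA; rewrite !mxE.
have key : posd (ulpart A) -> (posd A <-> 0 < Re (pivot A)).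
  move=> pU; rewrite -posd_blk E (posd_block _ pU hD) (pivot_block E (posd_unit pU)).
  rewrite posd11; last first.
    have [hU _] := pU.
    by rewrite adjD adjN !adjM adjK adj_inv hU hD mulmxA.
  by rewrite !mxE eqxx mulr1n.
split=> [pA|[pU]]; last by move=> /(key pU).
have pU : posd (ulpart A) by apply: (@posd_ulsub R _ _ _ B (B^t*) D%:M); rewrite -E posd_blk.
by split=> //; apply/key.
Qed.

(** The integrand as a function of the pivots; the tests make it vanish unless [T] is
    positive definite. *)
Fixpoint weight n (a s t : nat -> C) : 'M[C]_n -> 'M[C]_n -> C :=
  match n with
  | 0 => fun _ _ => 1
  | n'.+1 => fun T Q => weight a s t (ulpart T) (ulpart Q) *
      (if 0 < Re (pivot T)
       then rpow (Re (pivot T)) (a n') * qpow (pivot Q) (s n') (t n') else 0)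
  end.

Lemma posd_mx0 (A : 'M[C]_0) : posd A.
Proof.
split; first by rewrite [A]flatmx0 [LHS]flatmx0.
by move=> v; rewrite flatmx0 eqxx.
Qed.

Lemma herm_ulpart n (A : 'M[C]_n.+1) : A^t* = A -> (ulpart A)^t* = ulpart A.
Proof. by move=> hA; rewrite -[in RHS]hA; apply/matrixP => k m; rewrite !mxE. Qed.

Lemma weight_eq0 n a s t (T Q : 'M[C]_n) : T^t* = T -> ~ posd T -> weight a s t T Q = 0.
Proof.
elim: n T Q => [|n IH] T Q hT nT; first by have := posd_mx0 T.
rewrite /=; have [pU|nU] := pselect (posd (ulpart T)).
  by case: ltP => [r0|]; [exfalso; apply: nT; apply/posd_recr|rewrite mulr0].
by rewrite IH ?mul0r//; exact: herm_ulpart.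
Qed.

(** Real exponents, with [s] and [t] replaced by their mean, give a real majorant of
    the same kind; this is what Fubini's theorem needs. *)
Lemma weight_bound n a s t (T Q : 'M[C]_n) :
  let W0 := weight (fun k => (Re (a k))%:C) (fun k => qmean (s k) (t k))
     (fun k => qmean (s k) (t k)) T Q in
  [/\ 0 <= Re W0, Im W0 = 0 &
    normc (weight a s t T Q) <=
      (\prod_(k < n) expR (`|Im (s k) - Im (t k)| * (pi / 2))) * Re W0].
Proof.
elim: n T Q => [|n IH] T Q /=.
  by rewrite big_ord0 mul1r expr1n expr0n /= addr0 sqrtr1.
have [W0 W1 W2] := IH (ulpart T) (ulpart Q).
case: ltP => r0; last first.
  by rewrite !mulr0 ComplexField.Normc.normc0.
set w0 := weight _ _ _ _ _ in W0 W1 W2 *; set w := weight _ _ _ _ _ in W2 *.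
move: (pivot T) (pivot Q) r0 => r q r0.
rewrite rpow_realE qpow_mean -rmorphM !ReM !ImM W1 /= !mul0r !mulr0 subr0 addr0.
split=> //; first by rewrite mulr_ge0// mulr_ge0// expR_ge0.
rewrite big_ord_recr/= !ComplexField.Normc.normcM mulrACA ler_pM ?normc_ge0//.
  by rewrite mulr_ge0// normc_ge0.
rewrite normc_rpowE mulrCA ler_wpM2l ?expR_ge0//.
by have := normc_qpow_le q (s n) (t n); rewrite qpow_mean.
Qed.

Lemma cmeas_weight d (X : measurableType d) n a s t (F G : X -> 'M[C]_n) :
  mxmeas F -> mxmeas G -> cmeas (fun x => weight a s t (F x) (G x)).
Proof.
elim: n F G => [|n IH] F G mF mG /=; first exact: cmeas_cst.
have mul (H : X -> 'M[C]_n.+1) : mxmeas H -> mxmeas (fun x => ulpart (H x)).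
  by move=> mH k m; under eq_fun do rewrite mxE; exact: mH.
have mp (H : X -> 'M[C]_n.+1) : mxmeas H -> cmeas (fun x => pivot (H x)).
  by move=> mH; apply: cmeasM; [exact: cmeas_det|exact/cmeasV/cmeas_det/mul].
have [mr _] := mp _ mF.
apply: cmeasM; first by apply: IH; exact: mul.
apply: cmeas_if; first exact: measurable_gt0.
  by apply: cmeasM; [exact: cmeas_rpow|exact/cmeas_qpow/mp].
exact: cmeas_cst.
Qed.

End peeling.

(** * Pivots of dissipative matrices *)

Section weight_integral.
Context (R : realType).
Local Notation C := R[i].
Local Notation leb := (@lebesgue_measure R).
Local Notation normc := (@ComplexField.Normc.normc R).
Local Notation Re := (@complex.Re R).
Local Notation Im := (@complex.Im R).
Local Notation LM n := (lebesgue_tuple R (n * n)).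
Local Notation LV n := (prodm (lebesgue_tuple R n) (lebesgue_tuple R n)).

Definition lastcol n (A : 'M[C]_n.+1) : 'cV[C]_n := \col_k A (lift ord_max k) ord_max.

Lemma ulpart_shift n (T S : 'M[C]_n.+1) :
  ulpart (1%:M + T + S) = 1%:M + ulpart T + ulpart S.
Proof.
by apply/matrixP => k m; rewrite !mxE (inj_eq (@lift_inj _ _)).
Qed.

Lemma skew_ulpart n (S : 'M[C]_n.+1) : S^t* = - S -> (ulpart S)^t* = - ulpart S.
Proof.
move=> hS; apply/matrixP => k m.
have := congr1 (fun M : 'M[C]_n.+1 => M (lift ord_max k) (lift ord_max m)) hS.
by rewrite !mxE.
Qed.

Lemma Re_pivot_herm n (T : 'M[C]_n.+1) : T^t* = T -> posd (ulpart T) ->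
  Re (pivot T) = Re (T ord_max ord_max) - qform (invmx (ulpart T)) (lastcol T).
Proof.
move=> hT pU; rewrite (pivot_block (herm_blk hT) (posd_unit pU)) ReD ReN.
by rewrite -/(lastcol T) /qform.
Qed.

Lemma pivot_shift n (T S : 'M[C]_n.+1) : T^t* = T -> S^t* = - S -> posd (ulpart T) ->
  pivot (1%:M + T + S) = bschur (ulpart T) (ulpart S) (lastcol T) (lastcol S)
    (Re (T ord_max ord_max)) (Im (S ord_max ord_max)).
Proof.
move=> hT hS pU.
have hTE k m : T k m = Num.conj (T m k) by rewrite -[in LHS]hT !mxE.
have hSE k m : S k m = - Num.conj (S m k).
  by have := congr1 (fun M : 'M[C]_n.+1 => - M k m) hS; rewrite !mxE opprK => <-.
have E : blk (1%:M + T + S) = block_mx (ulpart (1%:M + T + S)) (lastcol T + lastcol S)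
    ((lastcol T - lastcol S)^t*)
    (1 + (Re (T ord_max ord_max) +i* Im (S ord_max ord_max)))%:M.
  apply: blkE => [k m|k|m|].
  - by rewrite !mxE.
  - by rewrite !mxE (negbTE (_ : lift ord_max k != ord_max)) ?add0r// eq_sym neq_lift.
  - rewrite !mxE (negbTE (neq_lift ord_max m)) add0r.
    by rewrite [T ord_max _]hTE [S ord_max _]hSE -rmorphB.
  - rewrite !mxE eqxx -addrA; congr (_ + _).
    have := herm_diag_real ord_max hT; move: (hSE ord_max ord_max).
    case: (T _ _) => a b; case: (S _ _) => c d /= [] /eqP; rewrite -subr_eq0 opprK -mulr2n.
    by rewrite mulrn_eq0 => /= /eqP -> _ ->; apply: complex_ext; rewrite /= ?addr0 ?add0r.
have uQ : ulpart (1%:M + T + S) \in unitmx.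
  by rewrite ulpart_shift; apply: skew_shift_unit => //; exact: skew_ulpart.
by rewrite (pivot_block E uQ) ulpart_shift.
Qed.

Lemma Re_pivot_shift n (T S : 'M[C]_n.+1) : posd T -> S^t* = - S ->
  0 < Re (pivot (1%:M + T + S)).
Proof.
move=> pT hS; have [hT _] := pT; have [pU r0] := (posd_recr hT).1 pT.
have hS' := skew_ulpart hS.
rewrite pivot_shift// Re_bschur// -Re_pivot_herm//.
have := posd_ge0 (lastcol T) (posd_resd pU).
have := posd_ge0 (lastcol S - bshift (ulpart T) (ulpart S) (lastcol T)) (posd_hinv pU hS').
move: r0; move: (qform (hinv _ _) _) (qform (resd _) _) (Re (pivot T)) => x y z; lra.
Qed.

Lemma det_pivot n (A : 'M[C]_n.+1) : ulpart A \in unitmx -> \det A = pivot A * \det (ulpart A).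
Proof. by move=> u; rewrite /pivot divfK// -unitfE -unitmxE. Qed.

Lemma pivot_real n (T : 'M[C]_n.+1) : posd T -> pivot T = (Re (pivot T))%:C.
Proof.
move=> pT; have [hT _] := pT; have [pU _] := (posd_recr hT).1 pT.
apply: complex_ext => //=.
rewrite (pivot_block (herm_blk hT) (posd_unit pU)) ImD ImN herm_diag_real//.
by rewrite herm_form_real ?subr0//; case: (posd_inv pU).
Qed.

(** The determinants of [T] and [1 + T + S] are the products of their pivots, which in
    [T] are real. *)
Lemma weight_shift n a s t (T S : 'M[C]_n) : posd T -> S^t* = - S ->
  weight (fun k => a k + 1) (fun k => s k - 1) (fun k => t k - 1) T (1%:M + T + S) =
  (\det (1%:M + T + S) * (\det (1%:M + T + S))^* * \det T) * weight a s t T (1%:M + T + S).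
Proof.
elim: n T S => [|n IH] T S pT hS.
  by rewrite !det_mx00 !mulr1 mul1r; apply: complex_ext; rewrite /= ?oppr0.
have [hT _] := pT; have [pU r0] := (posd_recr hT).1 pT.
have hS' := skew_ulpart hS; have q0 := Re_pivot_shift pT hS.
have uQ : ulpart (1%:M + T + S) \in unitmx.
  by rewrite ulpart_shift; exact: skew_shift_unit.
rewrite (det_pivot uQ) (det_pivot (posd_unit pU)) /= r0 ulpart_shift IH//.
rewrite {2}(pivot_real pT); move: (pivot T) (pivot (1%:M + T + S)) q0 r0 => r q q0 r0.
rewrite rpowD rpow1// qpowD.
have -> : qpow q (-1) (-1) = q * q^*.
  have : qpow q (-1) (-1) * (q^-1 * (q^*)^-1) = 1.
    by rewrite -qpow10// -qpow01// -!qpowD addr0 add0r !addNr qpow00.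
  have qn : q != 0 by exact: Re_neq0.
  have qn' : q^* != 0 by rewrite conjc_eq0.
  by rewrite -invfM => /divr1_eq.
rewrite rmorphM/=.
move: (weight _ _ _ _ _) (\det _) (\det _) (rpow _ _) (qpow _ _ _) => w d1 d2 x y.
ring.
Qed.

End weight_integral.

(** * Induction on the size *)

Section weight_induction.
Context (R : realType).
Local Notation C := R[i].
Local Notation leb := (@lebesgue_measure R).
Local Notation normc := (@ComplexField.Normc.normc R).
Local Notation Re := (@complex.Re R).
Local Notation Im := (@complex.Im R).
Local Notation LM n := (lebesgue_tuple R (n * n)).
Local Notation LV n := (prodm (lebesgue_tuple R n) (lebesgue_tuple R n)).

Lemma herm_of_adj n (x : (n * n).-tuple R) : (herm_of x)^t* = herm_of x.
Proof. by apply/herm_ofP; exists x. Qed.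

Lemma skewherm_of_adj n (x : (n * n).-tuple R) : (skewherm_of x)^t* = - skewherm_of x.
Proof. by apply/skewherm_ofP; exists x. Qed.

Lemma measurable_coord n (k m : 'I_n) :
  measurable_fun [set: (n * n).-tuple R] (fun x => Defs.coord x k m).
Proof. exact: measurable_tnth. Qed.

Lemma mxmeas_herm_of n : mxmeas (@herm_of R n).
Proof.
move=> k m; under eq_fun do rewrite mxE.
case: (k == m); first by apply: cmeas_real; exact: measurable_coord.
case: ltnP => _; split => /=; try exact: measurable_coord.
by apply: measurable_funN; exact: measurable_coord.
Qed.

Lemma mxmeas_skewherm_of n : mxmeas (@skewherm_of R n).
Proof.
move=> k m; under eq_fun do rewrite mxE.
case: (k == m); first by split => /=; [exact: measurable_cst|exact: measurable_coord].
case: ltnP => _; split => /=; try exact: measurable_coord.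
by apply: measurable_funN; exact: measurable_coord.
Qed.

Section hcons_entries.
Variables (n : nat) (x : (n * n).-tuple R) (z : (n.-tuple R * n.-tuple R) * R).

Let lift_ltn (k : 'I_n) : (lift ord_max k < @ord_max n)%N.
Proof. by rewrite lift_max. Qed.

Lemma ulpart_herm_hcons : ulpart (herm_of (hcons (x, z))) = herm_of x.
Proof.
apply/matrixP => k m; rewrite !mxE !coord_hcons !liftK (inj_eq (@lift_inj _ _)).
by rewrite !lift_max.
Qed.

Lemma ulpart_skewherm_hcons : ulpart (skewherm_of (hcons (x, z))) = skewherm_of x.
Proof.
apply/matrixP => k m; rewrite !mxE !coord_hcons !liftK (inj_eq (@lift_inj _ _)).
by rewrite !lift_max.
Qed.

Lemma lastcol_herm_hcons : lastcol (herm_of (hcons (x, z))) = vec z.1.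
Proof.
apply/matrixP => k m; rewrite !mxE !coord_hcons !liftK !unlift_none.
by rewrite eq_sym (negbTE (neq_lift _ _)) lift_ltn.
Qed.

Lemma lastcol_skewherm_hcons : lastcol (skewherm_of (hcons (x, z))) = vec z.1.
Proof.
apply/matrixP => k m; rewrite !mxE !coord_hcons !liftK !unlift_none.
by rewrite eq_sym (negbTE (neq_lift _ _)) lift_ltn.
Qed.

Lemma corner_herm_hcons : Re (herm_of (hcons (x, z)) ord_max ord_max) = z.2.
Proof. by rewrite !mxE eqxx coord_hcons unlift_none. Qed.

Lemma corner_skewherm_hcons : Im (skewherm_of (hcons (x, z)) ord_max ord_max) = z.2.
Proof. by rewrite !mxE eqxx coord_hcons unlift_none. Qed.

End hcons_entries.

(** The [k]-th factor of the value, for [a] the exponent of the [k]-th pivot of [T] and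
    [s], [t] those of [1 + T + S]. *)
Definition factor (n k : nat) (a s t : C) : C :=
  rpow 2 (2 * (n%:R - k%:R) - s - t) * (pi ^+ (2 * k + 1))%:C *
  (Gamma (a + n%:R - k%:R) * Gamma (s + t - a - 3 * n%:R + k%:R + 1) *
   ((Gamma (s - n%:R + k%:R + 1))^-1 * (Gamma (t - n%:R + k%:R + 1))^-1)).

Lemma factorS n k a s t : factor n.+1 k a s t = factor n k (a + 1) (s - 1) (t - 1).
Proof.
rewrite /factor -(natr1 n); congr (rpow _ _ * _ * (Gamma _ * Gamma _ * ((Gamma _)^-1 * (Gamma _)^-1))); ring.
Qed.

Definition integrand n (a s t : nat -> C) (p : (n * n).-tuple R * (n * n).-tuple R) : C :=
  weight a s t (herm_of p.1) (1%:M + herm_of p.1 + skewherm_of p.2).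

Lemma cmeas_integrand n a s t : cmeas (@integrand n a s t).
Proof.
have m1 : mxmeas (fun p : (n * n).-tuple R * (n * n).-tuple R => herm_of p.1).
  by move=> k m; exact: (cmeas_comp measurable_fst (@mxmeas_herm_of n k m)).
have m2 : mxmeas (fun p : (n * n).-tuple R * (n * n).-tuple R => skewherm_of p.2).
  by move=> k m; exact: (cmeas_comp measurable_snd (@mxmeas_skewherm_of n k m)).
apply: cmeas_weight => //; apply: mxmeasD => //; apply: mxmeasD => //; exact: mxmeas_cst.
Qed.

Definition hcons2 n (w : ((n * n).-tuple R * (n * n).-tuple R) *
    (((n.-tuple R * n.-tuple R) * measurableTypeR R) * ((n.-tuple R * n.-tuple R) * measurableTypeR R))) :=
  (hcons (w.1.1, w.2.1), hcons (w.1.2, w.2.2)).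

Lemma mpres_hcons2 n : mpres
  (prodm (prodm (LM n) (LM n)) (prodm (prodm (LV n) leb) (prodm (LV n) leb)))
  (prodm (LM n.+1) (LM n.+1)) (@hcons2 n).
Proof.
exact: mpres_comp (mpres_interchange _ _ _ _) (mpres_prod (mpres_hcons R n) (mpres_hcons R n)).
Qed.

(** Bordering changes the integrand by the factor that depends on the last pivots. *)
Lemma integrand_hcons2 n a s t w : integrand a s t (@hcons2 n w) =
  integrand a s t w.1 * (if 0 < rterm (herm_of w.1.1) w.2.1 then
     rpow (rterm (herm_of w.1.1) w.2.1) (a n) *
     qpow (qterm (herm_of w.1.1) (skewherm_of w.1.2) w.2) (s n) (t n) else 0).
Proof.
case: w => -[x y] [z1 z2]; rewrite /integrand /hcons2 /=.
rewrite ulpart_shift ulpart_herm_hcons ulpart_skewherm_hcons.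
have [pU|nU] := pselect (posd (herm_of x)); last first.
  by rewrite weight_eq0 ?mul0r//; exact: herm_of_adj.
have := Re_pivot_herm (herm_of_adj (hcons (x, z1))).
rewrite ulpart_herm_hcons lastcol_herm_hcons corner_herm_hcons => /(_ pU) ->.
have := pivot_shift (herm_of_adj (hcons (x, z1))) (skewherm_of_adj (hcons (y, z2))).
rewrite ulpart_herm_hcons ulpart_skewherm_hcons lastcol_herm_hcons lastcol_skewherm_hcons.
by rewrite corner_herm_hcons corner_skewherm_hcons => /(_ pU) ->.
Qed.

(** The last row and column are integrated first; this shifts the exponents of the
    remaining pivots in such a way that [factorS] matches the factors of the value. *)
Lemma has_int_integrand n a s t :
  (forall k, (k < n)%N -> 0 < Re (a k + n%:R - k%:R)) ->
  (forall k, (k < n)%N -> 0 < Re (s k + t k - a k - 3 * n%:R + k%:R + 1)) ->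
  has_int (prodm (LM n) (LM n)) (integrand a s t)
    (\prod_(k < n) factor n k (a k) (s k) (t k)).
Proof.
elim: n a s t => [|n IH] a s t Ha Hs.
  rewrite big_ord0; apply: has_int_total.
  exact: vlebesgue0.
have [mh mhE] := mpres_hcons2 n.
apply/(has_int_preserving _ mh mhE); first exact: cmeas_integrand.
pose K a s t := factor n.+1 n (a n) (s n) (t n).
have conds a' s' t' :
    (forall k, (k < n.+1)%N -> 0 < Re (a' k + n.+1%:R - k%:R)) ->
    (forall k, (k < n.+1)%N -> 0 < Re (s' k + t' k - a' k - 3 * n.+1%:R + k%:R + 1)) ->
    has_int (prodm (LM n) (LM n)) (fun p => K a' s' t' * integrand
       (fun k => a' k + 1) (fun k => s' k - 1) (fun k => t' k - 1) p)
     (\prod_(k < n.+1) factor n.+1 k (a' k) (s' k) (t' k)).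
  move=> Ha' Hs'; rewrite big_ord_recr/= mulrC; apply: has_intZ.
  under eq_bigr do rewrite factorS.
  apply: IH => k kn.
    have := Ha' k (ltnW kn); rewrite (_ : a' k + 1 + n%:R - k%:R = a' k + n.+1%:R - k%:R)//.
    by rewrite -(natr1 n); ring.
  have := Hs' k (ltnW kn); congr (0 < Re _).
  by rewrite -(natr1 n); ring.
have inner a' s' t' p :
    (forall k, (k < n.+1)%N -> 0 < Re (a' k + n.+1%:R - k%:R)) ->
    (forall k, (k < n.+1)%N -> 0 < Re (s' k + t' k - a' k - 3 * n.+1%:R + k%:R + 1)) ->
    has_int (prodm (prodm (LV n) leb) (prodm (LV n) leb))
      (fun z => (integrand a' s' t' \o @hcons2 n) (p, z))
      (K a' s' t' * integrand
       (fun k => a' k + 1) (fun k => s' k - 1) (fun k => t' k - 1) p).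
  move=> Ha' Hs'; case: p => x y.
  have [pT|nT] := pselect (posd (herm_of x)); last first.
    rewrite [X in _ * X]weight_eq0 ?mulr0//; last exact: herm_of_adj.
    apply: (has_int_ext _ (has_int0 _)) => z; rewrite /comp integrand_hcons2.
    by rewrite [X in X * _]weight_eq0 ?mul0r//; exact: herm_of_adj.
  have a0 : 0 < Re (a' n + 1).
    have := Ha' n (leqnn _); rewrite (_ : a' n + n.+1%:R - n%:R = a' n + 1)//.
    by rewrite -(natr1 n); ring.
  have c0 : 0 < Re (s' n + t' n - a' n - (2 * n + 2)%:R).
    have := Hs' n (leqnn _); congr (0 < Re _).
    by rewrite -(natr1 n) natrD natrM; ring.
  have := has_intZ (integrand a' s' t' (x, y)) (has_int_border pT (skewherm_of_adj y) a0 c0).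
  have -> : integrand (fun k => a' k + 1) (fun k => s' k - 1) (fun k => t' k - 1) (x, y) =
    (\det (1%:M + herm_of x + skewherm_of y) * (\det (1%:M + herm_of x + skewherm_of y))^* *
      \det (herm_of x)) * integrand a' s' t' (x, y).
    exact: weight_shift pT (skewherm_of_adj y).
  rewrite [K a' s' t' * _]mulrA [K a' s' t' * _ * _]mulrC.
  rewrite (_ : K a' s' t' = rpow 2 (2 - s' n - t' n) * (pi ^+ (2 * n + 1))%:C *
      (Gamma (a' n + 1) * Gamma (s' n + t' n - a' n - (2 * n + 2)%:R) *
      ((Gamma (s' n))^-1 * (Gamma (t' n))^-1))).
    by apply: has_int_ext => z; rewrite /comp integrand_hcons2.
  rewrite /K /factor; congr (rpow _ _ * _ * (Gamma _ * Gamma _ * ((Gamma _)^-1 * (Gamma _)^-1)));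
    rewrite -(natr1 n) ?natrD ?natrM; ring.
have Hm k (kn : (k < n.+1)%N) : 0 < Re (qmean (s k) (t k) + qmean (s k) (t k) - (Re (a k))%:C
    - 3 * n.+1%:R + k%:R + 1).
  by have := Hs k kn; rewrite !(ReD, ReN) -!ReD qmean_sum.
have Ham k (kn : (k < n.+1)%N) : 0 < Re ((Re (a k))%:C + n.+1%:R - k%:R).
  by have := Ha k kn; rewrite !(ReD, ReN).
have mf a' s' t' : cmeas (integrand a' s' t' \o @hcons2 n).
  exact: cmeas_comp mh (cmeas_integrand n.+1 a' s' t').
apply: (@has_int_fubini _ _ _ _ _ (prodm (LM n) (LM n))
  (prodm (prodm (LV n) leb) (prodm (LV n) leb))
  (\prod_(k < n.+1) expR (`|Im (s k) - Im (t k)| * (pi / 2)))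
  _ (integrand (fun k => (Re (a k))%:C) (fun k => qmean (s k) (t k)) (fun k => qmean (s k) (t k)) \o @hcons2 n)
  _ _ _ _ (mf _ _ _) (mf _ _ _) _ _ (fun p => inner _ _ _ p Ha Hs) (fun p => inner _ _ _ p Ham Hm)
  (conds _ _ _ Ha Hs) (conds _ _ _ Ham Hm)).
- by move=> w; have [] := weight_bound a s t (herm_of (hcons2 w).1)
    (1%:M + herm_of (hcons2 w).1 + skewherm_of (hcons2 w).2).
- by move=> w; have [] := weight_bound a s t (herm_of (hcons2 w).1)
    (1%:M + herm_of (hcons2 w).1 + skewherm_of (hcons2 w).2).
Qed.

End weight_induction.

(** * Logarithms of the eigenvalues and of the pivots *)

Section eigenvalue_logarithms.
Context (R : realType).
Local Notation C := R[i].
Local Notation normc := (@ComplexField.Normc.normc R).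
Local Notation Re := (@complex.Re R).
Local Notation Im := (@complex.Im R).

Lemma char_poly_eigenvals n (A : 'M[C]_n) :
  char_poly A = \prod_(mu <- eigenvals A) ('X - mu%:P).
Proof.
rewrite /eigenvals; case: closed_field_poly_normal => s /= {1}->.
by have /monicP -> := char_poly_monic A; rewrite scale1r.
Qed.

(** The determinant of [A + x] is the value of the characteristic polynomial at [- x], up
    to sign. *)
Lemma det_addM n (A : 'M[C]_n) (x : C) :
  \det (A + x%:M) = \prod_(mu <- eigenvals A) (mu + x).
Proof.
have sz : size (eigenvals A) = n.
  by apply: succn_inj; rewrite -(size_prod_XsubC _ id) -char_poly_eigenvals size_char_poly.
have E : (char_poly A).[- x] = \det ((-1) *: (A + x%:M)).
  rewrite scaleN1r /char_poly -horner_evalE -det_map_mx; congr (\det _).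
  apply/matrixP => k m; rewrite !mxE /= horner_evalE hornerD hornerN hornerC hornerMn hornerX.
  by rewrite opprD addrC mulNrn.
move: E; rewrite char_poly_eigenvals horner_prod detZ.
under eq_bigr do rewrite hornerXsubC -opprD addrC -mulN1r.
rewrite big_split /= big_const_seq count_predT sz iter_mulr_1 => /mulfI -> //.
by rewrite expf_neq0// oppr_eq0 oner_eq0.
Qed.

Definition accretive n (A : 'M[C]_n) := forall v, v != 0 -> 0 < qform A v.

(** The form [qform A] at an eigenvector [v] is [mu * |v| ^ 2]. *)
Lemma eigenvals_Re_gt0 n (A : 'M[C]_n) mu : accretive A -> mu \in eigenvals A -> 0 < Re mu.
Proof.
move=> pA mu_in; have : eigenvalue A mu.
  by rewrite eigenvalue_root_char char_poly_eigenvals root_prod_XsubC.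
move=> /eigenvalueP[v vA v0].
have w0 : v^t* != 0.
  by apply: contra_neq v0 => w0; rewrite -[v]adjK w0 trmx0 map_mx0.
have := pA _ w0; have := (posd1 R n).2 _ w0.
have E : (v *m A *m v^t*) 0 0 = mu * (v *m v^t*) 0 0 by rewrite vA -scalemxAl mxE.
rewrite /qform adjK mulmx1 E ReM.
have -> : Im ((v *m v^t*) 0 0) = 0.
  have := herm_form_real (v^t*) (adj1 R n); by rewrite adjK mulmx1.
by rewrite mulr0 subr0 => p0; rewrite pmulr_lgt0.
Qed.

Definition logdet n (A : 'M[C]_n) : C := \sum_(mu <- eigenvals A) clog mu.

Lemma logdet_rlog n (A : 'M[C]_n) : accretive A ->
  logdet A = \sum_(mu <- eigenvals A) rlog mu.
Proof.
move=> pA; apply: eq_big_seq => mu mu_in.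
by rewrite rlog_clog//; exact: eigenvals_Re_gt0 mu_in.
Qed.

Lemma Im_rlog_cvg0 (mu : C) : 0 < Re mu ->
  Im (rlog (mu + (k.+1%:R ^+ 2)%:C)) @[k --> \oo] --> (0 : R).
Proof.
move=> mu0; rewrite -[0 in X in _ --> X]atan0 /rlog /=.
apply: continuous_cvg; first exact: continuous_atan.
apply/cvgr0Pnorm_le => /= e e0.
have H : `|Im mu| * harmonic k @[k --> \oo] --> (0 : R).
  by rewrite -[0](mulr0 `|Im mu|); apply: cvgMr; exact: cvg_harmonic.
move/cvgr0Pnorm_le : H => /(_ _ e0); apply: filterS => k.
apply: le_trans; rewrite ImD /= addr0 ReD /=.
have k0 : 0 < k.+1%:R :> R by [].
have d0 : k.+1%:R <= Re mu + k.+1%:R ^+ 2 :> R.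
  have k1 : 1 <= k.+1%:R :> R by rewrite ler1n.
  by move: k1 mu0; move: (k.+1%:R) (Re mu) => K x k1 x0; nra.
rewrite !normrM normr_id ler_wpM2l// normfV (gtr0_norm (lt_le_trans k0 d0)).
by rewrite ger0_norm ?harmonic_ge0// lef_pV2 ?posrE// (lt_le_trans k0).
Qed.

Lemma sum_Im_rlog_cvg0 (s : seq C) : (forall mu, mu \in s -> 0 < Re mu) ->
  \sum_(mu <- s) Im (rlog (mu + (k.+1%:R ^+ 2)%:C)) @[k --> \oo] --> (0 : R).
Proof.
elim: s => [|mu s IH] s0.
  by under eq_fun do rewrite big_nil; exact: cvg_cst.
under eq_fun do rewrite big_cons.
have s1 : forall nu, nu \in s -> 0 < Re nu by move=> nu nus; apply: s0; rewrite in_cons nus orbT.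
have H := cvgD (Im_rlog_cvg0 (s0 mu (mem_head _ _))) (IH s1).
by rewrite addr0 in H; exact: H.
Qed.

Lemma cexp_eq1 w : cexp w = 1 -> `|Im w| < pi -> w = 0.
Proof.
move=> w1 wpi.
have r0 : Re w = 0.
  have := congr1 normc w1; rewrite normc_cexp (normc_real 1) normr1 => /eqP.
  by rewrite -expR0 => /eqP/expR_inj.
apply: complex_ext => //=; apply/eqP; apply: contraT => i0.
have : sin (Im w) = 0 by have := congr1 Im w1; rewrite Im_cexp r0 expR0 mul1r.
have: 0 < sin `|Im w| by rewrite sin_gt0_pi// normr_gt0 i0.
by case: ger0P => _; rewrite ?sinN => + s0; rewrite s0 ?oppr0 ltxx.
Qed.

Lemma cexp_neq1 w : `|Im w| = pi -> cexp w != 1.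
Proof.
move=> wpi; apply/eqP => /(congr1 Re); rewrite Re_cexp -cos_norm wpi cospi mulrN1 /=.
by have := expR_gt0 (Re w); lra.
Qed.

(** An imaginary part that passed from [|Im| < pi] to [|Im| >= pi] would take the value
    [pi] or [- pi], where [cexp] is negative. *)
Lemma cexp_path (f : R -> C) (b : R) : (forall y, Im (f t) @[t --> y] --> Im (f y)) -> (forall y, cexp (f y) = 1) ->
  0 <= b -> `|Im (f b)| < pi -> f 0 = 0.
Proof.
move=> cf f1 b0 fb; apply: cexp_eq1 => //; rewrite ltNge; apply/negP => f0.
have cg : {within `[0, b], continuous (fun y => `|Im (f y)|)}.
  apply: continuous_subspaceT => y.
  exact: (cvg_norm (cf y)).
have [|y _ fy] := IVT b0 cg (v := pi).
  by rewrite ge_min le_max (ltW fb) f0 orbT.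
by have := cexp_neq1 fy; rewrite f1 eqxx.
Qed.

Lemma cvg_Im_rlog (f : R -> C) y : 0 < Re (f y) -> ccont f y ->
  Im (rlog (f t)) @[t --> y] --> Im (rlog (f y)).
Proof.
move=> f0 [f1 f2]; apply: (continuous_cvg _ (@continuous_atan R _)).
by apply: cvgM => //; apply: cvgV => //; rewrite gt_eqF.
Qed.

Lemma cvg_Im_sum (s : seq C) (f : C -> R -> C) y :
  (forall mu, mu \in s -> Im (f mu t) @[t --> y] --> Im (f mu y)) ->
  Im (\sum_(mu <- s) f mu t) @[t --> y] --> Im (\sum_(mu <- s) f mu y).
Proof.
elim: s => [|mu s IH] fs.
  by under eq_fun do rewrite big_nil; rewrite big_nil; exact: cvg_cst.
under eq_fun do rewrite big_cons ImD; rewrite big_cons ImD; apply: cvgD.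
  by apply: fs; rewrite mem_head.
by apply: IH => nu nus; apply: fs; rewrite in_cons nus orbT.
Qed.

Lemma ccont_prod (s : seq C) (f : C -> R -> C) y : (forall mu, ccont (f mu) y) ->
  ccont (fun t => \prod_(mu <- s) f mu t) y.
Proof.
move=> cf; elim: s => [|mu s IH].
  by under eq_fun do rewrite big_nil; exact: ccont_cst.
by under eq_fun do rewrite big_cons; exact: ccontM.
Qed.

Lemma ccontV (f : R -> C) y : f y != 0 -> ccont f y -> ccont (fun t => (f t)^-1) y.
Proof.
move=> f0 [f1 f2].
have n0 : normc (f y) ^+ 2 != 0 by rewrite gt_eqF// exprn_gt0// normc_gt0.
have cn : normc (f t) ^+ 2 @[t --> y] --> normc (f y) ^+ 2.
  under eq_fun do rewrite sqr_normc; rewrite sqr_normc.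
  by apply: cvgD; under eq_fun do rewrite expr2; rewrite expr2; exact: cvgM.
split.
  by under eq_fun do rewrite ReV; rewrite ReV; apply: cvgM => //; exact: cvgV.
by under eq_fun do rewrite ImV; rewrite ImV; apply: cvgM; [exact: cvgN|exact: cvgV].
Qed.

Lemma ccont_addsq (c : C) y : ccont (fun t => c + (t ^+ 2)%:C) y.
Proof.
apply: ccontD; first exact: ccont_cst.
by apply: ccont_real; exact: exprn_continuous.
Qed.

Lemma cexp_sum_rlog (s : seq C) : (forall mu, mu \in s -> 0 < Re mu) ->
  cexp (\sum_(mu <- s) rlog mu) = \prod_(mu <- s) mu.
Proof.
by move=> s0; rewrite cexp_sum; apply: eq_big_seq => mu /s0; exact: cexp_rlog.
Qed.

(** Along [A + y ^ 2] the exponentials of both sides are the same determinant. For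
    large [y] the difference of the sides has argument below [pi], and then vanishes;
    by [cexp_path] it vanishes at [y = 0]. *)
Lemma logdet_pivot n (A : 'M[C]_n.+1) : accretive A -> accretive (ulpart A) ->
  (forall y : R, 0 < Re (pivot (A + (y ^+ 2)%:C%:M))) ->
  logdet A = logdet (ulpart A) + rlog (pivot A).
Proof.
move=> pA pU pp; have eA := eigenvals_Re_gt0 pA; have eU := eigenvals_Re_gt0 pU.
have addsq (s : seq C) y : (forall mu, mu \in s -> 0 < Re mu) ->
    forall mu, mu \in s -> 0 < Re (mu + (y ^+ 2)%:C).
  by move=> s0 mu /s0 ?; rewrite ReD /= ltr_pwDl// sqr_ge0.
have pvE y : pivot (A + (y ^+ 2)%:C%:M) =
    (\prod_(mu <- eigenvals A) (mu + (y ^+ 2)%:C)) /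
    (\prod_(mu <- eigenvals (ulpart A)) (mu + (y ^+ 2)%:C)).
  rewrite /pivot det_addM (_ : ulpart _ = ulpart A + (y ^+ 2)%:C%:M) ?det_addM//.
  by apply/matrixP => k m; rewrite !mxE (inj_eq (@lift_inj _ _)).
have prod0 y : \prod_(mu <- eigenvals (ulpart A)) (mu + (y ^+ 2)%:C) != 0.
  rewrite prodf_seq_neq0; apply/allP => mu /(addsq _ y eU) /Re_neq0.
  by move=> h; apply/implyP.
pose f y : C := \sum_(mu <- eigenvals A) rlog (mu + (y ^+ 2)%:C) -
  \sum_(mu <- eigenvals (ulpart A)) rlog (mu + (y ^+ 2)%:C) -
  rlog (pivot (A + (y ^+ 2)%:C%:M)).
have f1 y : cexp (f y) = 1.
  rewrite /f !cexpD !cexpN cexp_rlog ?pp// pvE.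
  rewrite -!(big_map (fun mu => mu + (y ^+ 2)%:C) xpredT (fun mu => rlog mu)).
  rewrite !cexp_sum_rlog; last 2 first.
  - by move=> _ /mapP[mu /(addsq _ y eU) ? ->].
  - by move=> _ /mapP[mu /(addsq _ y eA) ? ->].
  rewrite !big_map divff// mulf_neq0 ?invr_eq0//.
  rewrite prodf_seq_neq0; apply/allP => mu /(addsq _ y eA) /Re_neq0.
  by move=> h; apply/implyP.
have cf y : Im (f t) @[t --> y] --> Im (f y).
  rewrite /f; under eq_fun do rewrite !ImD !ImN; rewrite !ImD !ImN.
  apply: cvgB; first apply: cvgB.
  - apply: cvg_Im_sum => mu mus; apply: cvg_Im_rlog; last exact: ccont_addsq.
    exact: addsq mus.
  - apply: cvg_Im_sum => mu mus; apply: cvg_Im_rlog; last exact: ccont_addsq.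
    exact: addsq mus.
  - apply: cvg_Im_rlog => //; under eq_fun do rewrite pvE.
    apply: ccontM.
      by apply: ccont_prod => mu; exact: ccont_addsq.
    by apply: ccontV => //; apply: ccont_prod => mu; exact: ccont_addsq.
have [b b0 fb] : exists2 b : R, 0 <= b & `|Im (f b)| < pi.
  have H := cvgB (sum_Im_rlog_cvg0 eA) (sum_Im_rlog_cvg0 eU); rewrite subr0 in H.
  have p2 : 0 < pi / 2 :> R by rewrite divr_gt0 ?pi_gt0.
  have [N _ HN] := (cvgr0Pnorm_lt _).1 (H _) _ p2.
  exists N.+1%:R => //; have := HN N (leqnn N) => /= h.
  rewrite /f !ImD !ImN !Im_sum.
  have := normc_rlog_arg (pivot (A + (N.+1%:R ^+ 2)%:C%:M)).
  move: h; set a := (_ - _); set c := Im (rlog _) => h h'.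
  by apply: le_lt_trans (ler_normB _ _) _; lra.
have := cexp_path cf f1 b0 fb; rewrite /f expr0n /=.
under eq_bigr do rewrite addr0; under [X in _ - X - _ = _ -> _]eq_bigr do rewrite addr0.
rewrite (_ : A + 0%:M = A); last by rewrite raddf0 addr0.
by rewrite (logdet_rlog pA) (logdet_rlog pU) => /eqP; rewrite subr_eq add0r subr_eq addrC => /eqP.
Qed.

End eigenvalue_logarithms.

(** * Powers of the leading minors *)

Section power_products.
Context (R : realType).
Local Notation C := R[i].
Local Notation normc := (@ComplexField.Normc.normc R).
Local Notation Re := (@complex.Re R).
Local Notation Im := (@complex.Im R).

Lemma ulblock_widen n (A : 'M[C]_n.+1) (j : 'I_n) :
  ulblock (widen_ord (leqnSn n) j) A = ulblock j (ulpart A).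
Proof.
by apply/matrixP => k m; rewrite !mxE; congr (A _ _); apply/esym/val_inj; exact: lift_max.
Qed.

Lemma ulblock_max n (A : 'M[C]_n.+1) : ulblock ord_max A = A.
Proof. by apply/matrixP => k m; rewrite !mxE; congr (A _ _); exact: val_inj. Qed.

Lemma detpowE n (A : 'M[C]_n) s t : detpow A s t = cexp (s * logdet A + t * (logdet A)^*).
Proof. by rewrite /detpow /logdet rmorph_sum. Qed.

Lemma logdet_mx0 (A : 'M[C]_0) : logdet A = 0.
Proof.
rewrite /logdet; have : size (eigenvals A) = 0%N.
  by apply: succn_inj; rewrite -(size_prod_XsubC _ id) -char_poly_eigenvals size_char_poly.
by move/size0nil ->; rewrite big_nil.
Qed.

Lemma accretive_shift n (T S : 'M[C]_n) : posd T -> S^t* = - S -> accretive (1%:M + T + S).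
Proof.
move=> pT hS v v0; rewrite qformD (qform_skew hS) addr0.
by case: (posdD (posd1 R n) pT) => _; exact.
Qed.

Lemma posd_addsq n (T : 'M[C]_n) (y : R) : posd T -> posd (T + (y ^+ 2)%:C%:M).
Proof.
move=> [hT pT]; split.
  by rewrite adjD hT tr_scalar_mx map_scalar_mx /= conjcE conjc_real.
move=> v v0; rewrite qformD ltr_pwDl ?pT//.
rewrite /qform mul_mx_scalar -scalemxAl mxE ReM /= mul0r subr0 mulr_ge0 ?sqr_ge0//.
by have := posd_ge0 v (posd1 R n); rewrite /qform mulmx1.
Qed.

Lemma logdet_shift n (T S : 'M[C]_n.+1) : posd T -> S^t* = - S ->
  logdet (1%:M + T + S) = logdet (1%:M + ulpart T + ulpart S) + rlog (pivot (1%:M + T + S)).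
Proof.
move=> pT hS; have [hT _] := pT; have [pU _] := (posd_recr hT).1 pT.
rewrite -ulpart_shift; apply: logdet_pivot.
- exact: accretive_shift.
- by rewrite ulpart_shift; apply: accretive_shift => //; exact: skew_ulpart.
- move=> y; rewrite (_ : 1%:M + T + S + _ = 1%:M + (T + (y ^+ 2)%:C%:M) + S).
    by apply: Re_pivot_shift => //; exact: posd_addsq.
  by rewrite addrAC -[1%:M + T + _]addrA.
Qed.

Lemma det_posd n (T : 'M[C]_n) : posd T -> 0 < Re (\det T) /\ \det T = (Re (\det T))%:C.
Proof.
elim: n T => [|n IH] T pT; first by rewrite det_mx00 /=.
have [hT _] := pT; have [pU r0] := (posd_recr hT).1 pT; have [d0 dE] := IH _ pU.
by rewrite (det_pivot (posd_unit pU)) (pivot_real pT) dE -rmorphM /= mulr_gt0.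
Qed.

(** Induction on the size: the leading minor of size [n] occurs with the exponents of
    index [n] minus those of index [n + 1], and its pivots occur in all later minors. *)
Lemma weight_product n (lam sig tau : nat -> C) (T S : 'M[C]_n) : posd T -> S^t* = - S ->
  \prod_(j < n) (cpow (\det (ulblock j T)) (lam j.+1 - lam j.+2) /
    detpow (ulblock j (1%:M + T + S)) (sig j.+1 - sig j.+2) (tau j.+1 - tau j.+2)) =
  weight (fun k => lam k.+1) (fun k => sig k.+1) (fun k => tau k.+1) T (1%:M + T + S) *
  (cpow (\det T) (- lam n.+1) / detpow (1%:M + T + S) (- sig n.+1) (- tau n.+1)).
Proof.
elim: n T S => [|n IH] T S pT hS.
  rewrite big_ord0 mul1r detpowE logdet_mx0 det_mx00 (rpow_cpow _ ltr01) rpow1l.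
  by rewrite rmorph0 !mulr0 addr0 cexp0 divr1.
have [hT _] := pT; have [pU r0] := (posd_recr hT).1 pT.
have [d0 dE] := det_posd pT; have [d0' dE'] := det_posd pU.
rewrite big_ord_recr /=.
under eq_bigr do rewrite !ulblock_widen ulpart_shift.
rewrite (IH _ _ pU (skew_ulpart hS)) !ulblock_max /= r0 ulpart_shift.
rewrite !detpowE (logdet_shift pT hS) dE dE' !rpow_cpow// -!cexpN.
have dM : Re (\det T) = Re (pivot T) * Re (\det (ulpart T)).
  by rewrite (det_pivot (posd_unit pU)) (pivot_real pT) dE' -rmorphM.
rewrite dM !rpowM// qpowE.
set x := Re (pivot T); set d := Re (\det _); set q := rlog _; set L := logdet _.
set w := weight _ _ _ _ _; clearbody x d q L w.
rewrite rmorphD/= !rpowE -!cexpD -[LHS]mulrA -[RHS]mulrA -!cexpD; congr (_ * cexp _).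
ring.
Qed.

(** Subtracting [2 n] from all [lam] does not change their differences but leaves
    a factor [det T ^ (2 n)] from the index [n + 1]. *)
Lemma weight_integrand n (lam sig tau : nat -> C) (T S : 'M[C]_n) :
  lam n.+1 = 0 -> sig n.+1 = 0 -> tau n.+1 = 0 -> posd T -> S^t* = - S ->
  (\prod_(j < n) (cpow (\det (ulblock j T)) (lam j.+1 - lam j.+2) /
    detpow (ulblock j (1%:M + T + S)) (sig j.+1 - sig j.+2) (tau j.+1 - tau j.+2))) *
    (\det T) ^- (2 * n) =
  weight (fun k => lam k.+1 - (2 * n)%:R) (fun k => sig k.+1) (fun k => tau k.+1)
    T (1%:M + T + S).
Proof.
move=> lam0 sig0 tau0 pT hS; have [d0 dE] := det_posd pT.
have := weight_product (fun k => lam k - (2 * n)%:R) sig tau pT hS.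
rewrite sig0 tau0 oppr0 detpowE !mul0r addr0 cexp0 divr1 lam0 sub0r opprK.
rewrite dE rpow_cpow// rpow_nat// rmorphXn /= -dE => E.
rewrite (_ : \prod_(j < n) _ = weight (fun k => lam k.+1 - (2 * n)%:R) (fun k => sig k.+1)
   (fun k => tau k.+1) T (1%:M + T + S) * \det T ^+ (2 * n)).
  by rewrite mulfK// expf_neq0// Re_neq0.
rewrite -E; apply: eq_bigr => j _; congr (cpow _ _ / _).
by rewrite opprB addrA subrK.
Qed.

Lemma weight_neq0 n a s t (T Q : 'M[C]_n) : posd T -> weight a s t T Q != 0.
Proof.
elim: n T Q => [|n IH] T Q pT; first by rewrite oner_eq0.
have [hT _] := pT; have [pU r0] := (posd_recr hT).1 pT.
by rewrite /= r0 !mulf_neq0 ?IH ?rpow_neq0 ?qpow_neq0.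
Qed.

Lemma dissipative_herm n (x y : (n * n).-tuple R) :
  dissipative (herm_of x + skewherm_of y) <-> posd (herm_of x).
Proof.
rewrite /dissipative /= posdefP adjD herm_of_adj skewherm_of_adj addrACA subrr addr0.
split=> [[_ p]|p]; last exact: posdD.
split=> [|v v0]; first exact: herm_of_adj.
by have := p v v0; rewrite qformD -mulr2n pmulrn_lgt0.
Qed.

(** Positive definiteness is the nonvanishing of the weight with zero exponents, which is
    measurable in the coordinates. *)
Lemma measurable_posd n :
  measurable [set p : (n * n).-tuple R * (n * n).-tuple R | posd (herm_of p.1 : 'M[C]_n)].
Proof.
pose f (p : (n * n).-tuple R * (n * n).-tuple R) := integrand (fun=> 0) (fun=> 0) (fun=> 0) p : C.
have mf := measurable_gt0 (measurable_normc (@cmeas_integrand R n (fun=> 0) (fun=> 0) (fun=> 0))).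
rewrite (_ : mkset _ = (fun p => 0 < normc (f p)) @^-1` [set true]).
  by rewrite -[X in measurable X]setTI; exact: mf.
apply/seteqP; split=> p /=; rewrite normc_gt0 => h; first exact: weight_neq0.
apply: contrapT => np; move: h; rewrite /f /integrand weight_eq0 ?eqxx//.
exact: herm_of_adj.
Qed.

End power_products.

Theorem mainTheorem5 (R : realType) (n : nat) (lam sig tau : nat -> R[i])
    (n_ge1 : (1 <= n)%N)
    (lam_end : lam n.+1 = 0) (sig_end : sig n.+1 = 0) (tau_end : tau n.+1 = 0)
    (Hlam : forall k : nat, (1 <= k <= n)%N ->
      0 < complex.Re (lam k - n%:R - k%:R + 1))
    (Hsig : forall k : nat, (1 <= k <= n)%N ->
      0 < complex.Re (sig k + tau k - lam k - n%:R + k%:R)) :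
  let dTdS := (lebesgue_tuple R (n * n) \x lebesgue_tuple R (n * n))%E in
  let T (p : (n * n).-tuple R * (n * n).-tuple R) : 'M[R[i]]_n := herm_of p.1 in
  let S (p : (n * n).-tuple R * (n * n).-tuple R) : 'M[R[i]]_n := skewherm_of p.2 in
  let D := [set p | dissipative (T p + S p)] in
  let f p :=
    (\prod_(j < n)
       (cpow (\det (ulblock j (T p))) (lam j.+1 - lam j.+2) /
        detpow (ulblock j (1%:M + T p + S p))
          (sig j.+1 - sig j.+2) (tau j.+1 - tau j.+2)))
    * (\det (T p)) ^- (2 * n) in
  cintegrable dTdS D f /\
  cintegral dTdS D f =
    \prod_(1 <= k < n.+1)
      (cpow 2%:R (2%:R * (n%:R - k%:R + 1) - sig k - tau k)
       * (pi%:C) ^+ (2 * k - 1)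
       * (Gamma (lam k - n%:R - k%:R + 1)
          * Gamma (sig k + tau k - lam k - n%:R + k%:R)
          / (Gamma (sig k - n%:R + k%:R) * Gamma (tau k - n%:R + k%:R)))).
Proof.
move=> dTdS T S D f.
pose a k := lam k.+1 - (2 * n)%:R; pose s k := sig k.+1; pose t k := tau k.+1.
have Ha k : (k < n)%N -> 0 < complex.Re (a k + n%:R - k%:R).
  move=> kn; have := Hlam k.+1 kn; congr (0 < complex.Re _).
  by rewrite /a -(natr1 k) natrM; ring.
have Hs k : (k < n)%N -> 0 < complex.Re (s k + t k - a k - 3 * n%:R + k%:R + 1).
  move=> kn; have := Hsig k.+1 kn; congr (0 < complex.Re _).
  by rewrite /s /t /a -(natr1 k) natrM; ring.
have DE p : D p <-> posd (herm_of p.1 : 'M[R[i]]_n) by exact: dissipative_herm.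
have mD : measurable D.
  rewrite (_ : D = [set p | posd (herm_of p.1 : 'M[R[i]]_n)]); first exact: measurable_posd.
  by apply/seteqP; split=> p /DE.
have on p : D p -> integrand a s t p = f p.
  move=> /DE pT; apply/esym.
  exact: (weight_integrand lam_end sig_end tau_end pT (skewherm_of_adj _)).
have off p : ~ D p -> integrand a s t p = 0.
  move=> nD; apply: weight_eq0; first exact: herm_of_adj.
  by move=> pT; apply: nD; exact/DE.
have [iD vD] := has_int_restrict mD on off (has_int_integrand Ha Hs).
split; first exact: iD.
rewrite (_ : \prod_(1 <= k < n.+1) _ = \prod_(k < n) factor n k (a k) (s k) (t k)); first exact: vD.
rewrite big_add1 /= big_mkord; apply: eq_bigr => k _.
have c2 (z : R[i]) : cpow 2%:R z = rpow 2 z by rewrite -rpow_cpow// rmorph_nat.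
rewrite /factor c2 -invfM rmorphXn /=.
have -> : (2 * k.+1 - 1 = 2 * k + 1)%N by rewrite mulnS -addnBAC// addnC.
congr (rpow _ _ * _ * (Gamma _ * Gamma _ / (Gamma _ * Gamma _)));
  rewrite /a /s /t -?(natr1 k) ?natrM; ring.
Qed.
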